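(* Let $(X,\mathscr F)$ be a formal category of smooth type with $X=\mathrm{Spec}(A)$ affine and $L=\Lambda(X)$. Suppose $(E,\eta)$ is an MC complex and $F$ is a complex of $A$-modules, both $E$ and $F$ being bounded complexes of locally free $A$-modules. Suppose $a_0:E\rightarrow F$ is a quasiisomorphism of complexes of $A$-modules. Then there exist an MC element $\varphi$ for $F$ and an element $$a\in Q^0(E,F),\qquad P(a)=P_0(a)=a_0,\qquad d_{\eta,\varphi}(a)=0.$$ The same holds for a quasiisomorphism going in the other direction: given a quasiisomorphism $b_0:F\to E$ of complexes of $A$-modules, there exist an MC element $\varphi$ for $F$ and $b\in Q^0(F,E)$ with $P(b)=P_0(b)=b_0$ and $d_{\varphi,\eta}(b)=0$.
   Context: Formal categories. Over $\mathbb C$, a formal category of smooth type $(X,\mathscr F)$ is a separated scheme of finite type $X$ with a formal scheme $\mathscr F$ and maps $i:X\to\mathscr F$, $\mathscr F\rightrightarrows X$, $m:\mathscr F\times_X\mathscr F\to\mathscr F$ inducing a functor from schemes to groupoids, $\mathscr F$ supported along $i(X)$. It corresponds to a complete sheaf of algebras $\mathbf f$ over $\mathscr O_{X\times X}$, with $\mathbf j$ the ideal of $i(X)$, $\mathbf j^k/\mathbf j^{k+1}$ locally free of finite rank over $\mathscr O_X$ and $Gr_{\mathbf j}(\mathbf f)\cong Sym^\cdot(\mathbf j/\mathbf j^2)$. $\Lambda=\bigcup_kJ_k\Lambda$, $J_k\Lambda=\mathrm{Hom}_{\mathscr O_X,\mathrm{left}}(\mathbf f/\mathbf j^{k+1},\mathscr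 O_X)$, with ring structure $\varphi\psi=\varphi\circ(1\otimes\psi)\circ m^*$. For $X=\mathrm{Spec}(A)$, $L=\Lambda(X)$ is filtered by $J_kL$ with $J_0L=A$, so $L$ has left and right $A$-module structures. The complex $Q$. Tensor products $\otimes_A$ contract inner structures (right structure of the left factor with left structure of the right factor). $T^nL=L\otimes_A\cdots\otimes_AL$ ($n$ factors), $T^0L=A$, $TL=\bigoplus_{n\ge0}T^nL$; likewise $TA=\bigoplus_{n}T^nA\subset TL$, with each $T^nA\cong A$. For complexes of $A$-modules $E,F$, $Q(E,F)=\mathrm{Hom}_A(TL\otimes_AE,F)$: an element $q\in Q^i(E,F)$ is a collection over $k\ge0$ of multilinear functions $q(u_1,\ldots,u_k;e)\in F^{i+j-k}$ ($u_l\in L$, $e\in E^j$) with $q(au_1,\ldots;e)=aq(u_1,\ldots;e)$, $q(\ldots,u_la,u_{l+1},\ldots;e)=q(\ldots,u_l,au_{l+1},\ldots;e)$, $q(\ldots,u_ka;e)=q(\ldots,u_k;ae)$. The differential is $$(d_Qq)(u_1,\ldots,u_k;e)=d_Fq(u_1,\ldots,u_k;e)-(-1)^{i+k}q(u_1,\ldots,u_k;d_Ee)+\sum_{l=1}^{k-1}(-1)^{i+l}q(u_1,\ldots,u_lu_{l+1},\ldots,u_k;e).$$ For $q\in Q(E,F)$ and $p\in Q(F,G)$ the product is $(pq)(u_1,\ldots,u_k;e)=\sum_{j=0}^k(-1)^{j|q|}p(u_1,\ldots,u_j;q(u_{j+1},\ldots,u_k;e))$. $P:Q(E,F)\to\mathrm{Hom}_A(TA\otimes_AE,F)$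 is restriction to $TA$, and $P_0:Q(E,F)\to\mathrm{Hom}_A(E,F)$ is its $T^0A$ component; ''$P(a)=P_0(a)=a_0$'' means that $P(a)$ vanishes on $T^mA\otimes_AE$ for $m>0$ and equals $a_0$ on $T^0A\otimes_AE=E$. MC complexes. $1_E(1)\in\mathrm{Hom}_A(TA\otimes_AE,E)$ is the element of degree $1$ equal to the identity of $E$ on $T^1A\otimes_AE\cong E$ and zero on the other $T^nA\otimes_AE$. A Maurer–Cartan (MC) element for $E$ is $\eta\in Q^1(E,E)$ with $P(\eta)=1_E(1)$ and $d_Q(\eta)+\eta^2=0$; an MC complex is a pair $(E,\eta)$. For MC elements $\eta$ for $E$ and $\varphi$ for $F$, $d_{\eta,\varphi}(q)=d_Q(q)+\varphi q-(-1)^{|q|}q\eta$ on $Q(E,F)$. Locally free modules may have infinite rank, but become free on a single Zariski open covering. *)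

(* Defs.v *)
From HB Require Import structures.
From mathcomp Require Import all_boot all_order all_algebra.
From mathcomp Require Import boolp classical_sets functions reals.
From mathcomp Require Import perm complex zify.

Set Implicit Arguments.
Unset Strict Implicit.
Unset Printing Implicit Defensive.
Import Order.TTheory GRing.Theory Num.Theory.
Local Open Scope ring_scope.
Local Open Scope quotient_scope.

(* The tensor product R1 (x)_A R2, where A acts on the right of R1 through r and
   on the left of R2 through l. *)
Section Tensor.
Variables (A R1 R2 : comPzRingType).
Variables (r : {rmorphism A -> R1}) (l : {rmorphism A -> R2}).

Definition balanced (V : zmodType) (b : R1 -> R2 -> V) : Prop :=
  [/\ forall x x' y, b (x + x') y = b x y + b x' y,
      forall x y y', b x (y + y') = b x y + b x y' &
      forall x a y, b (x * r a) y = b x (l a * y)].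

Definition fsum (V : zmodType) (b : R1 -> R2 -> V) (s : seq (R1 * R2)) : V :=
  \sum_(p <- s) b p.1 p.2.

(* Two formal sums of pure tensors are identified when no balanced map separates
   them: this is the quotient of the free abelian group on R1 x R2 by the
   balancing relations; see tlift_pure, tliftD and tens_sum below. *)
Definition teq (s t : seq (R1 * R2)) : bool :=
  `[< forall (V : zmodType) (b : R1 -> R2 -> V),
        balanced b -> fsum b s = fsum b t >].

Lemma teq_equiv : equiv_class_of teq.
Proof.
split=> [s|s t|t s u].
- exact/asboolP.
- by apply/asboolP/asboolP => h V b /h.
- by move=> /asboolP h1 /asboolP h2; apply/asboolP => V b hb; rewrite h1 ?h2.
Qed.
Canonical teq_canonical := EquivRelPack teq_equiv.

Definition tens := {eq_quot teq}.
HB.instance Definition _ := Choice.on tens.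

Definition tclass (s : seq (R1 * R2)) : tens := \pi_tens s.
Definition pure (x : R1) (y : R2) : tens := tclass [:: (x, y)].

Lemma tclassP s t : (tclass s = tclass t) <->
  (forall (V : zmodType) (b : R1 -> R2 -> V), balanced b -> fsum b s = fsum b t).
Proof. by split=> [/eqquotP/asboolP|h]; [|apply/eqquotP/asboolP]. Qed.

Lemma fsum_repr (V : zmodType) (b : R1 -> R2 -> V) s :
  balanced b -> fsum b (repr (tclass s)) = fsum b s.
Proof. by move=> hb; apply: (tclassP _ _).1 => //; rewrite /tclass reprK. Qed.

Lemma fsum_cat (V : zmodType) (b : R1 -> R2 -> V) s t :
  fsum b (s ++ t) = fsum b s + fsum b t.
Proof. exact: big_cat. Qed.

Definition fopp (s : seq (R1 * R2)) := [seq (- p.1, p.2) | p <- s].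
Definition fmul (s t : seq (R1 * R2)) :=
  [seq (p.1 * q.1, p.2 * q.2) | p <- s, q <- t].

Lemma balanced0 (V : zmodType) (b : R1 -> R2 -> V) y :
  balanced b -> b 0 y = 0.
Proof. by case=> h _ _; apply: (addIr (b 0 y)); rewrite -h !add0r. Qed.

Lemma balancedN (V : zmodType) (b : R1 -> R2 -> V) x y :
  balanced b -> b (- x) y = - b x y.
Proof.
move=> hb; apply: (addIr (b x y)).
by case: (hb) => <- _ _; rewrite !addNr balanced0.
Qed.

Lemma fsum_opp (V : zmodType) (b : R1 -> R2 -> V) s :
  balanced b -> fsum b (fopp s) = - fsum b s.
Proof.
move=> hb; rewrite /fsum big_map -sumrN.
by apply: eq_bigr => p _; rewrite balancedN.
Qed.

Lemma fsum_mul (V : zmodType) (b : R1 -> R2 -> V) s t :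
  fsum b (fmul s t) = fsum (fun x y => fsum (fun x' y' => b (x * x') (y * y')) t) s.
Proof. by rewrite /fsum big_allpairs_dep. Qed.

Lemma fsum_mulC (V : zmodType) (b : R1 -> R2 -> V) s t :
  fsum b (fmul s t) = fsum b (fmul t s).
Proof.
rewrite !fsum_mul /fsum exchange_big /=; apply: eq_bigr => p _.
by apply: eq_bigr => q _; rewrite mulrC [_.2 * _]mulrC.
Qed.

Lemma balanced_mul (V : zmodType) (b : R1 -> R2 -> V) t : balanced b ->
  balanced (fun x y => fsum (fun x' y' => b (x * x') (y * y')) t).
Proof.
case=> h1 h2 h3; split=> [x x' y|x y y'|x a y]; rewrite /fsum.
- by rewrite -big_split; apply: eq_bigr => p _; rewrite mulrDl h1.
- by rewrite -big_split; apply: eq_bigr => p _; rewrite mulrDl h2.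
- by apply: eq_bigr => p _; rewrite mulrAC h3 mulrA.
Qed.

Definition tadd (x y : tens) : tens := tclass (repr x ++ repr y).
Definition topp (x : tens) : tens := tclass (fopp (repr x)).
Definition tmul (x y : tens) : tens := tclass (fmul (repr x) (repr y)).

Lemma taddE s t : tadd (tclass s) (tclass t) = tclass (s ++ t).
Proof. by apply/tclassP => V b hb; rewrite !fsum_cat !fsum_repr. Qed.

Lemma toppE s : topp (tclass s) = tclass (fopp s).
Proof. by apply/tclassP => V b hb; rewrite !fsum_opp // fsum_repr. Qed.

Lemma tmulE s t : tmul (tclass s) (tclass t) = tclass (fmul s t).
Proof.
apply/tclassP => V b hb; rewrite fsum_mul fsum_repr; last exact: balanced_mul.
by rewrite -fsum_mul fsum_mulC fsum_mul fsum_repr -?fsum_mul 1?fsum_mulC //;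
  exact: balanced_mul.
Qed.

Lemma tclassW (P : tens -> Prop) : (forall s, P (tclass s)) -> forall x, P x.
Proof. by move=> h; apply: quotW. Qed.

Fact taddA : associative tadd.
Proof.
by do 3!elim/tclassW => ?; rewrite !taddE catA.
Qed.
Fact taddC : commutative tadd.
Proof.
do 2!elim/tclassW => ?; rewrite !taddE; apply/tclassP => V b _.
by rewrite !fsum_cat addrC.
Qed.
Fact tadd0 : left_id (tclass [::]) tadd.
Proof. by elim/tclassW => ?; rewrite taddE. Qed.
Fact taddN : left_inverse (tclass [::]) topp tadd.
Proof.
elim/tclassW => ?; rewrite toppE taddE; apply/tclassP => V b hb.
by rewrite fsum_cat fsum_opp // addNr /fsum big_nil.
Qed.
HB.instance Definition _ := GRing.isZmodule.Build tens taddA taddC tadd0 taddN.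

Fact tmulA : associative tmul.
Proof.
do 3!elim/tclassW => ?; rewrite !tmulE; apply/tclassP => V b _.
rewrite !fsum_mul; apply: eq_bigr => p _; rewrite fsum_mul.
by do 2!apply: eq_bigr => ? _; rewrite /= !mulrA.
Qed.
Fact tmulC : commutative tmul.
Proof.
by do 2!elim/tclassW => ?; rewrite !tmulE; apply/tclassP => V b _; rewrite fsum_mulC.
Qed.
Fact tmul1 : left_id (pure 1 1) tmul.
Proof.
elim/tclassW => s; rewrite tmulE; apply/tclassP => V b _.
rewrite fsum_mul /fsum big_seq1; apply: eq_bigr => p _ /=; by rewrite !mul1r.
Qed.
Fact tmulD : left_distributive tmul +%R.
Proof.
do 3!elim/tclassW => ?; rewrite /GRing.add /= ?(taddE, tmulE).
by apply/tclassP => V b _; rewrite !(fsum_cat, fsum_mul).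
Qed.
HB.instance Definition _ :=
  GRing.Zmodule_isComPzRing.Build tens tmulA tmulC tmul1 tmulD.

(* The additive map R1 (x)_A R2 -> V induced by b, when b is balanced. *)
Definition tlift (V : zmodType) (b : R1 -> R2 -> V) (t : tens) : V := fsum b (repr t).

Lemma tlift_pure (V : zmodType) (b : R1 -> R2 -> V) x y :
  balanced b -> tlift b (pure x y) = b x y.
Proof. by move=> hb; rewrite /tlift fsum_repr // /fsum big_seq1. Qed.

Lemma tliftD (V : zmodType) (b : R1 -> R2 -> V) t u :
  balanced b -> tlift b (t + u) = tlift b t + tlift b u.
Proof.
move=> hb; elim/tclassW: t => s; elim/tclassW: u => s'.
by rewrite [_ + _]taddE /tlift !fsum_repr // fsum_cat.
Qed.

Lemma tens_sum (t : tens) : t = \sum_(p <- repr t) pure p.1 p.2.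
Proof.
rewrite -{1}[t]reprK; elim: (repr t) => [|[x y] s ih]; first by rewrite big_nil.
by rewrite big_cons -ih [_ + _]taddE.
Qed.

Lemma pure_balanced : balanced pure.
Proof.
split=> [x x' y|x y y'|x a y]; rewrite ?[_ + _ in RHS]taddE; apply/tclassP => V b [h1 h2 h3];
  by rewrite /fsum ?big_cons ?big_nil /= ?addr0.
Qed.

Lemma pureM x y x' y' : pure x y * pure x' y' = pure (x * x') (y * y').
Proof. exact: tmulE. Qed.

End Tensor.
Arguments tlift {A R1 R2 r l V}.
Arguments pure {A R1 R2 r l}.

Fixpoint ipow (R : comPzRingType) (I : R -> Prop) (n : nat) : R -> Prop :=
  if n is m.+1 then fun x => exists s : seq (R * R),
      (forall p, p \in s -> I p.1 /\ ipow I m p.2) /\ x = \sum_(p <- s) p.1 * p.2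
  else fun=> True.

Definition is_ideal (R : comPzRingType) (I : R -> Prop) : Prop :=
  [/\ I 0, forall x y, I x -> I y -> I (x + y) & forall a x, I x -> I (a * x)].

Section IdealPowers.
Variables (R : comPzRingType) (I : R -> Prop).
Hypothesis idI : is_ideal I.

Lemma ipow_ideal n : is_ideal (ipow I n).
Proof.
case: n => [|n] //; split=> [|x y|a x] /=.
- by exists [::]; rewrite big_nil.
- case=> [s [hs ->]] [t [ht ->]]; exists (s ++ t); rewrite big_cat; split=> // p.
  by rewrite mem_cat => /orP[/hs|/ht].
- case=> [s [hs ->]]; exists [seq (a * p.1, p.2) | p <- s]; split=> [p|].
    case/mapP=> q /hs [h1 h2] -> /=; split=> //; by case: idI => _ _; apply.
  by rewrite mulr_sumr big_map; apply: eq_bigr => p _; rewrite mulrA.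
Qed.

Lemma ideal_sum (J : R -> Prop) (T : eqType) (s : seq T) (F : T -> R) : is_ideal J ->
  (forall i, i \in s -> J (F i)) -> J (\sum_(i <- s) F i).
Proof.
move=> [J0 JD _]; elim: s => [|i s ih] h; first by rewrite big_nil.
rewrite big_cons; apply: JD; first by apply: h; rewrite mem_head.
by apply: ih => k hk; apply: h; rewrite in_cons hk orbT.
Qed.

Lemma idealN (J : R -> Prop) x : is_ideal J -> J x -> J (- x).
Proof. by move=> [_ _ h] hx; rewrite -mulN1r; apply: h. Qed.

Lemma ipow_anti m n x : (m <= n)%N -> ipow I n x -> ipow I m x.
Proof.
have step k y : ipow I k.+1 y -> ipow I k y.
  elim: k y => // k ih y [s [hs ->]]; exists s; split=> // p /hs [h1 h2].
  by split=> //; apply: ih.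
move=> /subnK <-; elim: (n - m)%N => // k ih.
by rewrite addSn => /step.
Qed.

Lemma ipow_mul1 n x y : I x -> ipow I n y -> ipow I n.+1 (x * y).
Proof.
by move=> hx hy; exists [:: (x, y)]; rewrite big_seq1; split=> // p;
  rewrite inE => /eqP ->.
Qed.

Lemma ipow1 x : ipow I 1 x -> I x.
Proof.
case=> s [hs ->]; apply: ideal_sum => // p /hs [h _].
by rewrite mulrC; case: idI => _ _; apply.
Qed.

Lemma ipow_prod k (x : 'I_k -> R) :
  (forall i, ipow I 1 (x i)) -> ipow I k (\prod_(i < k) x i).
Proof.
elim: k x => // k ih x hx; rewrite big_ord_recl; apply: ipow_mul1; first exact: ipow1.
exact: ih.
Qed.

End IdealPowers.

(* The data of an affine formal groupoid over Spec A: the ring f of functions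
   on F, the two A-algebra structures (O_X on the left and on the right), the
   restriction to the unit section i(X), and the comultiplication m^*, which
   is a map from f to the limit of the rings (f (x)_A f) / K^{n+1}, K being
   the ideal of X in F x_X F.  Its component at level n is given by a lift
   fm n : f -> f (x)_A f, of which only the class modulo K^{n+1} matters. *)
Record formal_data (A : comPzRingType) := FormalData {
  fring :> comPzRingType;
  fl : {rmorphism A -> fring};
  fr : {rmorphism A -> fring};
  feps : {rmorphism fring -> A};
  fm : nat -> fring -> tens fr fl
}.

Section FormalData.
Variables (A : comPzRingType) (D : formal_data A).

Definition fj (x : D) : Prop := feps D x = 0.

Lemma fj_ideal : is_ideal fj.
Proof.
split=> [|x y|a x]; rewrite /fj ?rmorph0 // ?rmorphD ?rmorphM.
  by move=> -> ->; rewrite addr0.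
by move=> ->; rewrite mulr0.
Qed.

(* The pair (g, h) of B-points of F, as a map on functions. *)
Definition glue (B : comPzRingType) (g h : D -> B) (t : tens (fr D) (fl D)) : B :=
  tlift (fun x y => g x * h y) t.

Definition fK (t : tens (fr D) (fl D)) : Prop := glue (feps D) (feps D) t = 0.

Definition eqK (n : nat) (t u : tens (fr D) (fl D)) : Prop := ipow fK n.+1 (t - u).

(* B-points of the formal scheme F. *)
Definition point (B : comPzRingType) (g : {rmorphism D -> B}) : Prop :=
  exists n, forall x, ipow fj n x -> g x = 0.

Definition composable (B : comPzRingType) (g h : D -> B) : Prop :=
  forall a, g (fr D a) = h (fl D a).

(* k = m o (g, h); for n large, (g, h) kills K^{n+1}. *)
Definition composite (B : comPzRingType) (g h k : D -> B) : Prop :=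
  exists N, forall n, (N <= n)%N -> forall x, k x = glue g h (fm n x).

Definition idpoint (B : comPzRingType) (p : A -> B) : D -> B := fun x => p (feps D x).

Section Glue.
Variables (B : comPzRingType) (g h : {rmorphism D -> B}).
Hypothesis gh : composable g h.

Lemma glue_balanced : balanced (fr D) (fl D) (fun x y => g x * h y).
Proof.
by split=> *; rewrite ?rmorphD ?mulrDl ?mulrDr // !rmorphM gh mulrA.
Qed.

Lemma glueD t u : glue g h (t + u) = glue g h t + glue g h u.
Proof. exact: tliftD glue_balanced. Qed.

Lemma glue0 : glue g h 0 = 0.
Proof. by apply: (addIr (glue g h 0)); rewrite -glueD !add0r. Qed.

Lemma glue_pure x y : glue g h (pure x y) = g x * h y.
Proof. exact: tlift_pure glue_balanced. Qed.

Lemma glue_sum (s : seq (D * D)) (F : D * D -> tens (fr D) (fl D)) :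
  glue g h (\sum_(p <- s) F p) = \sum_(p <- s) glue g h (F p).
Proof. by apply: big_morph; [apply: glueD|apply: glue0]. Qed.

Lemma glueM t u : glue g h (t * u) = glue g h t * glue g h u.
Proof.
rewrite (tens_sum t) (tens_sum u) mulr_suml !glue_sum mulr_suml.
apply: eq_bigr => p _; rewrite mulr_sumr !glue_sum mulr_sumr.
by apply: eq_bigr => q _; rewrite pureM !glue_pure !rmorphM mulrACA.
Qed.

End Glue.
End FormalData.

(* The last four axioms, together with fc_ml and fc_mr (source and target of a
   composite), say that the B-points of F are the morphisms of a groupoid whose
   objects are the B-points of Spec A, functorially in B.  As F is a formal
   scheme supported along i(X), it is enough to take affine test schemes. *)
Record is_formal_category (C A : comPzRingType) (cA : {rmorphism C -> A})
    (D : formal_data A) : Prop := IsFormalCategory {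
  fc_base : forall c, fl D (cA c) = fr D (cA c);
  fc_epsl : forall a, feps D (fl D a) = a;
  fc_epsr : forall a, feps D (fr D a) = a;
  fc_separated : forall x : D, (forall n, ipow (@fj A D) n x) -> x = 0;
  fc_complete : forall u : nat -> D,
    (forall n, ipow (@fj A D) n.+1 (u n.+1 - u n)) ->
    exists x, forall n, ipow (@fj A D) n.+1 (x - u n);
  fc_mS : forall n (x : D), eqK n (fm n.+1 x) (fm n x);
  fc_mD : forall n (x y : D), eqK n (fm n (x + y)) (fm n x + fm n y);
  fc_mM : forall n (x y : D), eqK n (fm n (x * y)) (fm n x * fm n y);
  fc_m1 : forall n, eqK n (fm n (1 : D)) 1;
  fc_ml : forall n a, eqK n (fm n (fl D a)) (pure (fl D a) 1);
  fc_mr : forall n a, eqK n (fm n (fr D a)) (pure 1 (fr D a));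
  fc_assoc : forall (B : comPzRingType) (g h k gh hk u v : {rmorphism D -> B}),
    point g -> point h -> point k -> composable g h -> composable h k ->
    composite g h gh -> composite h k hk ->
    composite gh k u -> composite g hk v -> u =1 v;
  fc_idl : forall (B : comPzRingType) (g : {rmorphism D -> B}), point g ->
    composite (idpoint (g \o fl D)) g g;
  fc_idr : forall (B : comPzRingType) (g : {rmorphism D -> B}), point g ->
    composite g (idpoint (g \o fr D)) g;
  fc_inv : forall (B : comPzRingType) (g : {rmorphism D -> B}), point g ->
    exists h : {rmorphism D -> B},
      [/\ point h, composable g h, composable h g,
          composite g h (idpoint (g \o fl D)) &
          composite h g (idpoint (g \o fr D))]
}.

Record formal_category (C A : comPzRingType) (cA : {rmorphism C -> A}) :=
  FormalCategory {
    fc_data :> formal_data A;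
    fc_axioms :> is_formal_category cA fc_data
  }.

Section Lambda.
Variables (C A : comPzRingType) (cA : {rmorphism C -> A}) (D : formal_category cA).
Local Notation f := (fring D).
Local Notation l := (fl D).
Local Notation r := (fr D).
Local Notation eps := (feps D).
Local Notation j := (@fj A D).
Local Notation K := (@fK A D).

Lemma eps_composable : composable eps eps.
Proof. by move=> a; rewrite (fc_epsr D) (fc_epsl D). Qed.

(* Left A-linear maps f / j^{k+1} -> A. *)
Definition in_J (k : nat) (u : f -> A) : Prop :=
  [/\ forall x y, u (x + y) = u x + u y,
      forall a x, u (l a * x) = a * u x &
      forall x, ipow j k.+1 x -> u x = 0].

(* Lambda is the union of the J_k. *)
Definition in_Lambda (u : f -> A) : bool := `[< exists k, in_J k u >].

Lemma in_J_Lambda k u : in_J k u -> in_Lambda u.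
Proof. by move=> h; apply/asboolP; exists k. Qed.

Lemma in_J_le k k' u : (k <= k')%N -> in_J k u -> in_J k' u.
Proof.
by move=> kk' [h1 h2 h3]; split=> // x hx; apply: h3; apply: ipow_anti hx.
Qed.

Fact in_Lambda_zmod : zmod_closed (in_Lambda : {pred f -> A}).
Proof.
split=> [|u v]; first by apply/asboolP; exists 0%N; split=> *; rewrite ?addr0 ?mulr0.
move=> /asboolP [k hk] /asboolP [k' hk']; apply/asboolP; exists (maxn k k').
have [u1 u2 u3] := in_J_le (leq_maxl k k') hk.
have [v1 v2 v3] := in_J_le (leq_maxr k k') hk'.
split=> [x y|a x|x hx]; rewrite -![(u - v) _]/(u _ - v _).
- by rewrite u1 v1 opprD addrACA.
- by rewrite u2 v2 mulrBr.
- by rewrite u3 // v3 // subrr.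
Qed.
HB.instance Definition _ := GRing.isZmodClosed.Build (f -> A) in_Lambda in_Lambda_zmod.

Definition Lambda := {u : f -> A | in_Lambda u}.
HB.instance Definition _ := SubChoice.on Lambda.
HB.instance Definition _ := [SubChoice_isSubZmodule of Lambda by <:].

Definition Lfun (u : Lambda) : f -> A := val u.

Lemma LambdaP (u : Lambda) : exists k, in_J k (Lfun u).
Proof. exact/asboolP/(valP u). Qed.

Definition Lord (u : Lambda) : nat := projT1 (cid (LambdaP u)).

Lemma LordP (u : Lambda) : in_J (Lord u) (Lfun u).
Proof. exact: (projT2 (cid (LambdaP u))). Qed.

(* 1 (x) v : f (x)_A f -> f (x)_A A = f *)
Definition one_tens (v : f -> A) (t : tens r l) : f := tlift (fun x y => x * r (v y)) t.

(* The integer n is large enough for u o (1 (x) v) to kill K^{n+1}. *)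
Definition Lmul_fun (u v : Lambda) : f -> A :=
  fun x => Lfun u (one_tens (Lfun v) (fm (Lord u + Lord v) x)).

Lemma one_tens_balanced k v : in_J k v -> balanced r l (fun x y => x * r (v y)).
Proof.
case=> v1 v2 _; split=> [x x' y|x y y'|x a y]; first by rewrite mulrDl.
  by rewrite v1 rmorphD mulrDr.
by rewrite v2 rmorphM mulrA.
Qed.

Lemma one_tensD k v t t' : in_J k v ->
  one_tens v (t + t') = one_tens v t + one_tens v t'.
Proof. by move=> /one_tens_balanced h; apply: tliftD. Qed.

Lemma one_tens0 k v : in_J k v -> one_tens v 0 = 0.
Proof.
by move=> hv; apply: (addIr (one_tens v 0)); rewrite -(one_tensD _ _ hv) !add0r.
Qed.

Lemma one_tens_pure k v x y : in_J k v -> one_tens v (pure x y) = x * r (v y).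
Proof. by move=> /one_tens_balanced h; rewrite /one_tens tlift_pure. Qed.

Definition graded_tens (n : nat) (t : tens r l) : Prop := exists s : seq (f * f),
  (forall p, p \in s -> exists a, [/\ (a <= n)%N, ipow j a p.1 & ipow j (n - a) p.2])
  /\ t = \sum_(p <- s) pure p.1 p.2.

Lemma fK_split t : K t -> exists s : seq (f * f),
  (forall p, p \in s -> j p.1 \/ j p.2) /\ t = \sum_(p <- s) pure p.1 p.2.
Proof.
have [pD1 pD2 pZ] := pure_balanced r l.
rewrite /fK (tens_sum t) (glue_sum eps_composable); move: (repr t) => s hs.
exists ((1, \sum_(p <- s) l (eps p.1) * p.2) :: [seq (p.1 - r (eps p.1), p.2) | p <- s]).
split=> [p|].
  rewrite inE => /orP[/eqP->|/mapP[q _ ->]] /=; [right|left]; last first.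
    by rewrite /fj rmorphB (fc_epsr D) subrr.
  rewrite /fj rmorph_sum /= -[RHS]hs. apply: eq_bigr => q _.
  by rewrite (glue_pure eps_composable) rmorphM (fc_epsl D).
rewrite big_cons big_map /=.
have -> : pure 1 (\sum_(p <- s) l (eps p.1) * p.2) =
    \sum_(p <- s) pure (r (eps p.1)) p.2 :> tens r l.
  elim: s {hs} => [|q s ih].
    by rewrite !big_nil; apply: (addIr (pure 1 0)); rewrite -pD2 !add0r.
  by rewrite !big_cons pD2 ih -pZ mul1r.
rewrite -big_split; apply: eq_bigr => p _ /=.
by rewrite -pD1 addrC subrK.
Qed.

Lemma ipowK_graded n t : ipow K n t -> graded_tens n t.
Proof.
elim: n t => [|n ih] t.
  move=> _; exists (repr t); split; last exact: tens_sum.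
  by move=> p _; exists 0%N.
case=> s [hs ->] {t}.
have gD t u : graded_tens n.+1 t -> graded_tens n.+1 u -> graded_tens n.+1 (t + u).
  case=> [s1 [h1 ->]] [s2 [h2 ->]]; exists (s1 ++ s2); rewrite big_cat; split=> // p.
  by rewrite mem_cat => /orP[/h1|/h2].
elim: s hs => [|p s IH] hs; first by rewrite big_nil; exists [::]; rewrite big_nil.
rewrite big_cons; apply: gD; last by apply: IH => q hq; apply: hs; rewrite inE hq orbT.
have [/fK_split [s1 [h1 ->]] /ih [s2 [h2 ->]]] := hs p (mem_head _ _).
exists [seq (q1.1 * q2.1, q1.2 * q2.2) | q1 <- s1, q2 <- s2]; split.
  move=> q /allpairsP [[q1 q2] /= [/h1 hq1 /h2 [a [an ha hb]] ->]] /=.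
  have [_ _ mj1] := ipow_ideal (fj_ideal D) a.
  have [_ _ mj2] := ipow_ideal (fj_ideal D) (n - a).
  case: hq1 => h; [exists a.+1|exists a].
    by split=> //; [apply: ipow_mul1|rewrite subSS; apply: mj2].
  by split; [apply: leqW|apply: mj1|rewrite subSn //; apply: ipow_mul1].
rewrite big_allpairs_dep mulr_suml; apply: eq_bigr => q1 _.
by rewrite mulr_sumr; apply: eq_bigr => q2 _; rewrite pureM.
Qed.

Lemma Jfun0 k u : in_J k u -> u 0 = 0.
Proof. by case=> h _ _; apply: (addIr (u 0)); rewrite -h !add0r. Qed.

Lemma comp_kill k k' u v t : in_J k u -> in_J k' v ->
  ipow K (k + k').+1 t -> u (one_tens v t) = 0.
Proof.
move=> hu hv /ipowK_graded [s [hs ->]]; elim: s hs => [|p s ih] hs.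
  by rewrite big_nil (one_tens0 hv) (Jfun0 hu).
rewrite big_cons (one_tensD _ _ hv) (one_tens_pure _ _ hv).
case: (hu) => uD _ u0; rewrite uD ih ?addr0; last first.
  by move=> q hq; apply: hs; rewrite inE hq orbT.
have [a [an ha hb]] := hs p (mem_head _ _).
case: (leqP k.+1 a) => hk.
  apply: u0; have [_ _ h] := ipow_ideal (fj_ideal D) k.+1.
  by rewrite mulrC; apply: h; apply: ipow_anti ha.
case: hv => _ _ -> ; first by rewrite rmorph0 mulr0 (Jfun0 hu).
by apply: ipow_anti hb; rewrite ltn_subRL (leq_trans _ (leqnn (k + k').+1)) // ltnS leq_add2r.
Qed.

Lemma comp_eqK k k' n u v t t' : in_J k u -> in_J k' v -> (k + k' <= n)%N ->
  eqK n t t' -> u (one_tens v t) = u (one_tens v t').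
Proof.
move=> hu hv hn /(@ipow_anti _ _ (k + k').+1 n.+1 _ hn) h.
rewrite -[t](subrK t') (one_tensD _ _ hv); case: (hu) => -> _ _.
by rewrite (comp_kill hu hv h) add0r.
Qed.

Lemma fK_ideal : is_ideal K.
Proof.
split=> [|t u|t u]; rewrite /fK; first exact: glue0 eps_composable.
  by move=> tK uK; rewrite (glueD eps_composable) tK uK addr0.
by move=> uK; rewrite (glueM eps_composable) uK mulr0.
Qed.

Lemma fm_K n x : j x -> K (fm n x).
Proof.
have [K0 KD KM] := fK_ideal.
have hp : point (feps D : {rmorphism f -> A}).
  exists 1%N => y [s [hs ->]]; rewrite rmorph_sum big_seq big1 // => p /hs [h _].
  by rewrite rmorphM h mul0r.
have [N hN] := fc_idl (fc_axioms D) hp.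
move=> hx; have hK : K (fm (N + n) x).
  rewrite /fK -[RHS]hx (hN (N + n)%N (leq_addr _ _) x) /glue; congr tlift.
  by apply/funext => y; apply/funext => z; rewrite /idpoint /= (fc_epsl D).
elim: N {hN} hK => // N ih hK; apply: ih.
have: eqK (N + n) (fm (N + n).+1 x) (fm (N + n) x) := fc_mS D _ _.
move=> /(@ipow_anti _ _ 1 (N + n).+1 _ isT) /(ipow1 fK_ideal) h.
rewrite -(subKr (fm (N + n).+1 x) (fm (N + n) x)).
by apply: KD; [|apply: idealN fK_ideal h].
Qed.

Lemma eqK_sum n (s : seq (f * f)) (F : f * f -> f) (G : f * f -> tens r l) :
  (forall p, p \in s -> eqK n (fm n (F p)) (G p)) ->
  eqK n (fm n (\sum_(p <- s) F p)) (\sum_(p <- s) G p).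
Proof.
have [I0 ID IM] := ipow_ideal fK_ideal n.+1.
elim: s => [|p s ih] h.
  rewrite !big_nil /eqK subr0 -[fm n 0]opprK.
  apply: idealN; first exact: ipow_ideal fK_ideal _.
  by have := fc_mD D n 0 0; rewrite /eqK addr0 opprD addrA subrr add0r.
rewrite !big_cons /eqK -(subrKA (fm n (F p) + fm n (\sum_(j <- s) F j))).
apply: (ID); first exact: (fc_mD D).
rewrite opprD addrACA; apply: (ID); first by apply: h; rewrite mem_head.
by apply: ih => q hq; apply: h; rewrite inE hq orbT.
Qed.

Lemma fm_ipow n m x : (m <= n.+1)%N -> ipow j m x -> ipow K m (fm n x).
Proof.
elim: m x => // m ih x hm [s [hs ->]].
have [_ KD _] := ipow_ideal fK_ideal m.+1.
have := @eqK_sum n s (fun p => p.1 * p.2) (fun p => fm n p.1 * fm n p.2)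
  (fun p _ => fc_mM D n p.1 p.2).
move=> /(ipow_anti hm) h; rewrite -(subrK (\sum_(p <- s) fm n p.1 * fm n p.2) (fm n _)).
apply: KD => //; apply: ideal_sum; first exact: ipow_ideal fK_ideal _.
by move=> p /hs [h1 h2]; apply: ipow_mul1; [apply: fm_K|apply: ih => //; apply: ltnW].
Qed.

Lemma Lmul_in_J (u v : Lambda) : in_J (Lord u + Lord v) (Lmul_fun u v).
Proof.
have hu := LordP u; have hv := LordP v; have [uD uZ _] := hu.
have E := comp_eqK hu hv (leqnn _).
split=> [x y|a x|x hx]; rewrite /Lmul_fun.
- by rewrite (E _ _ (fc_mD D _ _ _)) (one_tensD _ _ hv) uD.
- rewrite (E _ _ (fc_mM D _ _ _)).
  have -> : Lfun u (one_tens (Lfun v) (fm (Lord u + Lord v) (l a) * fm (Lord u + Lord v) x))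
    = Lfun u (one_tens (Lfun v) (pure (l a) 1 * fm (Lord u + Lord v) x)).
    apply: E; rewrite /eqK -mulrBl mulrC.
    have [_ _ h] := ipow_ideal fK_ideal (Lord u + Lord v).+1.
    by apply: h; apply: (fc_ml D).
  rewrite -uZ; congr (Lfun u _); rewrite (tens_sum (fm _ x)) mulr_sumr.
  elim: (repr _) => [|p s ih]; first by rewrite !big_nil !(one_tens0 hv) mulr0.
  rewrite !big_cons !(one_tensD _ _ hv) ih mulrDr pureM mul1r.
  by rewrite !(one_tens_pure _ _ hv) mulrA.
- by apply: (comp_kill hu hv); apply: fm_ipow hx.
Qed.

(* uv = u o (1 (x) v) o m^* *)
Definition Lmul (u v : Lambda) : Lambda :=
  exist _ (Lmul_fun u v) (in_J_Lambda (Lmul_in_J u v)).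

Lemma Lunit_in_J a : in_J 0 (fun x => eps x * a).
Proof.
split=> [x y|b x|x /(ipow1 (fj_ideal D)) ->]; rewrite ?rmorphD ?rmorphM ?mulrDl ?mul0r //.
by rewrite (fc_epsl D) mulrA.
Qed.

(* The identification A = J_0 Lambda. *)
Definition Lscal (a : A) : Lambda :=
  exist _ (fun x => eps x * a) (in_J_Lambda (Lunit_in_J a)).

End Lambda.

Record submod (A : pzRingType) (V : lmodType A) := Submod {
  smem :> V -> Prop;
  smem_closed : smem 0 /\ forall a x y, smem x -> smem y -> smem (a *: x + y)
}.

Section Submodules.
Variables (A : pzRingType) (V : lmodType A) (U : submod V).

Definition smemb (x : V) : bool := `[< U x >].

Fact smemb_closed : subsemimod_closed smemb.
Proof.
have [U0 UD] := smem_closed U.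
split; first (split; [exact/asboolP|]).
  move=> x y /asboolP hx /asboolP hy; apply/asboolP.
  by rewrite -[x]scale1r; apply: UD.
move=> a x /asboolP hx; apply/asboolP.
by rewrite -[a *: x]addr0; apply: UD.
Qed.
HB.instance Definition _ := GRing.isSubmodClosed.Build A V smemb smemb_closed.

Definition subm := {x : V | smemb x}.
HB.instance Definition _ := SubChoice.on subm.
HB.instance Definition _ := [SubChoice_isSubLmodule of subm by <:].

Definition smem_zmod := GRing.ZmodClosed.clone V smemb _.
Definition quom := Quotient.quot smem_zmod.
HB.instance Definition _ := GRing.Zmodule.on quom.

Definition quom_pi (x : V) : quom := \pi_quom x.

Lemma quom_eq x y : quom_pi x = quom_pi y <-> U (x - y).
Proof.
rewrite /quom_pi; split=> [/eqP|h].
  by rewrite -(Quotient.idealrBE smem_zmod) => /asboolP.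
by apply/eqP; rewrite -(Quotient.idealrBE smem_zmod); apply/asboolP.
Qed.

Lemma quom_piD x y : quom_pi (x + y) = quom_pi x + quom_pi y.
Proof. by rewrite /quom_pi; rewrite piE. Qed.

Lemma quom_surj (P : quom -> Prop) : (forall x, P (quom_pi x)) -> forall z, P z.
Proof. by move=> h; apply: quotW. Qed.

Definition quom_scale (a : A) (x : quom) : quom := quom_pi (a *: repr x).

Lemma quom_scaleE a x : quom_scale a (quom_pi x) = quom_pi (a *: x).
Proof.
apply/quom_eq; rewrite -scalerBr.
have [U0 UD] := smem_closed U; rewrite -[_ *: _]addr0; apply: UD => //.
by apply/quom_eq; rewrite /quom_pi reprK.
Qed.

Fact quom_scaleA a b v : quom_scale a (quom_scale b v) = quom_scale (a * b) v.
Proof. by elim/quom_surj: v => v; rewrite !quom_scaleE scalerA. Qed.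
Fact quom_scale1 : left_id 1 quom_scale.
Proof. by elim/quom_surj => v; rewrite !quom_scaleE scale1r. Qed.
Fact quom_scaleDr : right_distributive quom_scale +%R.
Proof.
by move=> a; do 2!elim/quom_surj => ?; rewrite -quom_piD !quom_scaleE scalerDr quom_piD.
Qed.
Fact quom_scaleDl v : {morph quom_scale^~ v : a b / a + b}.
Proof. by move=> a b; elim/quom_surj: v => v; rewrite !quom_scaleE scalerDl quom_piD. Qed.
HB.instance Definition _ := GRing.Zmodule_isLmodule.Build A quom
  quom_scaleA quom_scale1 quom_scaleDr quom_scaleDl.

End Submodules.

(* Localization M[1/g] as a module over A[1/g]; (x, k) stands for x / g^k. *)
Section Localization.
Variables (A : comPzRingType) (g : A).

Section LocMod.
Variable M : lmodType A.

Definition loc_eq (p q : M * nat) : bool :=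
  `[< exists n, g ^+ (n + q.2) *: p.1 = g ^+ (n + p.2) *: q.1 >].

Lemma loc_equiv : equiv_class_of loc_eq.
Proof.
split=> [p|p q|q p s].
- by apply/asboolP; exists 0%N.
- by apply/asboolP/asboolP => -[n h]; exists n.
- move=> /asboolP [n h] /asboolP [m h']; apply/asboolP.
  exists (n + m + q.2)%N.
  have -> : (n + m + q.2 + s.2 = (m + s.2) + (n + q.2))%N by lia.
  have -> : (n + m + q.2 + p.2 = (n + p.2) + (m + q.2))%N by lia.
  by rewrite exprD [in RHS]exprD -!scalerA h -h' !scalerA mulrC.
Qed.
Canonical loc_canonical := EquivRelPack loc_equiv.

Definition loc := {eq_quot loc_eq}.
HB.instance Definition _ := Choice.on loc.
Definition frac (x : M) (k : nat) : loc := \pi_loc (x, k).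

Lemma frac_eq x k y l : frac x k = frac y l <->
  exists n, g ^+ (n + l) *: x = g ^+ (n + k) *: y.
Proof. by split=> [/eqquotP/asboolP|h]; [|apply/eqquotP/asboolP]. Qed.

Lemma frac_ind (P : loc -> Prop) : (forall x k, P (frac x k)) -> forall z, P z.
Proof. by move=> h; apply: quotW => -[x k]; apply: h. Qed.

Lemma frac_repr (z : loc) : frac (repr z).1 (repr z).2 = z.
Proof. by rewrite /frac -surjective_pairing reprK. Qed.

Definition loc_add (z w : loc) : loc :=
  frac (g ^+ (repr w).2 *: (repr z).1 + g ^+ (repr z).2 *: (repr w).1)
    ((repr z).2 + (repr w).2).
Definition loc_opp (z : loc) : loc := frac (- (repr z).1) (repr z).2.

Lemma loc_addE x k y l :
  loc_add (frac x k) (frac y l) = frac (g ^+ l *: x + g ^+ k *: y) (k + l).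
Proof.
have /frac_eq [n hn] := frac_repr (frac x k).
have /frac_eq [m hm] := frac_repr (frac y l).
rewrite /loc_add; move: (repr (frac x k)) (repr (frac y l)) hn hm => [x' k'] [y' l'] /= hn hm.
apply/frac_eq; exists (n + m)%N; rewrite !scalerDr !scalerA -!exprD; congr (_ + _).
  have -> : (n + m + (k + l) + l' = (m + l + l') + (n + k))%N by lia.
  have -> : (n + m + (k' + l') + l = (m + l + l') + (n + k'))%N by lia.
  by rewrite exprD [in RHS]exprD -!scalerA hn.
have -> : (n + m + (k + l) + k' = (n + k + k') + (m + l))%N by lia.
have -> : (n + m + (k' + l') + k = (n + k + k') + (m + l'))%N by lia.
by rewrite exprD [in RHS]exprD -!scalerA hm.
Qed.

Lemma loc_oppE x k : loc_opp (frac x k) = frac (- x) k.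
Proof.
have /frac_eq [n hn] := frac_repr (frac x k).
by apply/frac_eq; exists n; rewrite !scalerN hn.
Qed.

Fact loc_addA : associative loc_add.
Proof.
do 3!elim/frac_ind => ? ?; rewrite !loc_addE addnA; congr frac.
rewrite !scalerDr !scalerA -!exprD addrA; congr (_ + _ + _).
  by rewrite addnC.
by rewrite addnC.
Qed.
Fact loc_addC : commutative loc_add.
Proof. by do 2!elim/frac_ind => ? ?; rewrite !loc_addE addrC addnC. Qed.
Fact loc_add0 : left_id (frac 0 0) loc_add.
Proof. by elim/frac_ind => ? ?; rewrite loc_addE scaler0 add0r scale1r. Qed.
Fact loc_addN : left_inverse (frac 0 0) loc_opp loc_add.
Proof.
elim/frac_ind => ? ?; rewrite loc_oppE loc_addE scalerN addNr.
by apply/frac_eq; exists 0%N; rewrite !scaler0.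
Qed.
HB.instance Definition _ := GRing.isZmodule.Build loc
  loc_addA loc_addC loc_add0 loc_addN.

End LocMod.

Definition locr := loc A^o.
HB.instance Definition _ := GRing.Zmodule.on locr.
Definition fracr (a : A) (k : nat) : locr := @frac A^o a k.

Definition locr_act (M : lmodType A) (z : locr) (w : loc M) : loc M :=
  frac ((repr z).1 *: (repr w).1) ((repr z).2 + (repr w).2).

Lemma locr_actE (M : lmodType A) (a : A) k (x : M) l :
  locr_act (fracr a k) (frac x l) = frac (a *: x) (k + l).
Proof.
have /frac_eq [n hn] := frac_repr (fracr a k).
have /frac_eq [m hm] := frac_repr (frac x l).
rewrite /locr_act; move: (repr (fracr a k)) (repr (frac x l)) hn hm.
move=> [a' k'] [x' l'] /= hn hm; apply/frac_eq; exists (n + m)%N.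
have -> : (n + m + (k + l) = (n + k) + (m + l))%N by lia.
have -> : (n + m + (k' + l') = (n + k') + (m + l'))%N by lia.
rewrite !exprD -!exprD [g ^+ (n + k + _)]exprD [g ^+ (n + k' + _)]exprD.
rewrite !scalerA [_ * _ * a']mulrAC [_ * _ * a]mulrAC.
by rewrite -!scalerA hm !scalerA; congr (_ * _ *: _); exact: hn.
Qed.

Lemma fracr_ind (P : locr -> Prop) : (forall a k, P (fracr a k)) -> forall z, P z.
Proof. exact: (@frac_ind A^o P). Qed.

Lemma fracrD (a : A) k b l :
  fracr a k + fracr b l = fracr (g ^+ l * a + g ^+ k * b) (k + l).
Proof. exact: loc_addE. Qed.

Lemma fracD (M : lmodType A) (x : M) k y l :
  frac x k + frac y l = frac (g ^+ l *: x + g ^+ k *: y) (k + l).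
Proof. exact: loc_addE. Qed.

Lemma locr_actDr (M : lmodType A) : right_distributive (@locr_act M) +%R.
Proof.
elim/fracr_ind => a k; do 2!elim/frac_ind => ? ?; rewrite fracD !locr_actE fracD.
apply/frac_eq; exists 0%N; rewrite !scalerDr !scalerA -!exprD.
congr (_ *: _ + _ *: _); rewrite mulrAC -!exprD; congr (g ^+ _ * _); lia.
Qed.
Lemma locr_actDl (M : lmodType A) (v : loc M) : {morph (@locr_act M)^~ v : a b / a + b}.
Proof.
do 2!elim/fracr_ind => ? ?; elim/frac_ind: v => ? ?; rewrite fracrD !locr_actE fracD.
apply/frac_eq; exists 0%N; rewrite !scalerDl !scalerDr !scalerA.
congr (_ *: _ + _ *: _); rewrite !mulrA -!exprD; congr (g ^+ _ * _); lia.
Qed.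
Lemma locr_act1 (M : lmodType A) : left_id (fracr 1 0) (@locr_act M).
Proof. by elim/frac_ind => ? ?; rewrite locr_actE scale1r. Qed.

Definition locr_mul (z w : locr) : locr := locr_act z (w : loc A^o).
Lemma fracrM (a : A) k b l : locr_mul (fracr a k) (fracr b l) = fracr (a * b) (k + l).
Proof. exact: locr_actE. Qed.

Fact locr_mulA : associative locr_mul.
Proof. by do 3!elim/fracr_ind => ? ?; rewrite !fracrM mulrA addnA. Qed.
Fact locr_mulC : commutative locr_mul.
Proof. by do 2!elim/fracr_ind => ? ?; rewrite !fracrM mulrC addnC. Qed.
Fact locr_mul1 : left_id (fracr 1 0) locr_mul.
Proof. exact: locr_act1. Qed.
Fact locr_mulDl : left_distributive locr_mul +%R.
Proof. by move=> x y z; apply: locr_actDl. Qed.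
HB.instance Definition _ := GRing.Zmodule_isComPzRing.Build locr
  locr_mulA locr_mulC locr_mul1 locr_mulDl.

Fact locr_actA (M : lmodType A) a b (v : loc M) :
  locr_act a (locr_act b v) = locr_act (a * b) v.
Proof.
elim/fracr_ind: a => ? ?; elim/fracr_ind: b => ? ?; elim/frac_ind: v => ? ?.
by rewrite [_ * _]fracrM !locr_actE scalerA addnA.
Qed.
HB.instance Definition _ (M : lmodType A) :=
  GRing.Zmodule_isLmodule.Build locr (loc M)
    (@locr_actA M) (@locr_act1 M) (@locr_actDr M) (@locr_actDl M).

End Localization.

(* I may be infinite. *)
Definition is_basis (R : pzRingType) (M : lmodType R) (I : eqType) (b : I -> M) : Prop :=
  (forall x, exists (s : seq I) (c : I -> R), x = \sum_(i <- s) c i *: b i) /\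
  (forall (s : seq I) (c : I -> R), uniq s -> \sum_(i <- s) c i *: b i = 0 ->
     forall i, i \in s -> c i = 0).

(* The principal opens D(g), g in gs, cover Spec A. *)
Definition unit_cover (A : comPzRingType) (gs : seq A) : Prop :=
  exists c : A -> A, \sum_(g <- gs) c g * g = 1.

Definition locally_free (A : comPzRingType) (M : lmodType A) : Prop :=
  exists2 gs : seq A, unit_cover gs & forall g, g \in gs ->
    exists (I : eqType) (b : I -> loc g M), @is_basis (locr g) (loc g M) I b.

Definition locally_free_finite (A : comPzRingType) (M : lmodType A) : Prop :=
  exists2 gs : seq A, unit_cover gs & forall g, g \in gs ->
    exists n (b : 'I_n -> loc g M), @is_basis (locr g) (loc g M) 'I_n b.

Definition upd (I : eqType) (T : Type) (x : I -> T) (i : I) (y : T) : I -> T :=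
  fun i' => if i' == i then y else x i'.

Definition sym_multilinear (A : pzRingType) (M V : lmodType A) (k : nat)
    (b : ('I_k -> M) -> V) : Prop :=
  (forall x i a y z, b (upd x i (a *: y + z)) = a *: b (upd x i y) + b (upd x i z)) /\
  (forall x (s : {perm 'I_k}), b (x \o s) = b x).

(* b : M^k -> S exhibits S as Sym^k M. *)
Definition is_sympower (A : pzRingType) (M S : lmodType A) (k : nat)
    (b : ('I_k -> M) -> S) : Prop :=
  sym_multilinear b /\
  forall (V : lmodType A) (b' : ('I_k -> M) -> V), sym_multilinear b' ->
    exists2 h : {linear S -> V}, (forall x, h (b x) = b' x) &
      forall h' : {linear S -> V}, (forall x, h' (b x) = b' x) -> h' =1 h.

(* f, with its left A-module structure. *)
Definition leftmod (A : comPzRingType) (D : formal_data A) : Type := fring D.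
Section Leftmod.
Variables (A : comPzRingType) (D : formal_data A).
HB.instance Definition _ := GRing.ComPzRing.on (leftmod D).
Definition leftmod_scale (a : A) (x : leftmod D) : leftmod D := fl D a * x.
Fact leftmod_scaleA a b v : leftmod_scale a (leftmod_scale b v) = leftmod_scale (a * b) v.
Proof. by rewrite /leftmod_scale rmorphM mulrA. Qed.
Fact leftmod_scale1 : left_id 1 leftmod_scale.
Proof. by move=> x; rewrite /leftmod_scale rmorph1 mul1r. Qed.
Fact leftmod_scaleDr : right_distributive leftmod_scale +%R.
Proof. by move=> a x y; rewrite /leftmod_scale mulrDr. Qed.
Fact leftmod_scaleDl v : {morph leftmod_scale^~ v : a b / a + b}.
Proof. by move=> a b; rewrite /leftmod_scale rmorphD mulrDl. Qed.
HB.instance Definition _ := GRing.Zmodule_isLmodule.Build A (leftmod D)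
  leftmod_scaleA leftmod_scale1 leftmod_scaleDr leftmod_scaleDl.

Fact jpow_closed k : ipow (@fj A D) k 0 /\
  forall a (x y : leftmod D), ipow (@fj A D) k x -> ipow (@fj A D) k y ->
    ipow (@fj A D) k (a *: x + y).
Proof.
have [J0 JD JM] := ipow_ideal (fj_ideal D) k.
by split=> // a x y hx hy; apply: JD => //; apply: JM.
Qed.
Definition jpow (k : nat) : submod (leftmod D) := Submod (jpow_closed k).

Fact jpow_next_closed k : jpow k.+1 (val (0 : subm (jpow k))) /\
  forall a (x y : subm (jpow k)), jpow k.+1 (val x) -> jpow k.+1 (val y) ->
    jpow k.+1 (val (a *: x + y)).
Proof.
have [J0 JD] := smem_closed (jpow k.+1).
by split=> [|a x y hx hy]; rewrite ?linearP ?raddf0 //; apply: JD.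
Qed.
Definition jpow_next k : submod (subm (jpow k)) :=
  @Submod A (subm (jpow k)) (fun x => jpow k.+1 (val x)) (jpow_next_closed k).

(* j^k / j^{k+1}; its left and right A-module structures agree. *)
Definition gr (k : nat) : lmodType A := quom (jpow_next k).

Definition gr_pi k (x : leftmod D) (hx : jpow k x) : gr k :=
  quom_pi (jpow_next k) (exist _ x (asboolT hx)).

Definition gr_rep k (x : gr k) : leftmod D := val (repr (x : quom (jpow_next k))).

Lemma gr_repP k (x : gr k) : jpow k (gr_rep x).
Proof. exact/asboolP/(valP (repr (x : quom (jpow_next k)))). Qed.

(* (j/j^2)^k -> j^k/j^{k+1}, the product of the graded algebra Gr_j(f). *)
Definition gr_prod k (x : 'I_k -> gr 1) : gr k :=
  gr_pi (ipow_prod (fj_ideal D) (fun i => gr_repP (x i))).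

(* Gr_j(f) is the symmetric algebra of j/j^2, degree by degree. *)
Definition smooth_type : Prop :=
  (forall k, locally_free_finite (gr k)) /\ (forall k, is_sympower (@gr_prod k)).
End Leftmod.

Definition finitely_generated (C A : comPzRingType) (cA : {rmorphism C -> A}) : Prop :=
  exists xs : seq A, forall S : A -> Prop,
    (forall c, S (cA c)) -> (forall x, x \in xs -> S x) ->
    (forall x y, S x -> S y -> S (x + y)) -> (forall x y, S x -> S y -> S (x * y)) ->
    forall a, S a.

Record cochain (A : pzRingType) := Cochain {
  cobj :> int -> lmodType A;
  cdiff : forall n, {linear cobj n -> cobj (n + 1)};
  cdiffK : forall n x, cdiff (n + 1) (cdiff n x) = 0
}.

Definition bounded (A : pzRingType) (E : cochain A) : Prop :=
  exists N : nat, forall n : int, (N < `|n|)%N -> forall x : E n, x = 0.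

Record chain_map (A : pzRingType) (E F : cochain A) := ChainMap {
  cmap :> forall n, {linear E n -> F n};
  cmapP : forall n x, cmap (n + 1) (cdiff E n x) = cdiff F n (cmap n x)
}.

(* Injectivity and surjectivity of H^{n+1}(a), for every integer n. *)
Definition quasi_isomorphism (A : pzRingType) (E F : cochain A) (a : chain_map E F) : Prop :=
  forall n : int,
    (forall x : E (n + 1), cdiff E (n + 1) x = 0 ->
       (exists y, a (n + 1) x = cdiff F n y) -> exists y, x = cdiff E n y) /\
    (forall z : F (n + 1), cdiff F (n + 1) z = 0 ->
       exists2 x : E (n + 1), cdiff E (n + 1) x = 0 &
         exists y, z = a (n + 1) x + cdiff F n y).

(* The direct sum of the terms of a complex. *)
Definition prodm (A : pzRingType) (E : int -> lmodType A) : Type := forall n, E n.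

Section Prodm.
Variables (A : pzRingType) (E : int -> lmodType A).
HB.instance Definition _ := Choice.copy (prodm E) (forall n, E n).
Implicit Types x y z : prodm E.
Definition prodm_add x y : prodm E := fun n => x n + y n.
Definition prodm_opp x : prodm E := fun n => - x n.
Definition prodm_zero : prodm E := fun n => 0.
Definition prodm_scale a x : prodm E := fun n => a *: x n.
Fact prodm_addA : associative prodm_add.
Proof. by move=> x y z; apply: functional_extensionality_dep => n; apply: addrA. Qed.
Fact prodm_addC : commutative prodm_add.
Proof. by move=> x y; apply: functional_extensionality_dep => n; apply: addrC. Qed.
Fact prodm_add0 : left_id prodm_zero prodm_add.
Proof. by move=> x; apply: functional_extensionality_dep => n; apply: add0r. Qed.
Fact prodm_addN : left_inverse prodm_zero prodm_opp prodm_add.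
Proof. by move=> x; apply: functional_extensionality_dep => n; apply: addNr. Qed.
HB.instance Definition _ := GRing.isZmodule.Build (prodm E)
  prodm_addA prodm_addC prodm_add0 prodm_addN.
Fact prodm_scaleA a b x : prodm_scale a (prodm_scale b x) = prodm_scale (a * b) x.
Proof. by apply: functional_extensionality_dep => n; apply: scalerA. Qed.
Fact prodm_scale1 : left_id 1 prodm_scale.
Proof. by move=> x; apply: functional_extensionality_dep => n; apply: scale1r. Qed.
Fact prodm_scaleDr : right_distributive prodm_scale +%R.
Proof. by move=> a x y; apply: functional_extensionality_dep => n; apply: scalerDr. Qed.
Fact prodm_scaleDl x : {morph prodm_scale^~ x : a b / a + b}.
Proof. by move=> a b; apply: functional_extensionality_dep => n; apply: scalerDl. Qed.
HB.instance Definition _ := GRing.Zmodule_isLmodule.Build A (prodm E)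
  prodm_scaleA prodm_scale1 prodm_scaleDr prodm_scaleDl.

Definition finsupp (x : prodm E) : Prop :=
  exists N : nat, forall n : int, (N < `|n|)%N -> x n = 0.

Fact finsupp_closed : finsupp 0 /\
  forall a x y, finsupp x -> finsupp y -> finsupp (a *: x + y).
Proof.
split=> [|a x y [N hx] [M hy]]; first by exists 0%N.
exists (maxn N M) => n; rewrite gtn_max => /andP[hN hM].
by rewrite -[(a *: x + y) n]/(a *: x n + y n) hx // hy // scaler0 addr0.
Qed.
Definition finsupp_submod : submod (prodm E) := Submod finsupp_closed.
End Prodm.

Definition tot (A : pzRingType) (E : int -> lmodType A) : lmodType A :=
  subm (finsupp_submod E).

Section Tot.
Variable A : pzRingType.
Implicit Types E F : cochain A.

Definition component E (x : tot E) : forall n, E n := val (x : subm (finsupp_submod E)).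

Lemma component_finsupp E (x : tot E) : finsupp (component x).
Proof. exact/asboolP/(valP (x : subm (finsupp_submod E))). Qed.

Definition mktot E (x : forall n, E n) (hx : finsupp x) : tot E :=
  exist _ (x : prodm E) (asboolT hx).

Definition homogeneous E (n : int) (x : tot E) : Prop :=
  forall m, m != n -> component x m = 0.

Lemma ecast0 E m n (h : m = n) : ecast k (E k) h (0 : E m) = 0.
Proof. by case: n / h. Qed.

Fact tot_diff_finsupp E (x : tot E) : @finsupp A E (fun n =>
  ecast m (E m) (subrK 1 n) (cdiff E (n - 1) (component x (n - 1)))).
Proof.
have [N hN] := component_finsupp x; exists N.+1 => n hn.
by rewrite hN ?raddf0 ?ecast0 //; lia.
Qed.
Definition tot_diff E (x : tot E) : tot E := mktot (tot_diff_finsupp x).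

Fact tot_map_finsupp E F (a : chain_map E F) (x : tot E) :
  @finsupp A F (fun n => a n (component x n)).
Proof.
by have [N hN] := component_finsupp x; exists N => n hn; rewrite hN ?raddf0.
Qed.
Definition tot_map E F (a : chain_map E F) (x : tot E) : tot F :=
  mktot (tot_map_finsupp a x).
End Tot.

Section Q.
Variables (C A : comPzRingType) (cA : {rmorphism C -> A}) (D : formal_category cA).
Local Notation L := (Lambda D).
Local Notation "u ** v" := (Lmul u v) (at level 40, left associativity).
Local Notation "a %:L" := (Lscal D a) (at level 2, format "a %:L").
Implicit Types E F G : cochain A.

Definition multimap E F : Type := seq L -> tot E -> tot F.

(* Q^i(E, F).  The left and right actions of A on L are the products with
   J_0 L = A. *)
Record in_Q E F (i : int) (q : multimap E F) : Prop := InQ {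
  Q_degree : forall u j e, homogeneous j e ->
    homogeneous (i + j - (size u)%:Z) (q u e);
  Q_addL : forall s u v t e,
    q (s ++ (u + v) :: t) e = q (s ++ u :: t) e + q (s ++ v :: t) e;
  Q_addE : forall u e e', q u (e + e') = q u e + q u e';
  Q_left : forall a u s e, q (a%:L ** u :: s) e = a *: q (u :: s) e;
  Q_mid : forall s u a v t e,
    q (s ++ u ** a%:L :: v :: t) e = q (s ++ u :: a%:L ** v :: t) e;
  Q_right : forall s u a e, q (rcons s (u ** a%:L)) e = q (rcons s u) (a *: e);
  Q_nil : forall a e, q [::] (a *: e) = a *: q [::] e
}.

(* (-1)^n x *)
Definition sgnz (V : zmodType) (n : int) (x : V) : V := if odd `|n|%N then - x else x.

(* u_1, ..., u_l u_{l+1}, ..., u_k *)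
Definition contract (l : nat) (u : seq L) : seq L :=
  take l.-1 u ++ (u`_(l.-1) ** u`_l) :: drop l.+1 u.

Definition dQ E F (i : int) (q : multimap E F) : multimap E F := fun u e =>
  tot_diff (q u e) - sgnz (i + (size u)%:Z) (q u (tot_diff e))
  + \sum_(1 <= l < size u) sgnz (i + l%:Z) (q (contract l u) e).

(* The product pq, for q of degree i. *)
Definition Qmul E F G (i : int) (p : multimap F G) (q : multimap E F) : multimap E G :=
  fun u e => \sum_(0 <= j < (size u).+1)
    sgnz (j%:Z * i) (p (take j u) (q (drop j u) e)).

(* P(q), with T^nA inside T^nL. *)
Definition restrTA E F (q : multimap E F) (s : seq A) (e : tot E) : tot F :=
  q [seq a%:L | a <- s] e.

Record MC E (eta : multimap E E) : Prop := IsMC {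
  MC_Q1 : in_Q 1 eta;
  MC_P : forall s e, restrTA eta s e = if s is [:: a] then a *: e else 0;
  MC_eq : forall u e, dQ 1 eta u e + Qmul 1 eta eta u e = 0
}.

Definition P_is_P0 E F (q : multimap E F) (a0 : tot E -> tot F) : Prop :=
  forall s e, restrTA q s e = if s is [::] then a0 e else 0.

(* d_{eta, phi} on Q^i(E, F) *)
Definition dMC E F (eta : multimap E E) (phi : multimap F F) (i : int) (q : multimap E F) :
    multimap E F := fun u e =>
  dQ i q u e + Qmul i phi q u e - sgnz i (Qmul 1 q eta u e).

End Q.

(* Main.v *)
Require Import Defs.
From HB Require Import structures.
From mathcomp Require Import all_boot all_order all_algebra.
From mathcomp Require Import boolp classical_sets functions.
From mathcomp Require Import reals complex zify.

(** The theorem is an instance of homotopy transfer.  After a twist by signs ([hat]) an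
    element of [Q] becomes a function from words in [L] to additive maps, the product of
    [Q] becomes the sign-free convolution ([conv]), and [d_Q] becomes the commutator with
    the differential plus a derivation that merges consecutive letters ([delta_conv]).
    A Maurer-Cartan element [eta] is then a perturbation of the differential [d].  If
    [F] is a strict deformation retract of [E], with projection [p], inclusion [i] and
    homotopy [h], the perturbation lemma provides
    [phi = p (1 + eta h)^-1 eta i], [a = p (1 + eta h)^-1] and [b = (1 + h eta)^-1 i];
    the inverses exist because [eta] vanishes on the empty word ([series_inverse]), and
    the equations required of [phi], [a] and [b] are three identities in a ring
    ([transferred_mc], [transferred_left], [transferred_right]).  On words of scalars
    [eta] is concentrated on one letter, so that the side conditions [p h = 0] and
    [h i = 0] leave only the leading terms: these are the normalizations of [P].

    A quasi-isomorphism is not a strict retraction, and two steps lead from one to the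
    other.  It is first a homotopy equivalence, by contracting its cone
    ([homotopy_inverse]), as soon as the terms of the complexes are projective.  One then
    adds to [E] a contractible complex [K] that maps onto [F], which leaves room to correct
    the inverse up to homotopy into a strict one ([deformation_retraction]).  For [eta]
    to extend to [K], this complex is made of a free module: there [L] acts strictly,
    coordinate by coordinate, because it acts on functions ([Lact]).

    That locally free modules of infinite rank are projective ([locally_free_projective])
    is the remaining point.  Local sections of a surjection [U -> M] have unbounded
    denominators on an infinitely generated module, and cannot be glued directly.  A
    finitely generated algebra over a field is noetherian ([finitely_generated_acc]), so
    that torsion in free modules is bounded, and gluing is possible over finitely
    generated pieces: a section over one piece, restricted to a smaller one, extends to
    every larger one ([extend_section]).  A zigzag along a countable chain of pieces
    ([good_prolong]) and Zorn's lemma give a global section. *)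

Set Implicit Arguments.
Unset Strict Implicit.
Unset Printing Implicit Defensive.
Import Order.TTheory GRing.Theory Num.Theory.
Local Open Scope ring_scope.

(** * Noetherian rings: the basis theorem for finitely generated algebras *)

Section Noetherian.
Variable A : comPzRingType.
Implicit Types (S J : A -> Prop) (x : A).

Definition subring_pred S : Prop :=
  [/\ S 1, forall a b, S a -> S b -> S (a - b) &
      forall a b, S a -> S b -> S (a * b)].

Definition ideal_in S J : Prop :=
  [/\ forall a, J a -> S a, J 0, forall a b, J a -> J b -> J (a - b) &
      forall s a, S s -> J a -> J (s * a)].

Definition acc S : Prop := forall J : nat -> A -> Prop,
  (forall n, ideal_in S (J n)) -> (forall n a, J n a -> J n.+1 a) ->
  exists N, forall n a, (N <= n)%N -> J n a -> J N a.

Lemma chain_le (J : nat -> A -> Prop) m n a :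
  (forall n a, J n a -> J n.+1 a) -> (m <= n)%N -> J m a -> J n a.
Proof.
move=> JS /subnK <-; elim: (n - m)%N => // k ih h.
by rewrite addSn; apply: JS; apply: ih.
Qed.

Section Adjoin.
Variables (S : A -> Prop) (x : A).
Hypothesis subS : subring_pred S.

Let S1 : S 1. Proof. by case: subS. Qed.
Let SB a b : S a -> S b -> S (a - b). Proof. by case: subS => _ h _; apply: h. Qed.
Let SM a b : S a -> S b -> S (a * b). Proof. by case: subS => _ _; apply. Qed.
Let S0 : S 0. Proof. by rewrite -(subrr 1); apply: SB. Qed.

Definition adjoin (a : A) : Prop := exists n (c : nat -> A),
  (forall i, S (c i)) /\ a = \sum_(i < n) c i * x ^+ i.

Lemma adjoin_le n m (c : nat -> A) : (forall i, S (c i)) -> (n <= m)%N ->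
  exists2 c' : nat -> A, (forall i, S (c' i)) &
    \sum_(i < n) c i * x ^+ i = \sum_(i < m) c' i * x ^+ i.
Proof.
move=> hc /subnKC <-; exists (fun i => if (i < n)%N then c i else 0).
  by move=> i; case: ifP.
rewrite big_split_ord /= [X in _ + X]big1 ?addr0 => [|i _].
  by apply: eq_bigr => i _; rewrite ltn_ord.
by rewrite ltnNge leq_addr mul0r.
Qed.

Lemma adjoinB a b : adjoin a -> adjoin b -> adjoin (a - b).
Proof.
case=> n [c [hc ->]] [m [d [hd ->]]].
have [c' hc' ->] := adjoin_le hc (leq_maxl n m).
have [d' hd' ->] := adjoin_le hd (leq_maxr n m).
exists (maxn n m), (fun i => c' i - d' i); split; first by move=> i; apply: SB.
by rewrite -sumrB; apply: eq_bigr => i _; rewrite mulrBl.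
Qed.

Lemma adjoin_base s : S s -> adjoin s.
Proof.
by move=> hs; exists 1%N, (fun=> s); rewrite big_ord1 expr0 mulr1.
Qed.

Lemma adjoin_scale s a : S s -> adjoin a -> adjoin (s * a).
Proof.
move=> hs [n [c [hc ->]]]; exists n, (fun i => s * c i); split.
  by move=> i; apply: SM.
by rewrite mulr_sumr; apply: eq_bigr => i _; rewrite mulrA.
Qed.

Lemma shift_sum n (c : nat -> A) : x * \sum_(i < n) c i * x ^+ i =
  \sum_(i < n.+1) (if (i : nat) is j.+1 then c j else 0) * x ^+ i.
Proof.
rewrite big_ord_recl mul0r add0r mulr_sumr; apply: eq_bigr => i _.
by rewrite mulrCA -exprS.
Qed.

Lemma adjoin_mulx a : adjoin a -> adjoin (x * a).
Proof.
case=> n [c [hc ->]]; rewrite shift_sum.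
by exists n.+1, (fun i => if i is j.+1 then c j else 0); split=> // -[].
Qed.

Lemma adjoinM a b : adjoin a -> adjoin b -> adjoin (a * b).
Proof.
case=> n [c [hc ->]] hb; rewrite mulr_suml.
have hN t : adjoin t -> adjoin (- t).
  by move=> ht; rewrite -[- t]add0r; apply: adjoinB => //; apply: adjoin_base.
apply: (big_ind adjoin) => [|u v hu hv|i _]; first exact: adjoin_base.
  by rewrite -[v]opprK; apply: adjoinB => //; apply: hN.
rewrite -mulrA; apply: adjoin_scale => //.
elim: (i : nat) => [|k ih]; first by rewrite mul1r.
by rewrite exprS -mulrA; apply: adjoin_mulx.
Qed.

Lemma adjoin_subring : subring_pred adjoin.
Proof.
by split; [apply: adjoin_base|apply: adjoinB|apply: adjoinM].
Qed.

Lemma adjoin_gen : adjoin x.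
Proof. by rewrite -[x]mulr1; apply: adjoin_mulx; apply: adjoin_base. Qed.

(** The leading coefficients of the elements of [J] of degree at most [n] in [x].  The
    coefficients of an element are not unique here, as [x] may be algebraic over [S];
    still, subtracting two elements with the same leading coefficient lowers the
    degree, which is all that Hilbert's argument uses. *)
Definition lead J (n : nat) (s : A) : Prop := S s /\ exists c : nat -> A,
  (forall i, S (c i)) /\ J (s * x ^+ n + \sum_(i < n) c i * x ^+ i).

Lemma lead_ideal J n : ideal_in adjoin J -> ideal_in S (lead J n).
Proof.
case=> _ J0 JB JM; split=> [a [] //||a b [ha [c [hc Jc]]] [hb [d [hd Jd]]]
  |s a hs [ha [c [hc Jc]]]].
- split=> //; exists (fun=> 0); split=> //.
  by rewrite mul0r add0r big1 // => i _; rewrite mul0r.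
- split; first exact: SB.
  exists (fun i => c i - d i); split; first by move=> i; apply: SB.
  rewrite mulrBl (eq_bigr (fun i : 'I_n => c i * x ^+ i - d i * x ^+ i)); last first.
    by move=> i _; rewrite mulrBl.
  by rewrite sumrB addrACA -opprD; apply: JB.
- split; first exact: SM.
  exists (fun i => s * c i); split; first by move=> i; apply: SM.
  rewrite (eq_bigr (fun i : 'I_n => s * (c i * x ^+ i))); last first.
    by move=> i _; rewrite mulrA.
  by rewrite -mulr_sumr -mulrA -mulrDr; apply: JM => //; apply: adjoin_base.
Qed.

Lemma lead_succ J n s : ideal_in adjoin J -> lead J n s -> lead J n.+1 s.
Proof.
case=> _ _ _ JM [hs [c [hc Jc]]]; split=> //.
exists (fun i => if i is j.+1 then c j else 0); split; first by case.
by rewrite -shift_sum exprS mulrCA -mulrDr; apply: JM => //; apply: adjoin_gen.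
Qed.

Lemma lead_sub J J' n s : (forall a, J a -> J' a) -> lead J n s -> lead J' n s.
Proof. by move=> JJ' [hs [c [hc Jc]]]; split=> //; exists c; split=> //; apply: JJ'. Qed.

(** Subtracting an element of [J] with the same leading coefficient lowers the
    degree, so nested ideals with the same leading coefficients coincide. *)
Lemma lead_inj J J' : ideal_in adjoin J -> ideal_in adjoin J' ->
  (forall a, J a -> J' a) -> (forall n s, lead J' n s -> lead J n s) ->
  forall a, J' a -> J a.
Proof.
move=> [_ J0 JB _] [J'S _ J'B _] JJ' hl a J'a.
have [n [c [hc ea]]] := J'S _ J'a; rewrite {}ea in J'a *.
elim: n c hc J'a => [|n ih] c hc; first by rewrite big_ord0.
rewrite big_ord_recr /= addrC => J'c.
have [|_ [d [hd Jd]]] := hl n (c n); first by split=> //; exists c.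
have Jcd : J (\sum_(i < n) (c i - d i) * x ^+ i).
  apply: (ih (fun i => c i - d i)) => [i|]; first exact: SB.
  rewrite (eq_bigr (fun i : 'I_n => c i * x ^+ i - d i * x ^+ i)); last first.
    by move=> i _; rewrite mulrBl.
  by rewrite sumrB -(addrKA (c n * x ^+ n)) ![_ + c n * _]addrC; apply: J'B => //; apply: JJ'.
set u := \sum_(i < n) c i * x ^+ i; set v := \sum_(i < n) d i * x ^+ i in Jd.
have -> : c n * x ^+ n + u = (c n * x ^+ n + v) - (0 - (u - v)).
  by rewrite sub0r opprK -addrA [v + _]addrC subrK.
apply: (JB) => //; apply: (JB) => //.
by rewrite -sumrB; under eq_bigr do rewrite -mulrBl.
Qed.

(** Hilbert's basis theorem.  The ideals [lead (J n) i] increase in both indices;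
    stability along the diagonal settles all large [i] at once, and finitely many
    further chains settle the small ones. *)
Lemma acc_adjoin : acc S -> acc adjoin.
Proof.
move=> accS J idJ JS.
have Jle m n a : (m <= n)%N -> J m a -> J n a by apply: chain_le.
have lead_le i i' m m' s : (i <= i')%N -> (m <= m')%N ->
    lead (J m) i s -> lead (J m') i' s.
  move=> ii' mm' h; apply: (chain_le (J := lead (J m')) _ ii').
    by move=> n b; apply: lead_succ.
  by apply: lead_sub h => b; apply: Jle.
have [N0 hN0] : exists N, forall n s, (N <= n)%N ->
    lead (J n) n s -> lead (J N) N s.
  apply: (accS (fun n => lead (J n) n)) => [n|n s]; first exact: lead_ideal.
  exact: lead_le.
have {}accS i : exists N, forall n s, (N <= n)%N -> lead (J n) i s -> lead (J N) i s.
  apply: (accS (fun n => lead (J n) i)) => [n|n s]; first exact: lead_ideal.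
  by apply: lead_sub => b; apply: JS.
have [Ni hNi] := choice accS.
pose N := (N0 + \sum_(i < N0) Ni i)%N.
exists N => n a hn; apply: lead_inj => //; first by move=> b; apply: Jle.
move=> i s hs; case: (ltnP i N0) => hi.
  have le_i : (Ni i <= N)%N.
    by rewrite /N (bigD1 (Ordinal hi)) //= addnCA leq_addr.
  by apply: (lead_le i _ (Ni i)) => //; apply: (hNi i n) => //; apply: leq_trans hn.
apply: (lead_le N0 i N0 N) => //; first exact: leq_addr.
apply: (hN0 (n + i)%N); first by apply: leq_trans hi (leq_addl _ _).
by apply: lead_le hs; [apply: leq_addl|apply: leq_addr].
Qed.

End Adjoin.

Lemma acc_field_image (K : fieldType) (f : {rmorphism K -> A}) :
  acc (fun a => exists c, a = f c).
Proof.
move=> J idJ JS.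
have [[n [a [Ja /eqP a0]]]|J0] := pselect (exists n a, J n a /\ a <> 0); last first.
  exists 0%N => n a _ Ja; case: (idJ 0%N) => _ J00 _ _.
  by have [->|/eqP a0] := eqVneq a 0 => //; case: J0; exists n, a.
exists n => m b _ Jb; case: (idJ m) (idJ n) => Jm _ _ _ [Jn _ _ JM].
have [[d eb] [c ea]] := (Jm _ Jb, Jn _ Ja).
have c0 : c != 0 by apply: contra_neq a0 => c0; rewrite ea c0 rmorph0.
have -> : b = f (d / c) * a by rewrite ea -rmorphM divfK.
by apply: JM => //; exists (d / c).
Qed.

Lemma finitely_generated_acc (K : fieldType) (f : {rmorphism K -> A}) :
  finitely_generated f -> acc (fun=> True).
Proof.
case=> xs hxs.
suff [S [[_ SB SM] accS Sf Sxs]] : exists S, [/\ subring_pred S, acc S,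
    forall c, S (f c) & forall x, x \in xs -> S x].
  have ST a : S a.
    apply: hxs => // x y hx hy; rewrite -[y]opprK; apply: (SB) => //.
    by rewrite -sub0r; apply: (SB) => //; rewrite -(rmorph0 f).
  by have -> : (fun=> True) = S by apply/funext => a; apply/propext; split.
elim: xs {hxs} => [|x xs [S [sS aS fS xS]]].
  exists (fun a => exists c, a = f c); split=> //; last by move=> c; exists c.
    split; first by exists 1; rewrite rmorph1.
      by move=> _ _ [c ->] [d ->]; exists (c - d); rewrite rmorphB.
    by move=> _ _ [c ->] [d ->]; exists (c * d); rewrite rmorphM.
  exact: acc_field_image.
exists (adjoin S x); split; first exact: adjoin_subring.
- exact: acc_adjoin.
- by move=> c; apply: adjoin_base.
move=> y; rewrite inE => /orP[/eqP ->|hy]; first exact: adjoin_gen.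
by apply: adjoin_base => //; apply: xS.
Qed.

End Noetherian.

Definition bounded_torsion (A : pzRingType) (g : A) (U : lmodType A) : Prop :=
  exists B : nat, forall n (w : U), g ^+ n *: w = 0 -> g ^+ B *: w = 0.

(** The annihilators of the powers of [g] form an increasing chain of ideals. *)
Lemma acc_bounded_torsion (A : comPzRingType) (g : A) :
  acc (fun _ : A => True) -> bounded_torsion g (A^o : lmodType A).
Proof.
move=> accA; have [||B hB] := accA (fun n a => g ^+ n * a = 0).
- move=> n; split=> [//||a b ha hb|s a _ ha]; rewrite ?mulr0 //.
    by rewrite mulrBr ha hb subrr.
  by rewrite mulrCA ha mulr0.
- by move=> n a h; rewrite exprS -mulrA h mulr0.
exists B => n w hw; apply: (hB (n + B)%N); first exact: leq_addl.
by rewrite addnC exprD -mulrA [X in _ * X]hw mulr0.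
Qed.

(** * Free modules, projective modules and bases after localization *)

Section Free.
Variables (A : comPzRingType) (T : choiceType).

Definition finite_support (x : T -> A^o) : Prop :=
  exists s : seq T, forall t, t \notin s -> x t = 0.

Fact finite_support_closed : finite_support 0 /\
  forall a x y, finite_support x -> finite_support y -> finite_support (a *: x + y).
Proof.
split=> [|a x y [s hs] [r hr]]; first by exists [::].
exists (s ++ r) => t; rewrite mem_cat negb_or => /andP[/hs ht /hr ht'].
by rewrite -[LHS]/(a *: x t + y t) ht ht' scaler0 addr0.
Qed.

Definition Free : lmodType A := subm (Submod finite_support_closed).

Definition coef (x : Free) : T -> A := val (x : subm (Submod finite_support_closed)).

Definition mkFree (x : T -> A) (hx : finite_support x) : Free :=
  exist _ (x : T -> A^o) (asboolT hx).

Lemma coefD x y t : coef (x + y) t = coef x t + coef y t. Proof. by []. Qed.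
Lemma coefZ a x t : coef (a *: x) t = a * coef x t. Proof. by []. Qed.

Lemma coefP x y : coef x =1 coef y -> x = y.
Proof. by move=> h; apply/val_inj/funext. Qed.

Lemma coef_finite (x : Free) : finite_support (coef x).
Proof. exact/asboolP/(valP (x : subm (Submod finite_support_closed))). Qed.

Definition supp (x : Free) : seq T := undup (projT1 (cid (coef_finite x))).

Lemma suppP x t : t \notin supp x -> coef x t = 0.
Proof. by rewrite mem_undup; apply: (projT2 (cid (coef_finite x))). Qed.

Section Eval.
Variables (W : lmodType A) (v : T -> W).

(** The linear map that sends the unit vector at [t] to [v t]. *)
Definition fev (x : Free) : W := \sum_(t <- supp x) coef x t *: v t.

Lemma fevE x s : uniq s -> (forall t, t \notin s -> coef x t = 0) ->
  fev x = \sum_(t <- s) coef x t *: v t.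
Proof.
have main (r : seq T) : \sum_(t <- r) coef x t *: v t =
    \sum_(t <- [seq t <- r | coef x t != 0]) coef x t *: v t.
  rewrite big_filter [in RHS]big_mkcond; apply: eq_bigr => t _.
  by case: eqP => [->|//]; rewrite scale0r.
move=> us hs; rewrite /fev main [in RHS]main; apply: perm_big.
apply: uniq_perm; rewrite ?filter_uniq ?undup_uniq // => t.
rewrite !mem_filter; case: (eqVneq (coef x t) 0) => //= h.
have -> : t \in supp x by apply: contraNT h => /suppP ->.
by apply/esym; apply: contraNT h => /hs ->.
Qed.

Fact fev_linear : linear fev.
Proof.
move=> a x y; pose s := undup (supp (a *: x + y) ++ supp x ++ supp y).
have mem_s t : t \notin s -> [/\ coef (a *: x + y) t = 0, coef x t = 0 & coef y t = 0].
  by rewrite mem_undup !mem_cat !negb_or => /and3P[/suppP ? /suppP ? /suppP].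
have us : uniq s by apply: undup_uniq.
rewrite (fevE us (x := a *: x + y)) => [|t /mem_s [] //].
rewrite (fevE us (x := x)) => [|t /mem_s [] //].
rewrite (fevE us (x := y)) => [|t /mem_s [] //].
rewrite scaler_sumr -big_split; apply: eq_bigr => t _ /=.
by rewrite coefD coefZ scalerDl scalerA.
Qed.
HB.instance Definition _ := GRing.isLinear.Build A Free W _ fev fev_linear.
End Eval.

Fact unit_vector_finite t : finite_support (fun t' => if t' == t then 1 else 0).
Proof. by exists [:: t] => t'; rewrite inE => /negbTE ->. Qed.
Definition unit_vector t : Free := mkFree (unit_vector_finite t).

Lemma fev_unit (W : lmodType A) (v : T -> W) t : fev v (unit_vector t) = v t.
Proof.
rewrite (@fevE _ _ _ [:: t]) // => [|t' h]; first by rewrite big_seq1 /coef /= eqxx scale1r.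
by rewrite /coef /=; move: h; rewrite inE => /negbTE ->.
Qed.

Lemma linear_fev (W W' : lmodType A) (p : {linear W -> W'}) (v : T -> W) x :
  p (fev v x) = fev (p \o v) x.
Proof. by rewrite /fev linear_sum; apply: eq_bigr => t _; rewrite linearZ. Qed.

Lemma eq_fev (W : lmodType A) (v v' : T -> W) x : v =1 v' -> fev v x = fev v' x.
Proof. by move=> h; apply: eq_bigr => t _; rewrite h. Qed.

Lemma Free_torsion g : bounded_torsion g (A^o : lmodType A) -> bounded_torsion g Free.
Proof.
case=> B hB; exists B => n w hw; apply: coefP => t; apply: (hB n).
by rewrite -[LHS](coefZ (g ^+ n) w t) hw.
Qed.

End Free.

Definition projective (A : pzRingType) (M : lmodType A) : Prop :=
  forall (U W : lmodType A) (p : {linear U -> W}) (g : {linear M -> W}),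
  (forall z, exists u, p u = g z) ->
  exists t : {linear M -> U}, forall z, p (t z) = g z.

(** A direct summand of a free module inherits its lifting property. *)
Lemma projective_section (A : comPzRingType) (M : lmodType A)
    (s : {linear M -> Free A M}) : (forall z, fev id (s z) = z) -> projective M.
Proof.
move=> hs U W p g hg; have [v hv] := choice hg.
exists (fev v \o s : {linear M -> U}) => z /=.
rewrite linear_fev (eq_fev (v' := g \o id)) => [|t]; last exact: hv.
by rewrite -linear_fev hs.
Qed.

Section SubmodPred.
Variables (A : pzRingType) (M : lmodType A).
Implicit Type N : M -> Prop.

Definition subspace N : Prop := N 0 /\ forall a x y, N x -> N y -> N (a *: x + y).

Lemma subspaceZ N a x : subspace N -> N x -> N (a *: x).
Proof. by case=> N0 h hx; rewrite -[_ *: _]addr0; apply: h. Qed.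

(** Defined by its universal property, so that no coefficients have to be chosen. *)
Definition gen N (Y : M -> Prop) (z : M) : Prop := forall S : M -> Prop,
  subspace S -> (forall x, N x -> S x) -> (forall y, Y y -> S y) -> S z.

Lemma gen_subspace N Y : subspace (gen N Y).
Proof.
split=> [S [] //|a x y hx hy S sS NS YS].
by case: (sS) => _; apply; [apply: hx|apply: hy].
Qed.
Lemma gen_l N (Y : M -> Prop) x : N x -> gen N Y x. Proof. by move=> h S _ NS _; apply: NS. Qed.
Lemma gen_r N (Y : M -> Prop) y : Y y -> gen N Y y. Proof. by move=> h S _ _; apply. Qed.
Lemma gen_ind N (Y S : M -> Prop) : subspace S -> (forall x, N x -> S x) ->
  (forall y, Y y -> S y) -> forall z, gen N Y z -> S z.
Proof. by move=> h1 h2 h3 z; apply. Qed.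
Lemma gen_mono N (Y Y' : M -> Prop) : (forall y, Y y -> Y' y) ->
  forall z, gen N Y z -> gen N Y' z.
Proof.
move=> h; apply: gen_ind; [exact: gen_subspace|exact: gen_l|].
by move=> y /h; apply: gen_r.
Qed.

End SubmodPred.

Section LocalBasis.
Variables (A : comPzRingType) (M : lmodType A) (g : A).

(** A family of elements of [M] whose images form a basis of [M[1/g]] over
    [A[1/g]], expressed without denominators. *)
Definition gbasis (I : eqType) (x : I -> M) : Prop :=
  (forall m, exists n (l : seq (I * A)), g ^+ n *: m = \sum_(p <- l) p.2 *: x p.1) /\
  (forall (s : seq I) (c : I -> A), uniq s -> \sum_(i <- s) c i *: x i = 0 ->
     forall i, i \in s -> exists n, g ^+ n * c i = 0).

(** A relation between the [x i] holds between any [v i] in another module, up to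
    a power of [g]. *)
Lemma gbasis_torsion (I : eqType) (x : I -> M) (U : lmodType A) (v : I -> U)
    (l : seq (I * A)) : gbasis x -> \sum_(p <- l) p.2 *: x p.1 = 0 ->
  exists n, g ^+ n *: \sum_(p <- l) p.2 *: v p.1 = 0.
Proof.
case=> _ indep; pose s := undup (map fst l).
pose c i := \sum_(p <- l | p.1 == i) p.2.
have coll (W : lmodType A) (w : I -> W) :
    \sum_(p <- l) p.2 *: w p.1 = \sum_(i <- s) c i *: w i.
  under [in RHS]eq_bigr do rewrite /c scaler_suml.
  rewrite (exchange_big_dep xpredT) //= big_seq [in RHS]big_seq.
  apply: eq_bigr => p hp; rewrite (eq_bigl (pred1 p.1)) => [|i]; last by rewrite /= eq_sym.
  rewrite -big_filter filter_pred1_uniq ?undup_uniq ?big_seq1 // mem_undup.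
  exact: map_f.
rewrite !coll => /indep h; have us : uniq s by apply: undup_uniq.
have {us}h := h us; elim: (s) h => [|i r ih] h; first by exists 0%N; rewrite big_nil scaler0.
have [|n hn] := ih; first by move=> j hj; apply: h; rewrite inE hj orbT.
have [m hm] := h i (mem_head _ _).
exists (m + n)%N; rewrite big_cons scalerDr {2}exprD -[in X in _ + X]scalerA hn scaler0.
by rewrite addr0 addnC exprD scalerA -mulrA hm mulr0 scale0r.
Qed.

(** Multiplying the basis elements by powers of [g], which are units, clears their
    denominators. *)
Lemma basis_gbasis (I : eqType) (b : I -> loc g M) : is_basis b ->
  exists x : I -> M, gbasis x.
Proof.
case=> spanb indb.
exists (fun i => (repr (b i)).1).
set x := fun i => _; pose k i := (repr (b i)).2.
have bE i : b i = Defs.frac g (x i) (k i) by rewrite frac_repr.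
have sumE (s : seq I) (F : I -> M) K :
    \sum_(i <- s) Defs.frac g (F i) K = Defs.frac g (\sum_(i <- s) F i) K.
  elim: s => [|i s ih]; first by rewrite !big_nil; apply/frac_eq; exists 0%N; rewrite !scaler0.
  rewrite !big_cons ih fracD; apply/frac_eq; exists 0%N.
  by rewrite -scalerDr scalerA -exprD add0n.
split=> [m|s c us hsum i hi].
  have [s [c hc]] := spanb (Defs.frac g m 0).
  have {}hc : Defs.frac g m 0 = \sum_(i <- s) Defs.frac g ((repr (c i)).1 *: x i) ((repr (c i)).2 + k i).
    rewrite hc; apply: eq_bigr => i _.
    by rewrite bE -[c i in LHS]frac_repr [LHS]locr_actE.
  pose K := \sum_(i <- s) ((repr (c i)).2 + k i)%N.
  pose a i := g ^+ (K - ((repr (c i)).2 + k i)) * (repr (c i)).1.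
  have : Defs.frac g m 0 = Defs.frac g (\sum_(i <- s) a i *: x i) K.
    rewrite hc -sumE big_seq [in RHS]big_seq; apply: eq_bigr => i hi.
    apply/frac_eq; exists 0%N; rewrite !add0n /a !scalerA mulrA -exprD subnKC //.
    by rewrite /K (big_rem i) //= leq_addr.
  move/frac_eq => [n]; rewrite addn0 => h; exists (n + K)%N, [seq (i, g ^+ n * a i) | i <- s].
  by rewrite h big_map scaler_sumr; apply: eq_bigr => j _; rewrite scalerA.
(* [x i] is [g ^+ k i] times [b i], so the relation is rescaled accordingly. *)
suff /(indb s (fun i => fracr g (g ^+ k i * c i) 0) us)/(_ i hi) :
    \sum_(i <- s) fracr g (g ^+ k i * c i) 0 *: b i = 0.
  move=> /(@frac_eq _ _ A^o _ _ 0 0) [n]; rewrite addn0 scaler0 => h.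
  by exists (n + k i)%N; rewrite exprD -mulrA.
transitivity (Defs.frac g (\sum_(j <- s) c j *: x j) 0); last by rewrite hsum.
rewrite -sumE; apply: eq_bigr => j _; rewrite bE [LHS]locr_actE.
by apply/frac_eq; exists 0%N; rewrite !add0n expr0 scale1r scalerA.
Qed.

End LocalBasis.

(** * Locally free modules are projective *)

Section MkLinear.
Variables (A : pzRingType) (M U : lmodType A) (f : M -> U) (hf : linear f).
Definition mklin of linear f := f.
HB.instance Definition _ := GRing.isLinear.Build A M U _ (mklin hf) hf.
Definition linmap : {linear M -> U} := mklin hf.
Lemma linmapE x : linmap x = f x. Proof. by []. Qed.
End MkLinear.

Lemma scaler_swap (A : comPzRingType) (M : lmodType A) (a b : A) (v : M) :
  a *: (b *: v) = b *: (a *: v).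
Proof. by rewrite !scalerA mulrC. Qed.

(** In a large power of the sum that equals one, every monomial contains a large power
    of one of the members of the cover. *)
Lemma radical_unit (A : comPzRingType) (gs : seq A) (P : A -> Prop) :
  unit_cover gs -> P 0 -> (forall a b, P a -> P b -> P (a + b)) ->
  (forall a b, P b -> P (a * b)) ->
  (forall g, g \in gs -> exists n, P (g ^+ n)) -> P 1.
Proof.
move=> [c hc] P0 PD PM; suff h : forall s, (forall g, g \in s -> exists n, P (g ^+ n)) ->
    exists n, P ((\sum_(g <- s) c g * g) ^+ n).
  by move=> /h [n]; rewrite hc expr1n.
elim=> [|g s ih] h; first by exists 1%N; rewrite big_nil expr1.
have [|n hn] := ih; first by move=> k hk; apply: h; rewrite inE hk orbT.
have [m hm] := h g (mem_head _ _).
exists (m + n)%N; rewrite big_cons exprDn; apply: (big_ind P) => // i _.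
rewrite -mulr_natl; apply: (PM).
have [hi|hi] := leqP n i; last first.
  have -> : (m + n - i = (n - i) + m)%N by rewrite -addnBA 1?addnC // ltnW.
  by rewrite mulrC; apply: (PM); rewrite exprMn; apply: (PM); rewrite exprD; apply: (PM).
by rewrite -(subnK hi) exprD mulrA; apply: (PM).
Qed.

Section LocallyFree.
Variables (A : comPzRingType) (M U : lmodType A) (pi : {linear U -> M}).
Variables (gs : seq A) (I : A -> eqType) (x : forall g, I g -> M).
Hypothesis cover : unit_cover gs.
Hypothesis basis : forall g, g \in gs -> gbasis g (@x g).
Hypothesis torsion : forall g, g \in gs -> bounded_torsion g U.
Hypothesis surj : forall m, exists u, pi u = m.
Implicit Types W N : M -> Prop.

Definition section_on W (t : M -> U) : Prop :=
  (forall a y z, W y -> W z -> t (a *: y + z) = a *: t y + t z) /\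
  (forall y, W y -> pi (t y) = y).

(** Formal combinations of basis elements are lists of pairs, possibly with repeated
    indices: concatenating lists adds combinations. *)
Definition lcomb g (V : lmodType A) (v : I g -> V) (l : seq (I g * A)) : V :=
  \sum_(p <- l) p.2 *: v p.1.

Lemma lcombD g (V : lmodType A) (v : I g -> V) l l' : lcomb v (l ++ l') = lcomb v l + lcomb v l'.
Proof. exact: big_cat. Qed.

Definition lscale g (a : A) (l : seq (I g * A)) := [seq (p.1, a * p.2) | p <- l].

Lemma lcombZ g (V : lmodType A) (v : I g -> V) a l : lcomb v (lscale a l) = a *: lcomb v l.
Proof. by rewrite /lcomb big_map scaler_sumr; apply: eq_bigr => p _; rewrite scalerA. Qed.

Definition spanned_by W (g : A) (y : M) : Prop := exists n (l : seq (I g * A)),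
  g ^+ n *: y = lcomb (@x g) l /\ forall p, p \in l -> W (x p.1).

(** [W1] is large enough to contain the basis elements that [W0] needs locally. *)
Definition locally_spanned W0 W1 : Prop :=
  forall y g, W0 y -> g \in gs -> spanned_by W1 g y.

(** The exponent [r] depends only on [g]: this is how finite generation over [W0] is
    used, denominators being otherwise unbounded. *)
Definition finite_over W0 W2 : Prop := forall g, g \in gs -> exists r, forall z,
  W2 z -> exists y (l : seq (I g * A)), W0 y /\ g ^+ r *: z = y + lcomb (@x g) l.

Lemma spanned_subspace W g : subspace (spanned_by W g).
Proof.
split; first by exists 0%N, [::]; rewrite scaler0 /lcomb big_nil.
move=> a y z [n [l [hl Wl]]] [m [r [hr Wr]]].
exists (n + m)%N, (lscale (a * g ^+ m) l ++ lscale (g ^+ n) r); split.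
  rewrite lcombD !lcombZ -hl -hr scalerDr !scalerA exprD; congr (_ *: _ + _ *: _).
  by rewrite mulrC -[RHS]mulrA [g ^+ m * _]mulrC.
by move=> p; rewrite mem_cat => /orP[] /mapP[q hq ->]; [apply: (Wl q)|apply: (Wr q)].
Qed.

Section Extension.
Variables (W0 W1 W2 : M -> Prop) (t : M -> U).
Hypotheses (sub0 : subspace W0) (sub1 : subspace W1) (sub2 : subspace W2).
Hypotheses (W01 : forall y, W0 y -> W1 y) (W02 : forall y, W0 y -> W2 y).
Hypothesis ht : section_on W1 t.
Hypothesis spanned : locally_spanned W0 W1.
Hypothesis finite : finite_over W0 W2.

(** [e] times the section extends: an ideal of scalars, whose members need only be
    exhibited locally. *)
Definition extendable (e : A) : Prop := exists f : M -> U,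
  [/\ forall a y z, W2 y -> W2 z -> f (a *: y + z) = a *: f y + f z,
      forall y, W2 y -> pi (f y) = e *: y &
      forall y, W0 y -> f y = e *: t y].

(** Over the localization at [g], the section [t] is prolonged by keeping its values at
    the basis elements that lie in [W1] and by choosing arbitrary lifts of the others.
    The relation [G] below is the graph of this prolongation; its fibre over zero is
    torsion, hence killed by one fixed power of [g], and a further power clears the
    denominators on [W2]. *)
Lemma extendable_local g : g \in gs -> exists n, extendable (g ^+ n).
Proof.
move=> hg; case: (ht) => t_lin t_sec.
have t0 : t 0 = 0.
  by have := t_lin 1 0 0 sub1.1 sub1.1; rewrite scaler0 addr0 scale1r -{1}[t 0]addr0 => /addrI.
have t_lc (l : seq (I g * A)) : (forall p, p \in l -> W1 (x p.1)) ->
    W1 (lcomb (@x g) l) /\ t (lcomb (@x g) l) = lcomb (t \o @x g) l.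
  elim: l => [|p l ih] h; first by rewrite /lcomb !big_nil t0; split=> //; case: sub1.
  have [|Wl tl] := ih; first by move=> q hq; apply: h; rewrite inE hq orbT.
  have Wp := h p (mem_head _ _).
  by rewrite /lcomb !big_cons t_lin // -/(lcomb _ l) tl; split=> //; apply: sub1.2.
have t_Z a y : W1 y -> t (a *: y) = a *: t y.
  by move=> Wy; have /= := t_lin a y 0 Wy sub1.1; rewrite addr0 t0 addr0.
have [v hv] : exists v : I g -> U, forall j,
    pi (v j) = x j /\ (W1 (x j) -> v j = t (x j)).
  suff /choice [v hv] : forall j : I g, exists u, pi u = x j /\ (W1 (x j) -> u = t (x j)).
    by exists v.
  move=> j; have [Wj|nWj] := pselect (W1 (x j)).
    by exists (t (x j)); split=> //; apply: t_sec.
  by have [u hu] := surj (x j); exists u; split.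
pose G z w := exists y l, [/\ W0 y, z = y + lcomb (@x g) l & w = t y + lcomb v l].
have GD a z w z' w' : G z w -> G z' w' -> G (a *: z + z') (a *: w + w').
  move=> [y [l [Wy -> ->]]] [y' [l' [Wy' -> ->]]].
  exists (a *: y + y'), (lscale a l ++ l'); rewrite !lcombD !lcombZ !scalerDr; split.
  - exact: sub0.2.
  - by rewrite addrACA.
  - by rewrite t_lin; [exact: addrACA|exact: W01|exact: W01].
have Gpi z w : G z w -> pi w = z.
  move=> [y [l [Wy -> ->]]]; rewrite raddfD /= t_sec; last exact: W01.
  rewrite linear_sum; congr (_ + _).
  by apply: eq_bigr => p _; rewrite linearZ /= (hv _).1 //.
have [B hB] := torsion hg.
have G0 w : G 0 w -> g ^+ B *: w = 0.
  move=> [y [l [Wy /esym e0 ->]]]; have [n [r [hr Wr]]] := spanned Wy hg.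
  have [] := gbasis_torsion (l := r ++ lscale (g ^+ n) l) v (basis hg).
    by rewrite -/(lcomb _ _) lcombD lcombZ -hr -scalerDr e0 scaler0.
  move=> m; rewrite -/(lcomb _ _) lcombD lcombZ => hm; apply: (hB (m + n)%N).
  rewrite exprD -scalerA scalerDr -t_Z; last exact: W01.
  rewrite -[RHS]hm hr (t_lc _ Wr).2; congr (_ *: (_ + _)).
  by rewrite /lcomb big_seq [in RHS]big_seq; apply: eq_bigr => p hp; rewrite (hv _).2 //; apply: Wr.
have [r hr] := finite hg.
have /choice [f hf] : forall z, exists w, W2 z -> G (g ^+ r *: z) w.
  move=> z; have [Wz|nWz] := pselect (W2 z); last by exists 0.
  by have [y [l [Wy e]]] := hr z Wz; exists (t y + lcomb v l) => _; exists y, l.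
exists (B + r)%N, (fun z => g ^+ B *: f z); split=> [a y z Wy Wz|y Wy|y Wy].
- have Wyz : W2 (a *: y + z) by apply: sub2.2.
  have h : G 0 (f (a *: y + z) - (a *: f y + f z)).
    have := GD (-1) _ _ _ _ (GD a _ _ _ _ (hf _ Wy) (hf _ Wz)) (hf _ Wyz).
    by rewrite !scaleN1r addrC [_ *: (a *: y + z)]scalerDr [g ^+ r *: (a *: y)]scaler_swap subrr addrC.
  by move/eqP: (G0 _ h); rewrite scalerBr subr_eq0 => /eqP ->; rewrite scalerDr [g ^+ B *: (a *: _)]scaler_swap.
- by rewrite linearZ /= (Gpi _ _ (hf _ Wy)) scalerA exprD.
have h : G 0 (f y - g ^+ r *: t y).
  have Gy : G (g ^+ r *: y) (g ^+ r *: t y).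
    exists (g ^+ r *: y), [::]; rewrite /lcomb !big_nil !addr0 t_Z //; last exact: W01.
    by split=> //; apply: subspaceZ.
  by have := GD (-1) _ _ _ _ Gy (hf _ (W02 Wy)); rewrite !scaleN1r !addNr addrC.
by move/eqP: (G0 _ h); rewrite scalerBr subr_eq0 exprD scalerA => /eqP.
Qed.

(** The values of a section on [W1] at [W0] can be prolonged to any [W2] that is finite
    over [W0], even when the section itself cannot: this is the Mittag-Leffler
    condition for sections over finitely generated submodules. *)
Lemma extend_section : exists t' : M -> U,
  section_on W2 t' /\ forall y, W0 y -> t' y = t y.
Proof.
suff [f [f1 f2 f3]] : extendable 1.
  exists f; split=> [|y /f3 ->]; last by rewrite scale1r.
  by split=> // y /f2 ->; rewrite scale1r.
apply: (radical_unit cover).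
- exists (fun=> 0); split=> [a y z _ _|y _|y _]; first by rewrite scaler0 addr0.
    by rewrite raddf0 scale0r.
  by rewrite scale0r.
- move=> a b [f [f1 f2 f3]] [f' [f1' f2' f3']]; exists (fun y => f y + f' y).
  split=> [c y z Wy Wz|y Wy|y Wy].
  + by rewrite f1 // f1' // scalerDr addrACA.
  + by rewrite linearD f2 // f2' // scalerDl.
  + by rewrite f3 // f3' // scalerDl.
- move=> a b [f [f1 f2 f3]]; exists (fun y => a *: f y); split=> [c y z Wy Wz|y Wy|y Wy].
  + by rewrite f1 // scalerDr scalerA mulrC -scalerA.
  + by rewrite linearZ /= f2 // scalerA.
  + by rewrite f3 // scalerA.
exact: extendable_local.
Qed.
End Extension.

Lemma finite_over_gen N W0 (Y : seq M) : subspace W0 -> (forall y, N y -> W0 y) ->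
  finite_over W0 (gen N (fun y => y \in Y)).
Proof.
move=> sW NW g hg.
have [r hr] : exists r, forall y, y \in Y ->
    exists l : seq (I g * A), g ^+ r *: y = lcomb (@x g) l.
  elim: Y => [|y Y [r hr]]; first by exists 0%N.
  have [n [l hl]] := (basis hg).1 y; exists (n + r)%N => z; rewrite inE => /orP[/eqP ->|hz].
    by exists (lscale (g ^+ r) l); rewrite lcombZ /lcomb -hl scalerA -exprD addnC.
  have [l' hl'] := hr z hz; exists (lscale (g ^+ n) l').
  by rewrite lcombZ -hl' scalerA -exprD.
exists r; apply: gen_ind.
- split; first by exists 0, [::]; rewrite /lcomb big_nil scaler0 addr0; split=> //; case: sW.
  move=> a y z [y1 [l1 [Wy1 e1]]] [y2 [l2 [Wy2 e2]]].
  exists (a *: y1 + y2), (lscale a l1 ++ l2); split; first exact: sW.2.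
  by rewrite scalerDr [g ^+ r *: (a *: y)]scaler_swap e1 e2 lcombD lcombZ scalerDr addrACA.
- move=> y Ny; exists (g ^+ r *: y), [::]; rewrite /lcomb big_nil addr0; split=> //.
  by apply: subspaceZ => //; apply: NW.
- move=> y Yy; have [l hl] := hr y Yy; exists 0, l; rewrite add0r; split=> //.
  by case: sW.
Qed.

Definition image_of (G : U -> Prop) (m : M) : Prop := exists2 u, G u & pi u = m.

(** A section over a submodule is recorded by its image [G] in [U].  The submodule
    [pi G] must be spanned, after inverting each [g], by members of the given basis:
    this is what lets the section be prolonged. *)
Definition good_graph (G : U -> Prop) : Prop :=
  [/\ forall a u v, G u -> G v -> G (a *: u + v),
      forall u, G u -> pi u = 0 -> u = 0 &
      locally_spanned (image_of G) (image_of G)].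

Lemma good_chain (F : set (set U)) : (F `<=` good_graph)%classic ->
  total_on F subset -> good_graph (\bigcup_(G in F) G)%classic.
Proof.
move=> FP Ftot; split=> [a u v [G FG Gu] [G' FG' G'v]|u [G FG Gu]|y g [u [G FG Gu] <-] hg].
- have [GG'|G'G] := Ftot _ _ FG FG'.
    by exists G' => //; case: (FP _ FG') => h _ _; apply: h => //; apply: GG'.
  by exists G => //; case: (FP _ FG) => h _ _; apply: h => //; apply: G'G.
- by case: (FP _ FG) => _ h _; apply: h.
have [_ _ spanG] := FP _ FG.
have [n [l [e hl]]] := spanG (pi u) g (ex_intro2 _ _ u Gu erefl) hg.
by exists n, l; split=> // p /hl [w Gw ew]; exists w => //; exists G.
Qed.

(** What one step of the closure process below adjoins on account of [y]. *)
Lemma finite_cover_span (y : M) : exists Y : seq M,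
  forall g, g \in gs -> spanned_by (fun z => z \in Y) g y.
Proof.
have /choice [Y hY] : forall g, exists Y : seq M,
    g \in gs -> spanned_by (fun z => z \in Y) g y.
  move=> g; have [hg|nhg] := boolP (g \in gs); last by exists [::].
  have [n [l hl]] := (basis hg).1 y; exists [seq x p.1 | p <- l] => _.
  by exists n, l; split=> // p hp; apply/mapP; exists p.
exists (flatten [seq Y g | g <- gs]) => g hg; have [n [l [e hl]]] := hY g hg.
exists n, l; split=> // p /hl hp; apply/flattenP; exists (Y g) => //.
by apply/mapP; exists g.
Qed.

(** The increasing finite sets [Y i] absorb the basis elements that their members need.
    The section [t i.+1] over the submodule [W i.+2] is required to agree with [t i]
    only on [W i], one step below the domain of [t i]; the values on each [W i] are
    then stable, and their union is a section over a larger good submodule. *)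
Lemma good_prolong (G : U -> Prop) (m : M) : good_graph G -> G 0 -> ~ image_of G m ->
  exists G' : U -> Prop, [/\ good_graph G', forall u, G u -> G' u & image_of G' m].
Proof.
move=> [GD Ginj Gspan] G0 nGm; pose N := image_of G.
have sN : subspace N.
  split=> [|a _ _ [u Gu <-] [v Gv <-]]; first by exists 0; rewrite ?raddf0.
  by exists (a *: u + v); rewrite ?linearP //; apply: GD.
have /choice [s hs] : forall y, exists u, N y -> G u /\ pi u = y.
  move=> y; have [[u Gu e]|nNy] := pselect (N y); first by exists u.
  by exists 0.
have s_pi u : G u -> s (pi u) = u.
  move=> Gu; have [|Gs e] := hs (pi u); first by exists u.
  apply/eqP; rewrite -subr_eq0; apply/eqP; apply: Ginj; last by rewrite linearB e subrr.
  by rewrite addrC -scaleN1r; apply: GD.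
have s_sec : section_on N s.
  split=> [a y z Ny Nz|y Ny]; last by case: (hs y Ny).
  have [Gy ey] := hs y Ny; have [Gz ez] := hs z Nz.
  by rewrite -[in LHS]ey -[in LHS]ez -linearP s_pi //; apply: GD.
have /choice [cl hcl] := finite_cover_span.
pose Y i := iter i (fun Y => Y ++ flatten [seq cl y | y <- Y] ++ [:: m]) [::].
pose W i := gen N (fun y => y \in Y i).
have sW i : subspace (W i) by apply: gen_subspace.
have YS i y : y \in Y i -> y \in Y i.+1 by rewrite /= mem_cat => ->.
have WS i y : W i y -> W i.+1 y by apply: gen_mono; apply: YS.
have NW i y : N y -> W i y by apply: gen_l.
have Wspan i : locally_spanned (W i) (W i.+1).
  move=> y g Wy hg; apply: Wy; first exact: spanned_subspace.
    move=> z Nz; have [n [l [e hl]]] := Gspan _ _ Nz hg.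
    by exists n, l; split=> // p /hl; apply: NW.
  move=> z hz; have [n [l [e hl]]] := hcl z g hg.
  exists n, l; split=> // p /hl hp; apply: gen_r; rewrite /= !mem_cat.
  apply/orP; right; apply/orP; left; apply/flattenP; exists (cl z) => //.
  by apply/mapP; exists z.
pose good i t := section_on (W i.+1) t /\ forall y, N y -> t y = s y.
have [t0 ht0] : exists t0, good 0%N t0.
  by apply: (extend_section sN sN (sW 1%N) _ (NW 1%N) s_sec Gspan) => //; apply: finite_over_gen.
have step i t : exists t', good i t -> good i.+1 t' /\ forall y, W i y -> t' y = t y.
  have [[ht tN]|nt] := pselect (good i t); last by exists t.
  have W2 y : W i y -> W i.+2 y by move=> /WS /WS.
  have [t' [ht' e]] := extend_section (sW i) (sW i.+1) (sW i.+2) (WS i) W2 ht (Wspan i)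
    (finite_over_gen (Y i.+2) (sW i) (@NW i)).
  exists t' => _; split=> //; split=> // y Ny; rewrite e ?tN //; exact: NW.
have /choice [next hnext] : forall it : nat * (M -> U), exists t',
    good it.1 it.2 -> good it.1.+1 t' /\ forall y, W it.1 y -> t' y = it.2 y.
  by case=> i t; apply: step.
pose t := fix t i := if i is j.+1 then next (j, t j) else t0.
have tgood i : good i (t i) by elim: i => // i /(hnext (i, t i)) [].
have tS i y : W i y -> t i.+1 y = t i y by case: (hnext (i, t i) (tgood i)) => _; apply.
have Wle i k y : W i y -> W (k + i)%N y.
  by move=> Wy; elim: k => // k ih; rewrite addSn; apply: WS.
have tle i k y : W i y -> t (k + i)%N y = t i y.
  by move=> Wy; elim: k => // k ih; rewrite addSn tS //; apply: Wle.
pose G' u := exists i y, W i y /\ u = t i y.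
have G'pi i y : W i y -> pi (t i y) = y.
  by move=> Wy; case: (tgood i) => -[_ h] _; apply: h; apply: WS.
exists G'; split.
- split.
  + move=> a _ _ [i [y [Wy ->]]] [j [z [Wz ->]]].
    rewrite -(tle i j y Wy) -(tle j i z Wz) (addnC j i).
    have {}Wy := Wle i j y Wy; have {}Wz := Wle j i z Wz; rewrite addnC in Wy.
    exists (i + j)%N, (a *: y + z); split; first exact: (sW _).2.
    by have [[tl _] _] := tgood (i + j)%N; rewrite tl //; apply: WS.
  + move=> _ [i [y [Wy ->]]]; rewrite (G'pi _ _ Wy) => y0; rewrite y0.
    have [[h _] _] := tgood i; have /= := h (-1) 0 0 (sW _).1 (sW _).1.
    by rewrite scaler0 addr0 scaleN1r addNr.
  + move=> _ g [_ [i [y [Wy ->]]] <-] hg; rewrite (G'pi _ _ Wy).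
    have [n [l [e hl]]] := Wspan i _ _ Wy hg; exists n, l; split=> // p /hl Wp.
    by exists (t i.+1 (x p.1)); [exists i.+1, (x p.1)|apply: G'pi].
- move=> u Gu; have Nu : N (pi u) by exists u.
  exists 0%N, (pi u); split; first exact: NW.
  by case: (tgood 0%N) => _ ->; rewrite ?s_pi.
exists (t 1%N m); last by apply: G'pi; apply: gen_r; rewrite mem_seq1.
by exists 1%N, m; split=> //; apply: gen_r; rewrite mem_seq1.
Qed.

Lemma split_of_local_basis : exists s : {linear M -> U}, forall m, pi (s m) = m.
Proof.
have [G [gG Gmax]] := Zorn_bigcup good_chain.
have G0 : G 0.
  case: (gG) => GD _ _; have [[u Gu]|nG] := pselect (exists u, G u).
    by rewrite -(addNr u) -scaleN1r; apply: GD.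
  case: (Gmax (fun u => u = 0)).
    by split=> [u Gu|h]; [case: nG; exists u|apply: nG; exists 0; apply: h].
  split=> [a u v -> ->|//|y g [u -> <-] hg]; first by rewrite scaler0 addr0.
  by exists 0%N, [::]; rewrite raddf0 scaler0 /lcomb big_nil.
have Gsurj m : image_of G m.
  apply: contrapT => nGm; have [G' [gG' GG' [u G'u e]]] := good_prolong gG G0 nGm.
  apply: (Gmax G' _ gG'); split=> [//|G'G]; apply: nGm.
  by exists u => //; apply: G'G.
case: gG => GD Ginj _.
have /choice [s hs] : forall m, exists u, G u /\ pi u = m.
  by move=> m; have [u] := Gsurj m; exists u.
have s_lin : linear s.
  move=> a y z; apply/eqP; rewrite -subr_eq0; apply/eqP.
  have [Gy ey] := hs y; have [Gz ez] := hs z; have [Gyz eyz] := hs (a *: y + z).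
  apply: Ginj; last by rewrite linearB eyz linearP ey ez subrr.
  by rewrite [X in G X]addrC -scaleN1r; apply: (GD) => //; apply: (GD).
by exists (linmap s_lin) => m; case: (hs m).
Qed.

End LocallyFree.

(** For modules of infinite rank the local splittings cannot be glued by clearing
    denominators; Zorn's lemma reduces the gluing to countably many finite steps. *)
Lemma locally_free_projective (A : comPzRingType) (M : lmodType A) :
  (forall g : A, bounded_torsion g (A^o : lmodType A)) -> locally_free M -> projective M.
Proof.
move=> tA [gs cover hgs].
have /choice [Ix hIx] : forall g, exists Ix : {I : eqType & I -> M},
    g \in gs -> gbasis g (projT2 Ix).
  move=> g; have [hg|nhg] := boolP (g \in gs).
    have [I [b /basis_gbasis [x hx]]] := hgs g hg.
    by exists (existT _ I x).
  by exists (existT (fun I : eqType => I -> M) bool (fun=> 0)).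
have [||s hs] := @split_of_local_basis A M (Free A M) (fev id) gs
    (fun g => projT1 (Ix g)) (fun g => projT2 (Ix g)) cover hIx.
- by move=> g _; apply: Free_torsion.
- by move=> m; exists (unit_vector A m); exact: fev_unit.
exact: (projective_section hs).
Qed.

(** * Signs, graded modules and contractions *)

Section Signs.
Variable V : zmodType.
Implicit Types (m n : int) (x y : V).

Lemma odd_abszD m n : odd `|(m + n)%R|%N = odd `|m|%N (+) odd `|n|%N.
Proof. lia. Qed.

Lemma sgnzDn m n x : sgnz (m + n) x = sgnz m (sgnz n x).
Proof. by rewrite /sgnz odd_abszD; do 2!case: odd; rewrite //= opprK. Qed.
Lemma sgnzK n x : sgnz n (sgnz n x) = x.
Proof. by rewrite /sgnz; case: odd; rewrite ?opprK. Qed.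
Lemma sgnz0r n : sgnz n (0 : V) = 0.
Proof. by rewrite /sgnz oppr0 if_same. Qed.
Lemma sgnzD n x y : sgnz n (x + y) = sgnz n x + sgnz n y.
Proof. by rewrite /sgnz; case: odd; rewrite ?opprD. Qed.
Lemma sgnzN n x : sgnz n (- x) = - sgnz n x.
Proof. by rewrite /sgnz; case: odd. Qed.
Lemma sgnz_sum n (I : Type) (s : seq I) (F : I -> V) :
  sgnz n (\sum_(i <- s) F i) = \sum_(i <- s) sgnz n (F i).
Proof. by apply: big_morph => [x y|]; rewrite ?sgnzD ?sgnz0r. Qed.
Lemma sgnz_parity m n x : odd `|m|%N = odd `|n|%N -> sgnz m x = sgnz n x.
Proof. by rewrite /sgnz => ->. Qed.

End Signs.

Definition additive_map (V W : zmodType) (f : V -> W) : Prop :=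
  forall x y, f (x + y) = f x + f y.

Section AdditiveMap.
Variables (V W : zmodType) (f : V -> W) (hf : additive_map f).
Lemma addmap0 : f 0 = 0.
Proof. by apply: (addIr (f 0)); rewrite -hf !add0r. Qed.
Lemma addmapN x : f (- x) = - f x.
Proof. by apply: (addIr (f x)); rewrite -hf !addNr addmap0. Qed.
Lemma addmapB x y : f (x - y) = f x - f y.
Proof. by rewrite hf addmapN. Qed.
Lemma addmap_sum (I : Type) (s : seq I) (F : I -> V) :
  f (\sum_(i <- s) F i) = \sum_(i <- s) f (F i).
Proof. by apply: big_morph; [apply: hf|apply: addmap0]. Qed.
Lemma addmap_sgn n x : f (sgnz n x) = sgnz n (f x).
Proof. by rewrite /sgnz; case: odd; rewrite ?addmapN. Qed.
End AdditiveMap.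

Lemma linear_sgn (A : pzRingType) (V W : lmodType A) (f : {linear V -> W}) n x :
  f (sgnz n x) = sgnz n (f x).
Proof. exact: (addmap_sgn (raddfD f)). Qed.

Lemma linear_additive (A : pzRingType) (V W : lmodType A) (f : {linear V -> W}) :
  additive_map f.
Proof. exact: raddfD. Qed.

(** A module graded by the integers, given by the projections onto its homogeneous
    parts; [geps] is the sign operator, equal to [(-1)^n] in degree [n]. *)
Record gmod (A : pzRingType) := Gmod {
  gcar :> lmodType A;
  gpr : int -> {linear gcar -> gcar};
  geps : {linear gcar -> gcar};
  gprE : forall m n x, gpr m (gpr n x) = if m == n then gpr n x else 0;
  gpr_sep : forall x, (forall n, gpr n x = 0) -> x = 0;
  gpr_fin : forall x, exists N : nat, forall n : int, (N < `|n|)%N -> gpr n x = 0;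
  gepsE : forall n x, gpr n (geps x) = sgnz n (gpr n x)
}.
Arguments gpr {A V} : rename.
Arguments geps {A V} : rename.

Definition ints (N : nat) : seq int := [seq (k%:Z - N%:Z) | k <- iota 0 (2 * N).+1].

Lemma ints_uniq N : uniq (ints N).
Proof. by rewrite map_inj_uniq ?iota_uniq // => i j /addIr []. Qed.

Lemma mem_ints N (n : int) : (n \in ints N) = (`|n| <= N)%N.
Proof.
apply/mapP/idP => [[k]|hn]; first by rewrite mem_iota; lia.
exists `|(n + N%:Z)%R|%N; first by rewrite mem_iota; lia.
lia.
Qed.

Section Graded.
Variable A : pzRingType.
Implicit Types V W : gmod A.

Definition hom V (n : int) (x : V) : Prop := gpr n x = x.
Definition deg V W (i : int) (f : V -> W) : Prop :=
  forall n x, hom n x -> hom (i + n) (f x).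

Lemma gpr_hom V n (x : V) : hom n (gpr n x).
Proof. by rewrite /hom gprE eqxx. Qed.

Lemma gpr_other V m n (x : V) : hom n x -> m != n -> gpr m x = 0.
Proof. by move=> hx h; rewrite -hx gprE (negbTE h). Qed.

Lemma hom0 V n : hom n (0 : V). Proof. exact: linear0. Qed.
Lemma homD V n (x y : V) : hom n x -> hom n y -> hom n (x + y).
Proof. by rewrite /hom linearD => -> ->. Qed.
Lemma homN V n (x : V) : hom n x -> hom n (- x).
Proof. by rewrite /hom linearN => ->. Qed.
Lemma homB V n (x y : V) : hom n x -> hom n y -> hom n (x - y).
Proof. by move=> hx hy; apply: homD => //; apply: homN. Qed.
Lemma hom_sgn V m n (x : V) : hom n x -> hom n (sgnz m x).
Proof. by rewrite /sgnz; case: odd => //; apply: homN. Qed.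
Lemma hom_sum V n (I : Type) (s : seq I) (F : I -> V) :
  (forall i, hom n (F i)) -> hom n (\sum_(i <- s) F i).
Proof. by move=> h; apply: big_ind => // [|x y]; [apply: hom0|apply: homD]. Qed.

Lemma gdecomp_bound V (x : V) N : (forall n : int, (N < `|n|)%N -> gpr n x = 0) ->
  x = \sum_(n <- ints N) gpr n x.
Proof.
move=> hN; apply/eqP; rewrite -subr_eq0; apply/eqP.
apply: gpr_sep => m; rewrite linearB linear_sum /=.
under eq_bigr do rewrite gprE.
have [hm|hm] := boolP (m \in ints N).
  rewrite (bigD1_seq m) ?ints_uniq //= eqxx big1 ?addr0 ?subrr // => n hn.
  by rewrite eq_sym (negbTE hn).
rewrite big_seq big1 => [|n hn].
  by rewrite hN ?subr0 // ltnNge -mem_ints.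
by case: eqP => // e; rewrite e hn in hm.
Qed.

Lemma gdecomp V (x : V) : exists N, x = \sum_(n <- ints N) gpr n x.
Proof. by have [N hN] := gpr_fin x; exists N; apply: gdecomp_bound. Qed.

Lemma hom_ext V (W : zmodType) (f g : V -> W) : additive_map f -> additive_map g ->
  (forall n x, hom n x -> f x = g x) -> f =1 g.
Proof.
move=> hf hg h x; have [N ->] := gdecomp x.
rewrite (addmap_sum hf) (addmap_sum hg); apply: eq_bigr => n _.
by apply: (h n); apply: gpr_hom.
Qed.

Lemma eps_hom V n (x : V) : hom n x -> geps x = sgnz n x.
Proof.
move=> hx; apply/eqP; rewrite -subr_eq0; apply/eqP; apply: gpr_sep => m.
rewrite linearB /= gepsE linear_sgn.
have [->|h] := eqVneq m n; first by rewrite hx subrr.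
by rewrite (gpr_other hx h) !sgnz0r subrr.
Qed.

Lemma epsK V (x : V) : geps (geps x) = x.
Proof.
apply: (hom_ext (f := fun x => geps (geps x)) (g := id)) => [y z|//|n y hy].
  by rewrite !linearD.
by rewrite (eps_hom hy) linear_sgn (eps_hom hy) sgnzK.
Qed.

Lemma hom_eps V n (x : V) : hom n x -> hom n (geps x).
Proof. by move=> h; rewrite (eps_hom h); apply: hom_sgn. Qed.

(** Sign operators compute degrees modulo two. *)
Lemma deg_eps V W i (f : V -> W) x : additive_map f -> deg i f ->
  f (geps x) = sgnz i (geps (f x)).
Proof.
move=> hf df; apply: (hom_ext (f := fun x => f (geps x))
   (g := fun x => sgnz i (geps (f x)))) => [y z|y z|n y hy].
- by rewrite linearD hf.
- by rewrite hf linearD sgnzD.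
by rewrite (eps_hom hy) (eps_hom (df _ _ hy)) (addmap_sgn hf) sgnzDn sgnzK.
Qed.

Lemma deg_pr V W i (f : V -> W) n x : additive_map f -> deg i f ->
  gpr (i + n) (f x) = f (gpr n x).
Proof.
move=> hf df; apply: (hom_ext (f := fun x => gpr (i + n) (f x))
   (g := fun x => f (gpr n x))) => [y z|y z|m y hy].
- by rewrite hf linearD.
- by rewrite linearD hf.
have [->|h] := eqVneq n m; first by rewrite df // hy.
rewrite (gpr_other hy h) (addmap0 hf); apply: (gpr_other (df _ _ hy)).
by apply: contra_neq h => /addrI.
Qed.

Definition gbounded V : Prop := exists N : nat, forall n : int, (N < `|n|)%N ->
  forall x : V, hom n x -> x = 0.

(** A bounded acyclic complex of projectives is contractible: descending through the
    degrees, the part of the identity that is not yet contracted takes its values in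
    cycles, hence lifts through the differential. *)
Lemma contraction V (D : {linear V -> V}) : projective V -> gbounded V ->
  deg 1 D -> (forall x, D (D x) = 0) ->
  (forall n x, hom n x -> D x = 0 -> exists y, D y = x) ->
  exists s : {linear V -> V}, deg (-1) s /\ forall x, D (s x) + s (D x) = x.
Proof.
move=> projV [N hN] dD DD exD.
have {}exD x : D x = 0 -> exists y, D y = x.
  move=> Dx; have /choice [y hy] : forall n, exists y, D y = gpr n x.
    move=> n; apply: (exD n); first exact: gpr_hom.
    by rewrite -(deg_pr _ _ (linear_additive D) dD) Dx linear0.
  have [K e] := gdecomp x; exists (\sum_(n <- ints K) y n).
  by rewrite linear_sum [RHS]e; apply: eq_bigr.
suff main k : exists s : {linear V -> V}, deg (-1) s /\
    forall n x, N%:Z + 1 - k%:Z <= n -> hom n x -> D (s x) + s (D x) = x.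
  have [s [ds hs]] := main (2 * N + 2)%N; exists s; split=> // x.
  apply: (hom_ext (f := fun x => D (s x) + s (D x)) (g := id)) => [y z|//|n y hy].
    by rewrite !linearD addrACA.
  case: (leP (N%:Z + 1 - (2 * N + 2)%N%:Z) n) => hn; first exact: (hs n).
  by rewrite (hN n _ y hy) ?linear0 ?addr0 ?linear0 ?add0r //; lia.
elim: k => [|k [s [ds hs]]].
  exists (\0 : {linear V -> V}); split=> [n x _|n x hn hx]; first exact: hom0.
  by rewrite (hN n _ x hx) ?linear0 ?addr0 //; lia.
pose n0 : int := N%:Z - k%:Z.
have g_lin : linear (fun x => gpr n0 x - s (D (gpr n0 x))).
  by move=> a x y; rewrite !linearP addrACA -scalerDr.
have hDs x : hom n0 x -> D (s (D x)) = D x.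
  move=> hx; rewrite -[RHS](hs (n0 + 1) (D x)) ?DD ?linear0 ?addr0 //; first lia.
  by rewrite addrC; apply: dD.
(* [g] is the part of the identity in degree [n0] that [s] does not contract yet. *)
have [z|t ht] := projV _ _ D (linmap g_lin).
  by apply: exD; rewrite /= linearB hDs ?subrr //; apply: gpr_hom.
have s'_lin : linear (fun x => s (x - gpr n0 x) + gpr (n0 - 1) (t (gpr n0 x))).
  move=> a x y; rewrite !linearP /= [a *: x + y + _]addrACA -scalerDr !linearP.
  by rewrite addrACA -scalerDr.
have [s' s'E] : exists s' : {linear V -> V}, forall x,
    s' x = s (x - gpr n0 x) + gpr (n0 - 1) (t (gpr n0 x)) by exists (linmap s'_lin).
exists s'; split=> [n x hx|n x hn hx]; rewrite !s'E.
  have [en|nn] := eqVneq n0 n.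
    by rewrite en hx subrr linear0 add0r (addrC (-1)); apply: gpr_hom.
  by rewrite (gpr_other hx nn) subr0 !linear0 addr0; apply: ds.
have dDx : hom (n + 1) (D x) by rewrite addrC; apply: dD.
rewrite (gpr_other dDx) ?subr0; last by rewrite /n0; lia.
rewrite [t 0]linear0 [gpr _ 0]linear0 addr0.
have [en|nn] := eqVneq n0 n; last first.
  by rewrite (gpr_other hx nn) subr0 [t 0]linear0 [gpr _ 0]linear0 addr0 (hs n) //; lia.
have hsD : hom n (s (D x)) by have := ds _ _ dDx; rewrite addrC addrK.
have hg : D (gpr (n - 1) (t x)) = gpr n (D (t x)).
  by rewrite -(deg_pr _ _ (linear_additive D) dD) addrCA subrr addr0.
by rewrite en hx subrr linear0 add0r hg ht linmapE en hx linearB /= hx hsD subrK.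
Qed.

End Graded.

(** * Total modules of complexes and homotopy inverses *)

Section GradedConstructions.
Variable A : pzRingType.

Section Product.
Variables V W : gmod A.
Definition prod_pr n (x : V * W) : V * W := (gpr n x.1, gpr n x.2).
Fact prod_pr_linear n : linear (prod_pr n).
Proof. by move=> a x y; rewrite /prod_pr !linearP. Qed.
Definition prod_eps (x : V * W) : V * W := (geps x.1, geps x.2).
Fact prod_eps_linear : linear prod_eps.
Proof. by move=> a x y; rewrite /prod_eps !linearP. Qed.

Fact prod_prE m n (x : (V * W)%type) :
  linmap (prod_pr_linear m) (linmap (prod_pr_linear n) x) =
  if m == n then linmap (prod_pr_linear n) x else 0.
Proof. by rewrite !linmapE /prod_pr /= !gprE; case: eqP. Qed.
Fact prod_pr_sep (x : (V * W)%type) : (forall n, linmap (prod_pr_linear n) x = 0) -> x = 0.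
Proof.
by case: x => x y h; congr pair; apply: gpr_sep => n; case: (h n).
Qed.
Fact prod_pr_fin (x : (V * W)%type) :
  exists N : nat, forall n : int, (N < `|n|)%N -> linmap (prod_pr_linear n) x = 0.
Proof.
case: x => x y; have [N hN] := gpr_fin x; have [M hM] := gpr_fin y.
exists (maxn N M) => n; rewrite gtn_max => /andP[h1 h2].
by rewrite linmapE /prod_pr hN ?hM.
Qed.
Fact prod_epsE n (x : (V * W)%type) : linmap (prod_pr_linear n) (linmap prod_eps_linear x) =
  sgnz n (linmap (prod_pr_linear n) x).
Proof.
by rewrite !linmapE /prod_pr /prod_eps /= !gepsE /sgnz; case: odd.
Qed.
Definition gprod : gmod A := Gmod prod_prE prod_pr_sep prod_pr_fin prod_epsE.

Lemma gprod_homE n (x : gprod) : hom n x <-> hom n (x : V * W).1 /\ hom n (x : V * W).2.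
Proof. by case: x => x y; split=> [[h1 h2]|[h1 h2]] //; congr pair. Qed.
End Product.

Section Shift.
Variables (k : int) (V : gmod A).
Fact shift_eps_linear : linear (fun x : V => sgnz k (geps x)).
Proof. by move=> a x y; rewrite linearP sgnzD /sgnz; case: odd; rewrite ?scalerN. Qed.
Fact shift_prE m n (x : V) :
  gpr (m + k) (gpr (n + k) x) = if m == n then gpr (n + k) x else 0.
Proof. by rewrite gprE (inj_eq (addIr k)). Qed.
Fact shift_sep (x : V) : (forall n, gpr (n + k) x = 0) -> x = 0.
Proof. by move=> h; apply: gpr_sep => n; rewrite -[n](subrK k). Qed.
Fact shift_fin (x : V) :
  exists N : nat, forall n : int, (N < `|n|)%N -> gpr (n + k) x = 0.
Proof.
have [N hN] := gpr_fin x; exists (N + `|k|)%N => n hn; apply: hN; lia.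
Qed.
Fact shift_epsE n (x : V) : gpr (n + k) (linmap shift_eps_linear x) = sgnz n (gpr (n + k) x).
Proof. by rewrite linmapE linear_sgn gepsE -sgnzDn; apply: sgnz_parity; lia. Qed.
Definition gshift : gmod A :=
  @Gmod A V (fun n => gpr (n + k)) (linmap shift_eps_linear)
    shift_prE shift_sep shift_fin shift_epsE.
Lemma gshift_homE n (x : V) : hom n (x : gshift) <-> hom (n + k) x.
Proof. by []. Qed.
End Shift.

Section Total.
Variable E : cochain A.

Lemma totP (x y : tot E) : (forall n, component x n = component y n) -> x = y.
Proof.
by move=> h; apply: val_inj; apply: functional_extensionality_dep.
Qed.

(** Every degree is a successor; in this form the differential needs no transport. *)
Lemma totP1 (x y : tot E) : (forall n, component x (n + 1) = component y (n + 1)) -> x = y.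
Proof. by move=> h; apply: totP => n; rewrite -[n](subrK 1). Qed.

Lemma componentD (x y : tot E) n : component (x + y) n = component x n + component y n.
Proof. by []. Qed.
Lemma componentZ a (x : tot E) n : component (a *: x) n = a *: component x n.
Proof. by []. Qed.
Lemma componentN (x : tot E) n : component (- x) n = - component x n.
Proof. by []. Qed.
Lemma component_sgn k (x : tot E) n : component (sgnz k x) n = sgnz k (component x n).
Proof. by rewrite /sgnz; case: odd. Qed.

Fact tpr_finite k (x : tot E) :
  @finsupp A E (fun n => if n == k then component x n else 0).
Proof.
by have [N hN] := component_finsupp x; exists N => n /hN ->; rewrite if_same.
Qed.
Definition tpr k (x : tot E) : tot E := mktot (tpr_finite k x).
Lemma component_tpr k (x : tot E) n :
  component (tpr k x) n = if n == k then component x n else 0.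
Proof. by []. Qed.
Fact tpr_linear k : linear (tpr k).
Proof.
move=> a x y; apply: totP => n; rewrite componentD componentZ.
rewrite /component /=; case: eqP => //= _.
by rewrite scaler0 addr0.
Qed.
Fact teps_finite (x : tot E) : @finsupp A E (fun n => sgnz n (component x n)).
Proof.
by have [N hN] := component_finsupp x; exists N => n /hN ->; rewrite sgnz0r.
Qed.
Definition teps (x : tot E) : tot E := mktot (teps_finite x).
Lemma component_teps (x : tot E) n : component (teps x) n = sgnz n (component x n).
Proof. by []. Qed.
Fact teps_linear : linear teps.
Proof.
move=> a x y; apply: totP => n; rewrite componentD componentZ.
by rewrite /component /= /sgnz; case: odd => //=; rewrite scalerN opprD.
Qed.
Fact tprE m n (x : tot E) : linmap (tpr_linear m) (linmap (tpr_linear n) x) =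
  if m == n then linmap (tpr_linear n) x else 0.
Proof.
apply: totP => k; have [->|mn] := eqVneq m n; rewrite !linmapE !component_tpr.
  by case: (k == n).
by have [->|//] := eqVneq k m; rewrite (negbTE mn).
Qed.
Fact tpr_sep (x : tot E) : (forall n, linmap (tpr_linear n) x = 0) -> x = 0.
Proof.
move=> h; apply: totP => n; have := congr1 (fun y : tot E => component y n) (h n).
by rewrite linmapE component_tpr eqxx.
Qed.
Fact tpr_fin (x : tot E) :
  exists N : nat, forall n : int, (N < `|n|)%N -> linmap (tpr_linear n) x = 0.
Proof.
have [N hN] := component_finsupp x; exists N => n hn; apply: totP => k.
by rewrite linmapE component_tpr; case: eqP => [->|//]; apply: hN.
Qed.
Fact tepsE n (x : tot E) : linmap (tpr_linear n) (linmap teps_linear x) =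
  sgnz n (linmap (tpr_linear n) x).
Proof.
apply: totP => k; rewrite component_sgn !linmapE !component_tpr component_teps.
by case: eqP => [->|_] //; rewrite sgnz0r.
Qed.
Definition gtot : gmod A := Gmod tprE tpr_sep tpr_fin tepsE.

Lemma component_gpr n (x : gtot) m :
  component (gpr n x : tot E) m = if m == n then component (x : tot E) m else 0.
Proof. by []. Qed.

Lemma gtot_homE n (x : gtot) : hom n x <-> homogeneous n (x : tot E).
Proof.
split=> [h m hm|h]; first by rewrite -h component_gpr (negbTE hm).
by apply: totP => m; rewrite component_gpr; case: eqVneq => // /h ->.
Qed.

Fact tinj_finite n (v : E n) : @finsupp A E (fun m =>
  if n =P m is ReflectT h then ecast k (E k) h v else 0).
Proof. by exists `|n|%N => m hm; case: eqP => // h; rewrite h ltnn in hm. Qed.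
(** The inclusion of the term of degree [n] into the direct sum. *)
Definition tinj n (v : E n) : tot E := mktot (tinj_finite v).
Lemma tinj_same n (v : E n) : component (tinj v) n = v.
Proof. by rewrite /component /=; case: eqP => // h; rewrite eq_axiomK. Qed.
Lemma tinj_other n m (v : E n) : n != m -> component (tinj v) m = 0.
Proof. by rewrite /component /=; case: eqP. Qed.
Fact tinj_linear n : linear (@tinj n).
Proof.
move=> a v w; apply: totP => m; rewrite componentD componentZ.
have [<-|h] := eqVneq n m; first by rewrite !tinj_same.
by rewrite !tinj_other // scaler0 addr0.
Qed.
Lemma tinj_hom n (v : E n) : hom n (tinj v : gtot).
Proof. by apply/gtot_homE => m hm; rewrite tinj_other // eq_sym. Qed.
Lemma tinj_component n (x : tot E) : tinj (component x n) = gpr n (x : gtot).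
Proof.
apply: totP => m; have [<-|h] := eqVneq n m.
  by rewrite tinj_same component_gpr eqxx.
by rewrite tinj_other // component_gpr eq_sym (negbTE h).
Qed.

Lemma gtot_bounded : bounded E -> gbounded gtot.
Proof.
case=> N hN; exists N => n hn x /gtot_homE hx; apply: totP => m.
by have [->|/hx //] := eqVneq m n; apply: hN.
Qed.

Lemma tot_diffE (x : tot E) n : component (tot_diff x) (n + 1) = cdiff E n (component x n).
Proof.
rewrite {1}/component /=; move: (subrK 1 (n + 1)).
have : n + 1 - 1 = n by rewrite addrK.
move: (n + 1 - 1) => m e; rewrite {}e => h.
by rewrite eq_axiomK.
Qed.

Fact tot_diff_linear : linear (@tot_diff A E).
Proof. by move=> a x y; apply: totP1 => n; rewrite componentD componentZ !tot_diffE linearP. Qed.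
Definition tdiff : {linear gtot -> gtot} := linmap tot_diff_linear.

Lemma tdiff_deg : deg 1 tdiff.
Proof.
move=> n x /gtot_homE hx; apply/gtot_homE => m hm; rewrite -[m](subrK 1) tot_diffE hx ?linear0 //.
by apply: contra_neq hm => <-; rewrite addrC subrK.
Qed.
Lemma tdiffK x : tdiff (tdiff x) = 0.
Proof.
apply: totP1 => n; rewrite tot_diffE -[n](subrK 1) tot_diffE.
exact: cdiffK.
Qed.

(** In a bounded complex the direct sum is finite, hence projective with its terms. *)
Lemma tot_projective : bounded E -> (forall n, projective (E n)) -> projective (tot E).
Proof.
move=> [N hN] projE U W p g hg.
have h n : exists t : {linear E n -> U}, forall v, p (t v) = g (tinj v).
  have gn_lin : linear (fun v : E n => g (tinj v)).
    by move=> a v w; rewrite tinj_linear linearP.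
  by have [v|t ht] := projE n U W p (linmap gn_lin); [apply: hg|exists t].
pose t n : {linear E n -> U} := projT1 (cid (h n)).
have ht n v : p (t n v) = g (tinj v) := projT2 (cid (h n)) v.
have t_lin : linear (fun x : tot E => \sum_(n <- ints N) t n (component x n)).
  move=> a x y; rewrite scaler_sumr -big_split; apply: eq_bigr => n _.
  by rewrite componentD componentZ linearP.
exists (linmap t_lin) => x; rewrite linmapE linear_sum.
transitivity (g (\sum_(n <- ints N) tinj (component x n))).
  by rewrite linear_sum; apply: eq_bigr => n _.
congr (g _); apply: totP => m.
have compS (s : seq int) : component (\sum_(n <- s) tinj (component x n)) m =
    \sum_(n <- s) component (tinj (component x n)) m.
  by elim: s => [|n s ih]; rewrite ?big_nil // !big_cons componentD ih.
have [hm|hm] := boolP (m \in ints N).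
  rewrite compS (bigD1_seq m) ?ints_uniq //= tinj_same big1 ?addr0 // => n hn.
  by rewrite tinj_other.
have Em0 : forall v : E m, v = 0 by apply: hN; rewrite ltnNge -mem_ints.
by rewrite [RHS]Em0 [LHS]Em0.
Qed.

End Total.

Lemma pair_linearl (M N : lmodType A) a (x y : M) :
  (a *: x + y, 0) = a *: (x, 0) + (y, 0) :> M * N.
Proof. by apply: injective_projections; rewrite //= scaler0 addr0. Qed.
Lemma pair_linearr (M N : lmodType A) a (x y : N) :
  (0, a *: x + y) = a *: (0, x) + (0, y) :> M * N.
Proof. by apply: injective_projections; rewrite //= scaler0 addr0. Qed.
Lemma pair_split (M N : lmodType A) (x : M) (y : N) : (x, y) = (x, 0) + (0, y) :> M * N.
Proof. by apply: injective_projections; rewrite //= ?addr0 ?add0r. Qed.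

Lemma prod_projective (M N : lmodType A) : projective M -> projective N ->
  projective (M * N)%type.
Proof.
move=> pM pN U W p g hg.
have g1_lin : linear (fun x : M => g (x, 0)).
  by move=> a x y; rewrite pair_linearl linearP.
have g2_lin : linear (fun x : N => g (0, x)).
  by move=> a x y; rewrite pair_linearr linearP.
have [z|t1 h1] := pM _ _ p (linmap g1_lin); first exact: hg.
have [z|t2 h2] := pN _ _ p (linmap g2_lin); first exact: hg.
have t_lin : linear (fun x : M * N => t1 x.1 + t2 x.2).
  by move=> a x y; rewrite !linearP scalerDr addrACA.
exists (linmap t_lin) => -[x y]; rewrite linmapE linearD /= h1 h2 !linmapE -linearD.
by rewrite -pair_split.
Qed.

Section ChainMap.
Variables (E F : cochain A) (c : chain_map E F).
Lemma tot_mapE (x : tot E) n : component (tot_map c x) n = c n (component x n).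
Proof. by []. Qed.
Fact tot_map_linear : linear (tot_map c : tot E -> tot F).
Proof. by move=> a x y; apply: totP => n; rewrite componentD componentZ !tot_mapE linearP. Qed.
Definition tmap : {linear gtot E -> gtot F} := linmap tot_map_linear.
Lemma tmap_deg : deg 0 tmap.
Proof.
move=> n x /gtot_homE hx; apply/gtot_homE => m hm; rewrite tot_mapE hx ?linear0 //.
by rewrite add0r in hm.
Qed.
Lemma tmap_diff x : tmap (tdiff E x) = tdiff F (tmap x).
Proof. by apply: totP1 => n; rewrite tot_diffE tot_mapE tot_diffE cmapP tot_mapE. Qed.
End ChainMap.

Arguments tdiff : simpl never.
Arguments linmap : simpl never.
Arguments tmap {E F} c : simpl never.

Section HomotopyInverse.
Variables (E F : cochain A) (c : chain_map E F).
Hypotheses (bE : bounded E) (bF : bounded F).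
Hypotheses (pE : forall n, projective (E n)) (pF : forall n, projective (F n)).
Hypothesis qc : quasi_isomorphism c.

Local Notation cone := (gprod (gshift 1 (gtot E)) (gtot F)).

Fact cone_diff_linear : linear (fun z : cone =>
  (- tdiff E z.1, tmap c z.1 + tdiff F z.2) : cone).
Proof.
move=> a x y; apply: injective_projections => /=.
  by rewrite linearP opprD scalerN.
by rewrite !linearP scalerDr addrACA.
Qed.
Let d : {linear cone -> cone} := linmap cone_diff_linear.

(** Injectivity and surjectivity on cohomology, put together. *)
Lemma cone_acyclic n (z : cone) : hom n z -> d z = 0 -> exists w, d w = z.
Proof.
rewrite -[n](subrK 1); move: (n - 1) => {}n.
case: z => x y /gprod_homE [/= /gshift_homE /gtot_homE hx /gtot_homE hy] dz.
have dx : tot_diff (x : tot E) = 0.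
  by apply/eqP; rewrite -oppr_eq0; apply/eqP; exact: (congr1 fst dz).
have cxy : tot_map c (x : tot E) + tot_diff (y : tot F) = 0 := congr1 snd dz.
pose x1 := component (x : tot E) (n + 1 + 1); pose y1 := component (y : tot F) (n + 1).
have dx1 : cdiff E (n + 1 + 1) x1 = 0 by rewrite -tot_diffE dx.
have cxy1 : c (n + 1 + 1) x1 + cdiff F (n + 1) y1 = 0.
  by have := congr1 (fun u : tot F => component u (n + 1 + 1)) cxy; rewrite /= componentD tot_mapE tot_diffE.
have [x' ex'] : exists x', x1 = cdiff E (n + 1) x'.
  apply: (qc (n + 1)).1 => //; exists (- y1); rewrite linearN.
  by apply/eqP; rewrite -addr_eq0 cxy1.
have [|w dw [y' ey]] := (qc n).2 (y1 + c (n + 1) x').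
  by rewrite linearD /= -cmapP -ex' [LHS]addrC.
exists (tinj (w - x'), tinj y'); congr pair; apply: totP1 => k.
  rewrite componentN tot_diffE; have [<-|hk] := eqVneq (n + 1) k.
    by rewrite tinj_same linearB /= dw sub0r opprK -ex'.
  by rewrite tinj_other // linear0 oppr0 hx // (inj_eq (addIr 1)) eq_sym.
rewrite componentD tot_mapE tot_diffE; have [<-|hk] := eqVneq n k.
  by rewrite !tinj_same linearB /= addrAC -ey addrK.
by rewrite !tinj_other ?(inj_eq (addIr 1)) // !linear0 addr0 hy // (inj_eq (addIr 1)) eq_sym.
Qed.

(** A quasi-isomorphism of bounded complexes of projectives is a homotopy
    equivalence: the blocks of a contraction of its cone are a homotopy inverse and
    the two homotopies. *)
Lemma homotopy_inverse : exists (b : {linear gtot F -> gtot E})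
    (k : {linear gtot E -> gtot E}) (k' : {linear gtot F -> gtot F}),
  [/\ deg 0 b, deg (-1) k, deg (-1) k', forall y, b (tdiff F y) = tdiff E (b y) &
     (forall x, x - b (tmap c x) = tdiff E (k x) + k (tdiff E x)) /\
     (forall y, y - tmap c (b y) = tdiff F (k' y) + k' (tdiff F y))].
Proof.
have proj_cone : projective (gcar cone).
  by apply: prod_projective; apply: tot_projective.
have bd_cone : gbounded cone.
  have [N hN] := gtot_bounded bE; have [M hM] := gtot_bounded bF.
  exists (N + M + 1)%N => n hn [x y] /gprod_homE [/= /gshift_homE hx hy].
  apply: injective_projections => /=.
    by apply: (hN (n + 1)) => //; lia.
  by apply: (hM n) => //; lia.
have dd : deg 1 d.
  move=> n [x y] /gprod_homE [/= /gshift_homE hx hy]; apply/gprod_homE; split=> /=.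
    by apply/gshift_homE/homN; rewrite -addrA; apply: tdiff_deg.
  apply: homD; last exact: tdiff_deg.
  by have := tmap_deg c hx; rewrite add0r addrC.
have ddK z : d (d z) = 0.
  case: z => x y; congr pair => /=; first by rewrite linearN /= tdiffK oppr0 oppr0.
  by rewrite linearN linearD /= tdiffK addr0 tmap_diff addNr.
have [s [ds hs]] := contraction proj_cone bd_cone dd ddK cone_acyclic.
have b_lin : linear (fun y : gtot F => (s (0, y)).1 : gtot E).
  by move=> a x y; rewrite pair_linearr linearP.
have k'_lin : linear (fun y : gtot F => (s (0, y)).2 : gtot F).
  by move=> a x y; rewrite pair_linearr linearP.
have k_lin : linear (fun x : gtot E => - (s (x, 0)).1 : gtot E).
  by move=> a x y; rewrite pair_linearl linearP opprD scalerN.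
have sE x y : s (x, y) = s (x, 0) + s (0, y).
  by rewrite -linearD -pair_split.
have d0E y : d (0, y) = (0, tdiff F y).
  by apply: injective_projections; rewrite /= !linear0 ?oppr0 ?add0r.
have dx0E x : d (x, 0) = (- tdiff E x, tmap c x).
  by apply: injective_projections; rewrite //= linear0 addr0.
exists (linmap b_lin), (linmap k_lin), (linmap k'_lin); split.
- move=> n y hy; have /ds /gprod_homE [/= /gshift_homE] : hom n ((0, y) : cone).
    by apply/gprod_homE; split=> //; apply: hom0.
  by rewrite addrAC addNr.
- move=> n x hx; have /ds /gprod_homE [/= /gshift_homE] : hom (n - 1) ((x, 0) : cone).
    by apply/gprod_homE; split; [apply/gshift_homE; rewrite subrK|apply: hom0].
  by rewrite -addrA subrK => h _; apply: homN.
- move=> n y hy; have /ds /gprod_homE [] // : hom n ((0, y) : cone).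
  by apply/gprod_homE; split=> //; apply: hom0.
- move=> y; have := congr1 fst (hs (0, y)).
  rewrite d0E /= => /eqP.
  by rewrite addrC subr_eq0 => /eqP.
split=> [x|y].
  have sN : s (- tdiff E x, 0) = - s (tdiff E x, 0).
    rewrite -[RHS]linearN; congr (s _).
    by apply: injective_projections; rewrite //= oppr0.
  have e : - tdiff E (s (x, 0)).1 + (- (s (tdiff E x, 0)).1 + (s (0, tmap c x)).1) = x.
    by have := congr1 fst (hs (x, 0)); rewrite dx0E (sE (- tdiff E x)) sN.
  by rewrite -{1}e !(linmapE b_lin, linmapE k_lin) addrA addrK (linearN (tdiff E)).
have := congr1 snd (hs (0, y)); rewrite d0E /= => {1}<-.
by rewrite !(linmapE b_lin, linmapE k'_lin) addrAC [tmap c _ + _]addrC addrK.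
Qed.

End HomotopyInverse.
End GradedConstructions.

(** * The perturbation identities in an abstract ring *)

(** In the application [R] is the ring of operator-valued functions of words, [d] is the
    differential, [par] the derivation that merges consecutive letters, and [tau] the
    parity automorphism for which [par] is a skew derivation.  The equation [mc] says
    that [d + eta] is a perturbation of [d], and [h] is a homotopy, so that
    [1 - d h - h d] is the projection onto the retract. *)
Section HomotopyTransferIdentities.
Variables (R : pzRingType) (par tau : R -> R).
Hypothesis parD : forall x y, par (x + y) = par x + par y.
Hypothesis parM : forall x y, par (x * y) = par x * y + tau x * par y.
Variables (d h eta X Y Z : R).
Hypotheses (par_h : par h = 0) (tau_h : tau h = - h) (tau_eta : tau eta = - eta).
Hypothesis tau1 : tau 1 = 1.
Hypothesis mc : d * eta + eta * d + eta * eta + par eta = 0.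
Hypotheses (Yl : Y * (1 + eta * h) = 1) (Yr : (1 + eta * h) * Y = 1).
Hypothesis Zr : (1 + h * eta) * Z = 1.
Hypothesis XE : X = Y * eta.

Let par1 : par 1 = 0.
Proof.
have := parM 1 1; rewrite !mulr1 tau1 mul1r => /eqP.
by rewrite -subr_eq0 opprD addrA subrr sub0r oppr_eq0 => /eqP.
Qed.

Let YE : Y = 1 - X * h.
Proof. by rewrite XE -mulrA -Yl mulrDr mulr1 addrK. Qed.

Lemma inverse_swap : Y * eta = eta * Z.
Proof.
have e : (1 + eta * h) * eta = eta * (1 + h * eta) by rewrite mulrDl mulrDr mul1r mulr1 mulrA.
by rewrite -[LHS]mulr1 -Zr mulrA -[Y * eta * _]mulrA -e mulrA Yl mul1r.
Qed.

Let XEr : X = eta * Z. Proof. by rewrite XE inverse_swap. Qed.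

Let ZE : Z = 1 - h * X.
Proof. by rewrite XEr mulrA -Zr mulrDl mul1r addrK. Qed.

Let hY : h * Y = Z * h.
Proof. by rewrite YE ZE mulrBr mulrBl mulr1 mul1r mulrA. Qed.

Let etahY : eta * h * Y = 1 - Y.
Proof. by rewrite -Yr mulrDl mul1r addrC addKr. Qed.

Let par_hx x : par (h * x) = - (h * par x).
Proof. by rewrite parM par_h mul0r add0r tau_h mulNr. Qed.

Let par_etax x : par (eta * x) = par eta * x - eta * par x.
Proof. by rewrite parM tau_eta mulNr. Qed.

Let parX : par X = Y * par eta * Z.
Proof.
have e : (1 + eta * h) * par X = par eta * Z.
  have eX : eta = X + eta * (h * X).
    by rewrite XE -{1}[eta]mul1r -Yr mulrDl mulrDl mul1r !mulrA.
  have pe : par eta = par X + (par eta * (h * X) + eta * (h * par X)).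
    by rewrite {1}eX parD par_etax par_hx mulrN opprK.
  by rewrite ZE mulrBr mulr1 {1}pe mulrDl mul1r -mulrA addrCA [_ + (_ + _)]addrC addrK.
by rewrite -[LHS]mul1r -Yl -!mulrA e.
Qed.

Let parY : par Y = - (Y * par eta * (h * Y)).
Proof.
have e : (1 + eta * h) * par Y = - (par eta * (h * Y)).
  have /eqP : par (Y + eta * (h * Y)) = 0 by rewrite mulrA -{1}[Y]mul1r -mulrDl Yr.
  rewrite parD par_etax par_hx mulrN opprK addrCA addrC addr_eq0 => /eqP e.
  by rewrite mulrDl mul1r -mulrA e.
by rewrite -[LHS]mul1r -Yl -!mulrA e mulrN.
Qed.

Let parZ : par Z = h * Y * par eta * Z.
Proof.
have /eqP : par (Z + h * X) = 0 by rewrite ZE subrK.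
by rewrite parD par_hx subr_eq0 parX !mulrA => /eqP.
Qed.

(** The transferred perturbation [X] satisfies the Maurer-Cartan equation for the product
    twisted by [1 - d h - h d]: multiply the equation for [eta] by [Y] on the left and
    by [Z] on the right. *)
Lemma transferred_mc : d * X + X * d + X * (1 - d * h - h * d) * X + par X = 0.
Proof.
have e0 := mulr0 Y; rewrite -[in LHS](mul0r Z) -[in LHS]mc 2!mulrDl in e0.
have t1 : Y * (d * eta * Z) = d * X - X * h * d * X.
  by rewrite {1}YE -mulrA -XEr mulrBl mul1r !mulrA.
have t2 : Y * (eta * d * Z) = X * d - X * d * h * X.
  by rewrite !mulrA -XE ZE mulrBr mulr1 !mulrA.
have t3 : Y * (eta * eta * Z) = X * X by rewrite -mulrA mulrA -XE -XEr.
rewrite mulrDl !mulrDr t1 t2 t3 (mulrA Y) -parX in e0; rewrite -[RHS]e0.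
have -> : X * (1 - d * h - h * d) * X = X * X - X * d * h * X - X * h * d * X.
  by rewrite !mulrBr !mulrBl mulr1 !mulrA.
by rewrite !addrA (ACl (1*5*2*4*3*6)).
Qed.

(** The comparison map from the perturbed complex to its retract is closed: here the
    factors are [Y] and [h Y]. *)
Lemma transferred_left : d * Y + X * (1 - d * h - h * d) * Y - Y * d - X + par Y = 0.
Proof.
have e0 := mulr0 Y; rewrite -[in LHS](mul0r (h * Y)) -[in LHS]mc 2!mulrDl in e0.
have t1 : Y * (d * eta * (h * Y)) = Y * d - (d * Y - X * h * d * Y).
  have e : d * eta * (h * Y) = d - d * Y.
    by rewrite mulrA -2!mulrA [eta * (h * Y)]mulrA etahY mulrBr mulr1.
  by rewrite e mulrBr; congr (_ - _); rewrite {1}YE mulrBl mul1r !mulrA.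
have t2 : Y * (eta * d * (h * Y)) = X * d * h * Y by rewrite !mulrA -XE.
have t3 : Y * (eta * eta * (h * Y)) = X - X * Y.
  by rewrite -[eta * eta * _]mulrA [eta * (h * Y)]mulrA etahY mulrA -XE mulrBr mulr1.
rewrite mulrDl !mulrDr t1 t2 t3 (mulrA Y) in e0.
have -> : X * (1 - d * h - h * d) * Y = X * Y - X * d * h * Y - X * h * d * Y.
  by rewrite !mulrBr !mulrBl mulr1 !mulrA.
apply/eqP; rewrite -oppr_eq0; apply/eqP; rewrite -[RHS]e0 parY.
by rewrite !opprD !opprK !addrA [LHS](ACl (5*1*4*3*6*2*7)).
Qed.

(** For the comparison map in the other direction the factors are [h Y] and [Z]. *)
Lemma transferred_right : d * Z + X - Z * d - Z * (1 - d * h - h * d) * X + par Z = 0.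
Proof.
have e0 := mulr0 (h * Y); rewrite -[in LHS](mul0r Z) -[in LHS]mc 2!mulrDl in e0.
have t1 : h * Y * (d * eta * Z) = Z * h * d * X.
  by rewrite hY -[d * eta * Z]mulrA -XEr !mulrA.
have hX : h * X = 1 - Z by rewrite ZE opprB addrC subrK.
have t2 : h * Y * (eta * d * Z) = d * Z - (Z * d - Z * d * h * X).
  rewrite !mulrA -[h * Y * eta]mulrA -XE hX mulrBl mul1r mulrBl; congr (_ - _).
  by rewrite {2}ZE mulrBr mulr1 !mulrA.
have t3 : h * Y * (eta * eta * Z) = X - Z * X.
  by rewrite -[eta * eta * _]mulrA -XEr mulrA -[h * Y * eta]mulrA -XE hX mulrBl mul1r.
rewrite mulrDl !mulrDr t1 t2 t3 (mulrA (h * Y)) -parZ in e0; rewrite -[RHS]e0.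
have -> : Z * (1 - d * h - h * d) * X = Z * X - Z * d * h * X - Z * h * d * X.
  by rewrite !mulrBr !mulrBl mulr1 !mulrA.
by rewrite !opprD !opprK !addrA [LHS](ACl (6*1*3*5*2*4*7)).
Qed.
End HomotopyTransferIdentities.

(** * Convolution of operator-valued functions of words *)

Section Convolution.
Variables (T : Type) (mul : T -> T -> T).
Implicit Types (U V W : zmodType) (u w : seq T).

(** The value at a word of the product of two operator-valued functions of words:
    the sum over all ways of cutting the word in two. *)
Fixpoint conv U V W (f : seq T -> V -> W) (g : seq T -> U -> V) (u : seq T) (e : U) : W :=
  f [::] (g u e) + if u is x :: w then conv (fun v => f (x :: v)) g w e else 0.

(** The alternating sum over the products of two consecutive letters. *)
Fixpoint delta V W (f : seq T -> V -> W) (u : seq T) (e : V) : W :=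
  if u is x :: w then
    if w is y :: v then - f (mul x y :: v) e - delta (fun t => f (x :: t)) w e else 0
  else 0.

Lemma conv_cons U V W (f : seq T -> V -> W) (g : seq T -> U -> V) x w e :
  conv f g (x :: w) e = f [::] (g (x :: w) e) + conv (fun v => f (x :: v)) g w e.
Proof. by []. Qed.

Lemma conv_nil U V W (f : seq T -> V -> W) (g : seq T -> U -> V) e :
  conv f g [::] e = f [::] (g [::] e).
Proof. exact: addr0. Qed.

Lemma delta_cons2 V W (f : seq T -> V -> W) x y v e :
  delta f [:: x, y & v] e = - f (mul x y :: v) e - delta (fun t => f (x :: t)) (y :: v) e.
Proof. by []. Qed.

Lemma conv_big U V W (f : seq T -> V -> W) (g : seq T -> U -> V) u e :
  conv f g u e = \sum_(0 <= j < (size u).+1) f (take j u) (g (drop j u) e).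
Proof.
elim: u f => [|x w ih] f; first by rewrite conv_nil big_nat1 take0 drop0.
by rewrite conv_cons ih [RHS]big_nat_recl //= take0 drop0.
Qed.

Lemma conv_eq U V W (f f' : seq T -> V -> W) (g g' : seq T -> U -> V) u e :
  (forall w v, f w v = f' w v) -> (forall w, (size w <= size u)%N -> g w e = g' w e) ->
  conv f g u e = conv f' g' u e.
Proof.
move=> hf hg; rewrite !conv_big; apply: eq_bigr => j _.
by rewrite hf hg // size_drop leq_subr.
Qed.

Lemma convDl U V W (f f' : seq T -> V -> W) (g : seq T -> U -> V) u e :
  conv (fun w v => f w v + f' w v) g u e = conv f g u e + conv f' g u e.
Proof. by rewrite !conv_big -big_split. Qed.

Lemma conv0l U V W (g : seq T -> U -> V) u e :
  conv (fun _ _ => 0 : W) g u e = 0.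
Proof. by rewrite conv_big big1. Qed.

Lemma convDr U V W (f : seq T -> V -> W) (g g' : seq T -> U -> V) u e :
  (forall w, additive_map (f w)) ->
  conv f (fun w v => g w v + g' w v) u e = conv f g u e + conv f g' u e.
Proof. by move=> hf; rewrite !conv_big -big_split; apply: eq_bigr => j _; rewrite hf. Qed.

Lemma convNl U V W (f : seq T -> V -> W) (g : seq T -> U -> V) u e :
  conv (fun w v => - f w v) g u e = - conv f g u e.
Proof. by rewrite !conv_big sumrN. Qed.

Lemma conv_additive U V W (f : seq T -> V -> W) (g : seq T -> U -> V) :
  (forall w, additive_map (f w)) -> (forall w, additive_map (g w)) ->
  forall u, additive_map (conv f g u).
Proof.
move=> hf hg u x y; rewrite !conv_big -big_split; apply: eq_bigr => j _.
by rewrite hg hf.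
Qed.

Lemma conv_compl U V W (W' : zmodType) (p : W -> W') (f : seq T -> V -> W)
    (g : seq T -> U -> V) u e : additive_map p ->
  conv (fun w v => p (f w v)) g u e = p (conv f g u e).
Proof. by move=> hp; rewrite !conv_big (addmap_sum hp). Qed.

Lemma conv_compm U V W (V' : zmodType) (p : V -> V') (f : seq T -> V' -> W)
    (g : seq T -> U -> V) u e :
  conv (fun w v => f w (p v)) g u e = conv f (fun w v => p (g w v)) u e.
Proof. by rewrite !conv_big. Qed.

Lemma convA U V W (W' : zmodType) (f : seq T -> W -> W') (g : seq T -> V -> W)
    (k : seq T -> U -> V) u e : (forall w, additive_map (f w)) ->
  conv f (conv g k) u e = conv (conv f g) k u e.
Proof.
elim: u f g => [|x w ih] f g hf; first by rewrite !conv_nil.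
rewrite !conv_cons ih // hf -addrA conv_nil; congr (_ + _).
by rewrite convDl conv_compl //; exact: hf.
Qed.

Lemma delta_eq V W (f f' : seq T -> V -> W) u e :
  (forall w v, f w v = f' w v) -> delta f u e = delta f' u e.
Proof.
move=> h; elim: u f f' h => // x [|y v] ih f f' h //.
by rewrite !delta_cons2 h; congr (_ - _); apply: ih => w t; apply: h.
Qed.

Lemma deltaD V W (f f' : seq T -> V -> W) u e :
  delta (fun w v => f w v + f' w v) u e = delta f u e + delta f' u e.
Proof.
elim: u f f' => [|x [|y v] ih] f f'; rewrite ?addr0 //.
by rewrite !delta_cons2 ih !opprD addrACA.
Qed.

Lemma delta_additive V W (f : seq T -> V -> W) :
  (forall w, additive_map (f w)) -> forall u, additive_map (delta f u).
Proof.
move=> hf u; elim: u f hf => [|x [|y v] ih] f hf a b; rewrite ?addr0 //.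
rewrite !delta_cons2 hf ih; last by move=> w; apply: hf.
by rewrite !opprD addrACA.
Qed.

Lemma delta_compl V W (W' : zmodType) (p : W -> W') (f : seq T -> V -> W) u e :
  additive_map p -> delta (fun w v => p (f w v)) u e = p (delta f u e).
Proof.
move=> hp; elim: u f => [|x [|y v] ih] f; rewrite ?(addmap0 hp) //.
by rewrite !delta_cons2 ih (addmapB hp) (addmapN hp).
Qed.

Lemma delta_compr V W (V' : zmodType) (p : V -> V') (f : seq T -> V' -> W) u e :
  delta (fun w v => f w (p v)) u e = delta f u (p e).
Proof.
elim: u f => [|x [|y v] ih] f //; rewrite !delta_cons2; congr (_ - _).
exact: (ih (fun w => f (x :: w))).
Qed.

(** [delta] is a derivation for the convolution, up to the parity of the length of
    the word that it jumps over. *)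
Lemma delta_conv U V W (f : seq T -> V -> W) (g : seq T -> U -> V) u e :
  (forall w, additive_map (f w)) ->
  delta (conv f g) u e =
  conv (delta f) g u e + conv (fun w v => sgnz (size w) (f w v)) (delta g) u e.
Proof.
elim: u f => [|x [|y v] ih] f hf.
- by rewrite !conv_nil /= (addmap0 (hf [::])) addr0.
- rewrite !conv_cons !conv_nil /= !add0r (addmap0 (hf [::])) add0r.
  by rewrite (addmap0 (hf [:: x])) sgnz0r.
rewrite delta_cons2 conv_cons.
have -> : delta (fun t => conv f g (x :: t)) (y :: v) e =
    f [::] (delta (fun t => g (x :: t)) (y :: v) e) + delta (conv (fun w => f (x :: w)) g) (y :: v) e.
  rewrite -(@delta_compl _ _ _ (f [::]) (fun t => g (x :: t)) _ _ (hf [::])).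
  by rewrite -deltaD; apply: delta_eq.
rewrite (ih (fun w => f (x :: w))); last by move=> w; exact: (hf (x :: w)).
have e1 : conv (delta f) g [:: x, y & v] e =
    - conv (fun w => f (mul x y :: w)) g v e
    - conv (fun w => delta (fun w => f (x :: w)) (y :: w)) g v e.
  by rewrite !conv_cons /= !add0r -!convNl -convDl.
have e2 : conv (delta (fun w => f (x :: w))) g (y :: v) e =
    conv (fun w => delta (fun w => f (x :: w)) (y :: w)) g v e.
  by rewrite conv_cons /= add0r.
have e3 : conv (fun w v0 => sgnz (size w) (f w v0)) (delta g) [:: x, y & v] e =
    f [::] (- g (mul x y :: v) e - delta (fun t => g (x :: t)) (y :: v) e)
    - conv (fun w v0 => sgnz (size w) (f (x :: w) v0)) (delta g) (y :: v) e.
  rewrite conv_cons -convNl; congr (_ + _).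
  apply: conv_eq => // w t.
  by rewrite -[size _]addn1 PoszD addrC sgnzDn.
have reorder (a b c k l : W) : - (a + b) - (c + (k + l)) = - b - k + (- a - c - l).
  by rewrite !opprD !addrA [LHS](ACl (2*4*1*3*5)).
by rewrite e1 e2 e3 (addmapB (hf [::])) (addmapN (hf [::])); apply: reorder.
Qed.

End Convolution.

(** * The convolution ring and its geometric series *)

Section Series.
Variables (T : Type) (V : zmodType).
Implicit Types (u w : seq T) (e : V).

Definition additive_words (f : seq T -> V -> V) : bool :=
  `[< forall u, additive_map (f u) >].

Fact additive_words_zmod : zmod_closed (additive_words : {pred seq T -> V -> V}).
Proof.
split=> [|f g /asboolP hf /asboolP hg]; first by apply/asboolP => u x y; rewrite addr0.
apply/asboolP => u x y; rewrite -![(f - g) _ _]/(f u _ - g u _) hf hg.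
by rewrite opprD addrACA.
Qed.
HB.instance Definition _ :=
  GRing.isZmodClosed.Build (seq T -> V -> V) additive_words additive_words_zmod.

Definition ser := {f : seq T -> V -> V | additive_words f}.
HB.instance Definition _ := SubChoice.on ser.
HB.instance Definition _ := [SubChoice_isSubZmodule of ser by <:].

Definition sfun (f : ser) : seq T -> V -> V := val f.

Lemma sfun_additive (f : ser) u : additive_map (sfun f u).
Proof. by move: u; apply/asboolP/(valP f). Qed.

Definition mkser (f : seq T -> V -> V) (hf : forall u, additive_map (f u)) : ser :=
  exist _ f (asboolT hf).

Lemma sfunE f (hf : forall u, additive_map (f u)) : sfun (mkser hf) = f.
Proof. by []. Qed.

Lemma serP (f g : ser) : (forall u e, sfun f u e = sfun g u e) -> f = g.
Proof. by move=> h; apply: val_inj; apply/funext => u; apply/funext => e; apply: h. Qed.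

Lemma serD f g u e : sfun (f + g) u e = sfun f u e + sfun g u e. Proof. by []. Qed.
Lemma serN f u e : sfun (- f) u e = - sfun f u e. Proof. by []. Qed.
Lemma ser0 u e : sfun 0 u e = 0. Proof. by []. Qed.

Fact cst_additive (p : V -> V) (hp : additive_map p) u :
  additive_map (fun e => if u is [::] then p e else 0).
Proof. by case: u => [|x w] a b; rewrite ?addr0. Qed.
Definition cst p (hp : additive_map p) : ser := mkser (cst_additive hp).

Definition ser_one : ser := cst (fun x y => erefl : id (x + y) = id x + id y).
Definition ser_mul (f g : ser) : ser :=
  mkser (conv_additive (sfun_additive f) (sfun_additive g)).

Lemma cst_mull p (hp : additive_map p) f u e :
  sfun (ser_mul (cst hp) f) u e = p (sfun f u e).
Proof.
rewrite sfunE; case: u => [|x w]; first by rewrite conv_nil.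
by rewrite conv_cons conv0l addr0.
Qed.

Lemma cst_mulr p (hp : additive_map p) f u e :
  sfun (ser_mul f (cst hp)) u e = sfun f u (p e).
Proof.
rewrite sfunE; have := sfun_additive f; move: (sfun f) => {}f hf.
elim: u f hf => [|x w ih] f hf; first by rewrite conv_nil.
rewrite conv_cons ih; last by move=> v; apply: hf.
by rewrite /= (addmap0 (hf [::])) add0r.
Qed.

Fact ser_mulA : associative ser_mul.
Proof. by move=> f g h; apply: serP => u e; apply: convA; apply: sfun_additive. Qed.
Fact ser_mul1l : left_id ser_one ser_mul.
Proof. by move=> f; apply: serP => u e; apply: cst_mull. Qed.
Fact ser_mul1r : right_id ser_one ser_mul.
Proof. by move=> f; apply: serP => u e; apply: cst_mulr. Qed.
Fact ser_mulDl : left_distributive ser_mul +%R.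
Proof. by move=> f g h; apply: serP => u e; apply: convDl. Qed.
Fact ser_mulDr : right_distributive ser_mul +%R.
Proof. by move=> f g h; apply: serP => u e; apply: convDr; apply: sfun_additive. Qed.
HB.instance Definition _ := GRing.Zmodule_isPzRing.Build ser
  ser_mulA ser_mul1l ser_mul1r ser_mulDl ser_mulDr.

Lemma serM f g u e : sfun (f * g) u e = conv (sfun f) (sfun g) u e. Proof. by []. Qed.
Lemma ser1 u e : sfun 1 u e = if u is [::] then e else 0. Proof. by []. Qed.
Lemma cstMl p (hp : additive_map p) f u e : sfun (cst hp * f) u e = p (sfun f u e).
Proof. exact: cst_mull. Qed.
Lemma cstMr p (hp : additive_map p) f u e : sfun (f * cst hp) u e = sfun f u (p e).
Proof. exact: cst_mulr. Qed.

Section Inverse.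
Variable N : ser.
Hypothesis N0 : forall e, sfun N [::] e = 0.

(** Partial sums of the alternating geometric series. *)
Fixpoint geom (n : nat) : ser := if n is m.+1 then 1 - N * geom m else 1.

Lemma nilM_eq (f g : ser) u : (forall w, (size w < size u)%N -> sfun f w =1 sfun g w) ->
  forall e, sfun (N * f) u e = sfun (N * g) u e.
Proof.
move=> h e; rewrite !serM; case: u h => [|x w] h; first by rewrite !conv_nil !N0.
by rewrite !conv_cons !N0 !add0r; apply: conv_eq => // v hv; apply: h.
Qed.

Lemma geom_stable n m m' u e : (size u <= n)%N -> (n <= m)%N -> (n <= m')%N ->
  sfun (geom m) u e = sfun (geom m') u e.
Proof.
have geom_nil k e' : sfun (geom k) [::] e' = e'.
  by case: k => //= k; rewrite serD serN serM conv_nil N0 oppr0 addr0.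
elim: n m m' u e => [|n ih] m m' u e hu hm hm'.
  by case: u hu => // _; rewrite !geom_nil.
case: m m' hm hm' => [//|m] [//|m'] hm hm' /=; rewrite !serD !serN; congr (_ - _).
apply: nilM_eq => w hw e'; apply: ih => //.
by rewrite -ltnS (leq_trans hw).
Qed.

(** On a word of length [n] the partial sums are constant from the [n]-th on. *)
Definition geom_sum : ser := mkser (fun u => sfun_additive (geom (size u)) u).

Lemma geom_sumE n u e : (size u <= n)%N -> sfun geom_sum u e = sfun (geom n) u e.
Proof. by move=> h; apply: (geom_stable (n := size u)). Qed.

Lemma geom_sum_rec : geom_sum = 1 - N * geom_sum.
Proof.
apply: serP => u e; rewrite (geom_sumE (n := (size u).+1)) //= !serD !serN.
congr (_ - _); apply: nilM_eq => w hw e'; rewrite (geom_sumE (n := size u)) //.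
exact: ltnW.
Qed.

End Inverse.

(** Every word is cut into finitely many pieces, so the geometric series of an element
    that vanishes on the empty word converges; on words of bounded length it agrees
    with a partial sum. *)
Lemma series_inverse (N : ser) : (forall e, sfun N [::] e = 0) ->
  exists Y : ser, [/\ (1 + N) * Y = 1, Y * (1 + N) = 1 &
    forall P : ser -> Prop, P 1 -> (forall x, P x -> P (1 - N * x)) ->
    forall n, exists2 Y', P Y' & forall u e, (size u <= n)%N -> sfun Y u e = sfun Y' u e].
Proof.
move=> N0; pose Y := geom_sum N.
have right_inv (K : ser) : (forall e, sfun K [::] e = 0) -> (1 + K) * geom_sum K = 1.
  by move=> K0; rewrite mulrDl mul1r {1}(geom_sum_rec K0) subrK.
have NY : (1 + N) * Y = 1 by apply: right_inv.
exists Y; split=> //.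
  have [Z YZ] : exists Z, Y * Z = 1.
    have YE : Y = 1 + (- (N * Y)) by apply: geom_sum_rec.
    exists (geom_sum (- (N * Y))); rewrite {1}YE; apply: right_inv => e.
    by rewrite serN serM conv_nil N0 oppr0.
  by have -> : 1 + N = Z by rewrite -[LHS]mulr1 -{2}YZ mulrA NY mul1r.
move=> P P1 PN n; exists (geom N n); last by move=> u e; apply: geom_sumE.
by elim: n => //= n ih; apply: PN.
Qed.

Section Derivation.
Variables (mul : T -> T -> T) (eps : V -> V).
Hypotheses (epsD : additive_map eps) (epsK : forall e, eps (eps e) = e).

Fact par_additive (f : ser) u : additive_map (fun e => eps (delta mul (sfun f) u e)).
Proof. by move=> x y; rewrite (delta_additive mul (sfun_additive f)) epsD. Qed.
Definition par (f : ser) : ser := mkser (par_additive f).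

Fact tau_additive (f : ser) u :
  additive_map (fun e => sgnz (size u) (eps (sfun f u (eps e)))).
Proof. by move=> x y; rewrite epsD (sfun_additive f) epsD sgnzD. Qed.
Definition tau (f : ser) : ser := mkser (tau_additive f).

Lemma parD f g : par (f + g) = par f + par g.
Proof.
by apply: serP => u e; rewrite serD !sfunE -epsD -deltaD.
Qed.

(** The sign operator inserted in [par] turns the parity of the length of a word into
    the parity of the degree, which is what [tau] records. *)
Lemma parM f g : par (f * g) = par f * g + tau f * par g.
Proof.
apply: serP => u e; rewrite serD !serM !sfunE.
rewrite (delta_conv _ _ _ _ (sfun_additive f)) epsD; congr (_ + _).
  by rewrite -conv_compl.
rewrite -conv_compl // -[RHS]conv_compm.
apply: conv_eq => // w v /=; rewrite epsK.
by rewrite (addmap_sgn epsD).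
Qed.

Lemma tau1 : tau 1 = 1.
Proof.
apply: serP => u e; rewrite sfunE ser1.
by case: u => [|x w]; rewrite ?epsK ?(addmap0 epsD) ?sgnz0r.
Qed.

Lemma par_cst p (hp : additive_map p) : par (cst hp) = 0.
Proof.
apply: serP => u e; rewrite ser0 sfunE.
have h (k : seq T -> V -> V) w : (forall v x, k v x = 0) -> delta mul k w e = 0.
  by elim: w k => // x [|y w] ih k hk //; rewrite delta_cons2 hk ih ?oppr0 ?addr0.
have -> : delta mul (sfun (cst hp)) u e = 0.
  by case: u => // x [|y w] //; rewrite delta_cons2 h ?subr0 //= oppr0.
exact: addmap0.
Qed.

Lemma tau_cst p (hp : additive_map p) : (forall e, eps (p (eps e)) = - p e) ->
  tau (cst hp) = - cst hp.
Proof.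
move=> h; apply: serP => u e; rewrite serN !sfunE.
by case: u => [|x w]; rewrite ?h ?(addmap0 epsD) ?sgnz0r ?oppr0.
Qed.

End Derivation.
End Series.

(** * Multilinear maps, degrees and the removal of signs *)

Section Words.
Variables (C A : comPzRingType) (cA : {rmorphism C -> A}) (D : formal_category cA).
Local Notation L := (Lambda D).
Local Notation "u ** v" := (Lmul u v) (at level 40, left associativity).
Local Notation "a %:L" := (Lscal D a) (at level 2, format "a %:L").
Implicit Types (a : A) (u v : L) (s t w : seq L).

(** The conditions on an element of [Q] that do not involve the grading. *)
Record lin_words (V W : lmodType A) (f : seq L -> V -> W) : Prop := LinWords {
  lw_addE : forall w, additive_map (f w);
  lw_add : forall s u v t e,
    f (s ++ (u + v) :: t) e = f (s ++ u :: t) e + f (s ++ v :: t) e;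
  lw_left : forall a u s e, f (a%:L ** u :: s) e = a *: f (u :: s) e;
  lw_mid : forall s u a v t e,
    f (s ++ u ** a%:L :: v :: t) e = f (s ++ u :: a%:L ** v :: t) e;
  lw_right : forall s u a e, f (rcons s (u ** a%:L)) e = f (rcons s u) (a *: e);
  lw_nil : forall a e, f [::] (a *: e) = a *: f [::] e
}.

Section Closure.
Variables V W U : lmodType A.

(** When the two letters of the middle condition are separated by the cut, a scalar has to
    pass from the last letter of the left piece to the first letter of the right one:
    this combines the right condition for [f] with the left condition for [g]. *)
Lemma lin_words_conv (f : seq L -> V -> W) (g : seq L -> U -> V) :
  lin_words f -> lin_words g -> lin_words (conv f g).
Proof.
move=> [fE fD fl fm fr f0] [gE gD gl gm gr g0]; split.
- exact: conv_additive.
- move=> s u v t e; elim: s f fE fD {fl fm fr f0} => [|x s ih] f fE fD.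
    rewrite !cat0s !conv_cons (gD [::]) fE addrACA -convDl; congr (_ + _).
    by apply: conv_eq => // w z; apply: (fD [::]).
  rewrite !cat_cons !conv_cons (gD (x :: s)) fE (ih (fun w => f (x :: w))).
  - exact: addrACA.
  - by move=> w; apply: fE.
  - by move=> s' u' v' t' e'; apply: (fD (x :: s')).
- move=> a u s e; rewrite !conv_cons gl f0 scalerDr; congr (_ + _).
  rewrite !conv_big scaler_sumr; apply: eq_bigr => j _; exact: fl.
- move=> s u a v t e; elim: s f fE fD {fl f0} fm fr => [|x s ih] f fE fD fm fr.
    rewrite !cat0s !conv_cons (gm [::]) gl [f [:: u ** a%:L] _](fr [::]); congr (_ + (_ + _)).
    by apply: conv_eq => // w z; apply: (fm [::]).
  rewrite !cat_cons !conv_cons (gm (x :: s)) (ih (fun w => f (x :: w))).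
  + by [].
  + by move=> w; apply: fE.
  + by move=> s' u' v' t' e'; apply: (fD (x :: s')).
  + by move=> s' u' a' v' t' e'; apply: (fm (x :: s')).
  + by move=> s' u' a' e'; apply: (fr (x :: s')).
- move=> s u a e; elim: s f fE {fD fl f0 fm} fr => [|x s ih] f fE fr.
    rewrite !conv_cons !conv_nil (gr [::]); congr (_ + _).
    by rewrite (fr [::]) g0.
  rewrite !rcons_cons !conv_cons (gr (x :: s)) (ih (fun w => f (x :: w))).
  + by [].
  + by move=> w; apply: fE.
  + by move=> s' u' a' e'; apply: (fr (x :: s')).
- by move=> a e; rewrite !conv_nil g0 f0.
Qed.

Lemma lin_words_sub (f g : seq L -> V -> W) : lin_words f -> lin_words g ->
  lin_words (fun w e => f w e - g w e).
Proof.
move=> [fE fD fl fm fr f0] [gE gD gl gm gr g0]; split=> *.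
- by move=> x y; rewrite fE gE opprD addrACA.
- by rewrite fD gD opprD addrACA.
- by rewrite fl gl scalerBr.
- by rewrite fm gm.
- by rewrite fr gr.
- by rewrite f0 g0 scalerBr.
Qed.

Lemma lin_words_cst (p : {linear V -> W}) :
  lin_words (fun w e => if w is [::] then p e else 0).
Proof.
split=> [w x y|s u v t e|a u s e|s u a v t e|s u a e|a e].
- by case: w => [|z w]; rewrite ?addr0 // linearD.
- by case: s => [|z s]; rewrite /= addr0.
- by rewrite scaler0.
- by case: s.
- by case: s.
- by rewrite linearZ.
Qed.

(** Each condition compares values at words of equal length, so a function that agrees
    with good ones on words of bounded length is good. *)
Lemma lin_words_local (f : seq L -> V -> W) :
  (forall n, exists2 f', lin_words f' & forall w e, (size w <= n)%N -> f w e = f' w e) ->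
  lin_words f.
Proof.
move=> h; split=> [w x y|s u v t e|a u s e|s u a v t e|s u a e|a e].
- by have [f' [h1 _ _ _ _ _] e] := h (size w); rewrite !e ?h1.
- have [f' [_ h1 _ _ _ _] e'] := h (size (s ++ (u + v) :: t)).
  by rewrite !e' ?h1 // !size_cat.
- by have [f' [_ _ h1 _ _ _] e'] := h (size (u :: s)); rewrite !e' ?h1.
- have [f' [_ _ _ h1 _ _] e'] := h (size (s ++ [:: u, v & t])).
  by rewrite !e' ?h1 // !size_cat.
- have [f' [_ _ _ _ h1 _] e'] := h (size (rcons s u)).
  by rewrite !e' ?h1 // !size_rcons.
- by have [f' [_ _ _ _ _ h1] e'] := h 0%N; rewrite !e' ?h1.
Qed.

Lemma lin_words_pre (f : seq L -> V -> W) (p : {linear U -> V}) :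
  lin_words f -> lin_words (fun w e => f w (p e)).
Proof.
move=> [fE fD fl fm fr f0]; split=> *.
- by move=> x y; rewrite linearD fE.
- exact: fD.
- exact: fl.
- exact: fm.
- by rewrite fr linearZ.
- by rewrite linearZ f0.
Qed.

Lemma lin_words_post (f : seq L -> U -> V) (p : {linear V -> W}) :
  lin_words f -> lin_words (fun w e => p (f w e)).
Proof.
move=> [fE fD fl fm fr f0]; split=> *.
- by move=> x y; rewrite fE linearD.
- by rewrite fD linearD.
- by rewrite fl linearZ.
- by rewrite fm.
- by rewrite fr.
- by rewrite f0 linearZ.
Qed.

End Closure.

Lemma lin_words_pair (V W V' W' : lmodType A) (f : seq L -> V -> W) (g : seq L -> V' -> W') :
  lin_words f -> lin_words g -> lin_words (fun w (x : V * V') => (f w x.1, g w x.2)).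
Proof.
move=> [fE fD fl fm fr f0] [gE gD gl gm gr g0].
split=> [w x y|s u v t e|a u s e|s u a v t e|s u a e|a e];
  apply: injective_projections => /=.
- exact: fE.
- exact: gE.
- exact: fD.
- exact: gD.
- exact: fl.
- exact: gl.
- exact: fm.
- exact: gm.
- exact: fr.
- exact: gr.
- exact: f0.
- exact: g0.
Qed.

Section Degrees.
Implicit Types V W U : gmod A.

(** Each letter lowers the degree by one, as in [Q]. *)
Definition degw V W (i : int) (f : seq L -> V -> W) : Prop :=
  forall w, deg (i - (size w)%:Z) (f w).

Lemma deg_cast V W i j (f : V -> W) : i = j -> deg i f -> deg j f.
Proof. by move=> ->. Qed.

Lemma degw_conv V W U i j (f : seq L -> V -> W) (g : seq L -> U -> V) :
  degw i f -> degw j g -> degw (i + j) (conv f g).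
Proof.
move=> df dg w; elim: w i f df => [|x w ih] i f df n e he.
  rewrite conv_nil (_ : _ + n = (i - 0%:Z) + (j - 0%:Z + n)); last by rewrite !subr0 addrA.
  by apply: (df [::]); apply: (dg [::]).
rewrite conv_cons; apply: homD.
  rewrite (_ : _ + n = (i - 0%:Z) + (j - (size (x :: w))%:Z + n)); last by rewrite subr0 !addrA.
  by apply: (df [::]); apply: dg.
rewrite (_ : i + j - _ = (i - 1) + j - (size w)%:Z); last by rewrite /=; lia.
apply: ih => // v; apply: deg_cast (df (x :: v)).
by rewrite /=; lia.
Qed.

Lemma degw_sub V W i (f g : seq L -> V -> W) : degw i f -> degw i g ->
  degw i (fun w e => f w e - g w e).
Proof. by move=> df dg w n e he; apply: homB; [apply: df|apply: dg]. Qed.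

Lemma degw_cst V W i (p : V -> W) : deg i p ->
  degw i (fun w e => if w is [::] then p e else 0).
Proof.
move=> dp [|x w] n e he; first by rewrite subr0; apply: dp.
exact: hom0.
Qed.

Lemma degw_local V W i (f : seq L -> V -> W) :
  (forall n, exists2 f', degw i f' & forall w e, (size w <= n)%N -> f w e = f' w e) ->
  degw i f.
Proof.
by move=> h w n e he; have [f' df e'] := h (size w); rewrite e' //; apply: df.
Qed.

Definition twist V (k : nat) (e : V) : V := if odd k then geps e else e.

Lemma twistD V k (x y : V) : twist k (x + y) = twist k x + twist k y.
Proof. by rewrite /twist; case: odd; rewrite ?linearD. Qed.
Lemma twistZ V k a (x : V) : twist k (a *: x) = a *: twist k x.
Proof. by rewrite /twist; case: odd; rewrite ?linearZ. Qed.
Lemma twistK V k (x : V) : twist k (twist k x) = x.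
Proof. by rewrite /twist; case: odd; rewrite ?epsK. Qed.
Lemma hom_twist V k n (x : V) : hom n x -> hom n (twist k x).
Proof. by rewrite /twist; case: odd => // /hom_eps. Qed.
Lemma twist_add V j k (x : V) : twist (j + k) x = twist j (twist k x).
Proof. by rewrite /twist oddD; do 2!case: odd => //=; rewrite epsK. Qed.

Lemma deg_twist V W i (f : V -> W) k x : additive_map f -> deg i f ->
  f (twist k x) = sgnz (k%:Z * i) (twist k (f x)).
Proof.
move=> hf df; rewrite /twist.
case ok: (odd k); last by rewrite /sgnz abszM oddM absz_nat ok.
rewrite (deg_eps _ hf df); apply: sgnz_parity; by rewrite abszM oddM absz_nat ok.
Qed.

(** Twisting by these signs turns the signed product of multilinear maps into the
    convolution product, in which no sign occurs. *)
Definition hat V W (q : seq L -> V -> W) : seq L -> V -> W := fun w e =>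
  sgnz ('C(size w, 2))%:Z (q w (twist (size w) e)).

Lemma degw_post V W U i (f : seq L -> U -> V) (p : V -> W) :
  deg 0 p -> degw i f -> degw i (fun w e => p (f w e)).
Proof. by move=> dp df w n e he; have := dp _ _ (df w n e he); rewrite add0r. Qed.

Lemma degw_pre V W U i (f : seq L -> V -> W) (p : U -> V) :
  deg 0 p -> degw i f -> degw i (fun w e => f w (p e)).
Proof. by move=> dp df w n e he; apply: df; rewrite -[n]add0r; apply: dp. Qed.

Lemma hatK V W (q : seq L -> V -> W) w e : hat (hat q) w e = q w e.
Proof. by rewrite /hat sgnzK twistK. Qed.

Lemma hat_eq0 V W (q : seq L -> V -> W) :
  (forall w e, hat q w e = 0) -> forall w e, q w e = 0.
Proof.
move=> h w e; rewrite -hatK -[LHS]/(sgnz _ (hat q w (twist (size w) e))).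
by rewrite h sgnz0r.
Qed.

Lemma hatD V W (q q' : seq L -> V -> W) w e :
  hat (fun w e => q w e + q' w e) w e = hat q w e + hat q' w e.
Proof. exact: sgnzD. Qed.

Lemma hatN V W (q : seq L -> V -> W) w e :
  hat (fun w e => - q w e) w e = - hat q w e.
Proof. exact: sgnzN. Qed.

Lemma hat_degw V W i (q : seq L -> V -> W) : degw i q -> degw i (hat q).
Proof. by move=> dq w n e he; apply: hom_sgn; apply: dq; apply: hom_twist. Qed.

Lemma sgnzZ (V : lmodType A) n a (x : V) : sgnz n (a *: x) = a *: sgnz n x.
Proof. by rewrite /sgnz; case: odd; rewrite ?scalerN. Qed.

Lemma hat_lin_words V W (q : seq L -> V -> W) : lin_words q -> lin_words (hat q).
Proof.
move=> [fE fD fl fm fr f0]; split=> *; rewrite /hat.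
- by move=> x y; rewrite twistD fE sgnzD.
- by rewrite !size_cat /= fD sgnzD.
- by rewrite /= fl sgnzZ.
- by rewrite !size_cat /= fm.
- by rewrite !size_rcons fr twistZ.
- by rewrite /= f0.
Qed.

End Degrees.

Section Conversion.
Implicit Types E F G : cochain A.

Lemma in_QP E F i (q : multimap D E F) :
  in_Q i q <-> degw (V := gtot E) (W := gtot F) i q /\ lin_words q.
Proof.
split=> [[qd qD qE ql qm qr q0]|[dq [fE fD fl fm fr f0]]].
  split; last by split=> // w x y; apply: qE.
  move=> w n e /gtot_homE he; apply/gtot_homE.
  by have := qd w n e he; rewrite addrAC.
split=> // w n e /(gtot_homE (E := E)) he.
have /gtot_homE := dq w n e he.
by rewrite addrAC.
Qed.

Lemma contract_cons l x (s : seq L) : contract l.+2 (x :: s) = x :: contract l.+1 s.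
Proof. by []. Qed.

Lemma delta_big (V W : zmodType) (f : seq L -> V -> W) w e :
  delta (@Lmul C A cA D) f w e = \sum_(1 <= l < size w) sgnz l%:Z (f (contract l w) e).
Proof.
elim: w f => [|x [|y v] ih] f; [by rewrite big_geq|by rewrite big_geq|].
rewrite delta_cons2 ih [RHS]big_ltn // big_add1; congr (_ + _).
  by rewrite /contract /= drop0.
rewrite -sumrN [LHS]big_nat [RHS]big_nat; apply: eq_bigr => -[//|l] _.
by rewrite contract_cons -[l.+2]addn1 PoszD addrC sgnzDn.
Qed.

Lemma size_contract l (w : seq L) : (0 < l < size w)%N -> size (contract l w) = (size w).-1.
Proof.
move=> /andP[l0 lw]; rewrite /contract size_cat /= size_take size_drop.
by case: ifP; lia.
Qed.

Lemma binS2 k : (0 < k)%N -> 'C(k, 2) = ('C(k.-1, 2) + k.-1)%N.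
Proof. by case: k => // k _; rewrite binS bin1. Qed.

Lemma bin2D j m : 'C(j + m, 2) = ('C(j, 2) + 'C(m, 2) + j * m)%N.
Proof.
elim: j => [|j ih]; first by rewrite add0n bin0n mul0n addn0.
by rewrite addSn !binS !bin1 ih mulSn; lia.
Qed.

(** After the twist the last part of the differential has signs that depend on the place
    of the contraction only. *)
Lemma hat_dQ E F i (q : multimap D E F) w e : in_Q i q ->
  hat (V := gtot E) (W := gtot F) (dQ i q) w e =
    tdiff F (hat (V := gtot E) (W := gtot F) q w e)
    - sgnz i (hat (V := gtot E) (W := gtot F) q w (tdiff E e))
    + geps (delta (@Lmul C A cA D) (hat (V := gtot E) (W := gtot F) q) w e : gtot F).
Proof.
move=> /in_QP [dq [qE _ _ _ _ _]].
rewrite {1}/hat /dQ sgnzD addmapB; last by move=> x y; apply: sgnzD.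
congr (_ - _ + _).
- exact: (esym (linear_sgn (tdiff F) _ _)).
- rewrite -[tot_diff _]/(tdiff E _) (deg_twist _ _ (linear_additive (tdiff E)) (@tdiff_deg A E)).
  rewrite (addmap_sgn (qE w)) /hat -!sgnzDn; apply: sgnz_parity; lia.
rewrite delta_big sgnz_sum linear_sum big_nat [RHS]big_nat.
apply: eq_bigr => l hl; have sl := size_contract hl.
rewrite {1}/hat sl !linear_sgn.
have -> : twist (size w) e = geps (twist (size w).-1 e : gtot E).
  rewrite -[size w in LHS]prednK; last by move: hl; lia.
  by rewrite -[(_.-1).+1]add1n twist_add.
rewrite (deg_eps (V := gtot E) (W := gtot F) _ (qE _) (dq (contract l w))) sl -!sgnzDn.
apply: sgnz_parity; rewrite (@binS2 (size w)); last by move: hl; lia.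
move: hl; lia.
Qed.

(** The signs match because [C(j + m, 2) = C(j, 2) + C(m, 2) + j m]. *)
Lemma hat_Qmul E F G i (p : multimap D F G) (q : multimap D E F) w e :
  in_Q i q -> (forall w, additive_map (p w)) ->
  hat (V := gtot E) (W := gtot G) (Qmul i p q) w e =
  conv (hat (V := gtot F) (W := gtot G) p) (hat (V := gtot E) (W := gtot F) q) w e.
Proof.
move=> /in_QP [dq [qE _ _ _ _ _]] pE.
rewrite conv_big {1}/hat /Qmul sgnz_sum big_nat [RHS]big_nat.
apply: eq_bigr => j; rewrite ltnS => hj.
have hj' : (j <= size w)%N by move: hj; lia.
rewrite /hat size_takel // size_drop.
move: hj'; move em : (size w - j)%N => m hj'.
have ew : size w = (j + m)%N by lia.
rewrite (addmap_sgn (f := twist j)); last by move=> x y; apply: twistD.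
have tw : twist j (q (drop j w) (twist m (e : gtot E)) : gtot F) =
    sgnz (j%:Z * (i - m%:Z)) (q (drop j w) (twist (size w) (e : gtot E))).
  have h := deg_twist (V := gtot E) (W := gtot F) j (twist m e) (qE _) (dq (drop j w)).
  by rewrite ew twist_add h size_drop em sgnzK.
rewrite tw !(addmap_sgn (pE _)) -!sgnzDn; apply: sgnz_parity.
rewrite ew bin2D mulrBr !PoszD PoszM; lia.
Qed.

End Conversion.
End Words.

(** * From a homotopy equivalence to a strict deformation retraction *)

Section Retract.
Variables (A : pzRingType) (E F : cochain A).
Local Notation TE := (gtot E).
Local Notation TF := (gtot F).
Variables (K : gmod A) (dK cK : {linear K -> K}).
Hypotheses (dK_deg : deg 1 dK) (cK_deg : deg (-1) cK).
Hypothesis dKK : forall k, dK (dK k) = 0.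
Hypothesis cK_contracts : forall k, dK (cK k) + cK (dK k) = k.
Variables (rho : {linear K -> TF}) (sigma : {linear TF -> K}).
Hypotheses (rho_deg : deg 0 rho) (sigma_deg : deg 0 sigma).
Hypothesis rho_diff : forall k, rho (dK k) = tdiff F (rho k).
Hypothesis rho_sigma : forall f, rho (sigma f) = f.
Variables (a0 : {linear TE -> TF}) (b0 : {linear TF -> TE}).
Variables (hE : {linear TE -> TE}) (hF : {linear TF -> TF}).
Hypotheses (a0_deg : deg 0 a0) (b0_deg : deg 0 b0).
Hypotheses (hE_deg : deg (-1) hE) (hF_deg : deg (-1) hF).
Hypothesis a0_diff : forall e, a0 (tdiff E e) = tdiff F (a0 e).
Hypothesis b0_diff : forall f, b0 (tdiff F f) = tdiff E (b0 f).
Hypothesis hE_homotopy : forall e, e - b0 (a0 e) = tdiff E (hE e) + hE (tdiff E e).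
Hypothesis hF_homotopy : forall f, f - a0 (b0 f) = tdiff F (hF f) + hF (tdiff F f).

Local Notation V := (gprod TE K).
Implicit Types (x : V) (e : TE) (f : TF) (k : K).

Lemma linear_exists (M N : lmodType A) (g : M -> N) : linear g ->
  exists g' : {linear M -> N}, forall m, g' m = g m.
Proof. by move=> hg; exists (linmap hg). Qed.

(** Adding the contractible complex [K] to [E] turns the homotopy equivalence into a
    strict deformation retraction: [cor] is a chain map homotopic to zero whose image
    under [rho] makes up for the failure of [a0 b0] to be the identity.  The
    homotopy exists on the block from [E] to itself because [b0 a0] is homotopic to
    the identity, and on the other blocks because the identity of [K] is. *)
Lemma deformation_retraction : exists (dV h : {linear V -> V})
    (p : {linear V -> TF}) (i : {linear TF -> V}),
  [/\ forall x, dV x = (tdiff E x.1, dK x.2),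
      [/\ deg 1 dV, deg (-1) h, deg 0 p & deg 0 i],
      (forall x, p (dV x) = tdiff F (p x)) /\ (forall f, i (tdiff F f) = dV (i f)),
      [/\ forall f, p (i f) = f, forall x, x - i (p x) = dV (h x) + h (dV x),
          forall x, p (h x) = 0 & forall f, h (i f) = 0] &
      (forall e, p (e, 0) = a0 e) /\ (forall f, (i f).1 = b0 f)].
Proof.
have [dV dVE] : exists dV : {linear V -> V}, forall x, dV x = (tdiff E x.1, dK x.2).
  by apply: linear_exists => a x y; rewrite !linearP.
have [p pE] : exists p : {linear V -> TF}, forall x, p x = a0 x.1 + rho x.2.
  by apply: linear_exists => a x y; rewrite !linearP scalerDr addrACA.
have [cor corE] : exists cor : {linear TF -> K}, forall f,
    cor f = dK (sigma (hF f)) + sigma (hF (tdiff F f)).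
  by apply: linear_exists => a x y; rewrite !linearP scalerDr addrACA.
have [i iE] : exists i : {linear TF -> V}, forall f, i f = (b0 f, cor f).
  by apply: linear_exists => a x y; rewrite !linearP.
have pi_id f : p (i f) = f.
  by rewrite pE iE corE /= linearD /= rho_diff !rho_sigma -hF_homotopy addrC subrK.
have cor_diff f : cor (tdiff F f) = dK (cor f).
  by rewrite !corE tdiffK !linear0 addr0 linearD /= dKK add0r.
have p_diff x : p (dV x) = tdiff F (p x).
  by rewrite !pE dVE /= linearD /= a0_diff rho_diff.
have i_diff f : i (tdiff F f) = dV (i f).
  by rewrite dVE !iE b0_diff cor_diff.
have p_deg : deg 0 p.
  move=> n x /gprod_homE [h1 h2]; rewrite pE.
  by apply: homD; [apply: a0_deg|apply: rho_deg].
have cor_deg : deg 0 cor.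
  move=> n f hf; rewrite corE; apply: homD.
    have h := dK_deg (sigma_deg (hF_deg hf)).
    by move: h; rewrite add0r !addrA subrr.
  have h := sigma_deg (hF_deg (@tdiff_deg _ F _ _ hf)).
  by move: h; rewrite addrA add0r addrA addNr.
have i_deg : deg 0 i.
  by move=> n f hf; rewrite iE; apply/gprod_homE; split; [apply: b0_deg|apply: cor_deg].
have dV_deg : deg 1 dV.
  move=> n x /gprod_homE [h1 h2]; rewrite dVE.
  by apply/gprod_homE; split; [apply: tdiff_deg|apply: dK_deg].
have [G GE] : exists G : {linear V -> V}, forall x, G x = x - i (p x).
  by apply: linear_exists => a x y; rewrite !linearP addrACA -scalerDr.
have [H HE] : exists H : {linear V -> V}, forall x,
    H x = (hE x.1 - b0 (rho (cK x.2)), cK (x.2 - cor (p x))).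
  apply: linear_exists => a x y; apply: injective_projections => /=.
    by rewrite !linearP addrACA -scalerDr.
  by rewrite !linearP addrACA -scalerDr linearP.
have H_homotopy x : dV (H x) + H (dV x) = G x.
  rewrite GE; apply: injective_projections; rewrite iE dVE !HE dVE /=.
    rewrite linearB /= addrACA -hE_homotopy -b0_diff -rho_diff -opprD -linearD -linearD.
    by rewrite cK_contracts pE linearD /= opprD addrA.
  have -> : p (tdiff E x.1, dK x.2) = tdiff F (p x) by rewrite -p_diff dVE.
  by rewrite cor_diff -linearB cK_contracts.
have H_deg : deg (-1) H.
  move=> n x hx; have /gprod_homE [h1 h2] := hx; rewrite HE; apply/gprod_homE; split=> /=.
    apply: homB; first exact: hE_deg.
    by have := b0_deg (rho_deg (cK_deg h2)); rewrite !add0r.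
  apply: cK_deg; apply: homB => //.
  by have := cor_deg _ _ (p_deg _ _ hx); rewrite !add0r.
have G_deg : deg 0 G.
  move=> n x hx; rewrite GE add0r; apply: homB => //.
  by have := i_deg _ _ (p_deg _ _ hx); rewrite !add0r.
have G_diff x : G (dV x) = dV (G x) by rewrite !GE p_diff i_diff linearB.
have pG x : p (G x) = 0 by rewrite GE linearB /= pi_id subrr.
have Gi f : G (i f) = 0 by rewrite GE pi_id subrr.
have GG x : G (G x) = G x by rewrite [LHS]GE pG linear0 subr0.
(* Conjugating the homotopy by the projection [G] onto the kernel of [p] keeps its
   boundary, as [G] is an idempotent chain map, and makes [p] and [i] kill it. *)
exists dV, (G \o H \o G : {linear V -> V}), p, i; split=> //.
- split=> // n x hx /=; have := G_deg _ _ (H_deg _ _ (G_deg _ _ hx)).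
  by rewrite !add0r.
- split=> [//|x|x|f] /=.
  + by rewrite -GE G_diff -[dV (G (H _))]G_diff -linearD H_homotopy !GG.
  + exact: pG.
  + by rewrite Gi !linear0.
split=> [e|f]; first by rewrite pE /= linear0 addr0.
by rewrite iE.
Qed.

End Retract.

(** * Homotopy transfer of Maurer-Cartan elements *)

Section Transfer.
Variables (C A : comPzRingType) (cA : {rmorphism C -> A}) (D : formal_category cA).
Local Notation L := (Lambda D).
Local Notation "u ** v" := (Lmul u v) (at level 40, left associativity).
Local Notation "a %:L" := (Lscal D a) (at level 2, format "a %:L").
Local Notation Delta := (delta (@Lmul C A cA D)).

Section StrictAction.
Variables (K : gmod A) (act : L -> K -> K).
Hypothesis act_additive : forall u, additive_map (act u).
Hypothesis actD : forall u v k, act (u + v) k = act u k + act v k.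
Hypothesis actM : forall u v k, act (u ** v) k = act u (act v k).
Hypothesis actS : forall a k, act a%:L k = a *: k.
Hypothesis act_deg : forall u, deg 0 (act u).
Variable dK : {linear K -> K}.
Hypothesis dK_deg : deg 1 dK.
Hypothesis dK_act : forall u k, dK (act u k) = act u (dK k).

(** A module over [L] in the strict sense, as a Maurer-Cartan element without higher terms. *)
Definition strict (w : seq L) (k : K) : K := if w is [:: u] then act u (geps k) else 0.

Lemma strict_size w k : size w != 1%N -> strict w k = 0.
Proof. by case: w => [|u [|v w]]. Qed.

Lemma act_eps u k : act u (geps k) = geps (act u k).
Proof. exact: (deg_eps _ (act_additive u) (act_deg u)). Qed.

Lemma strict_lin_words : lin_words strict.
Proof.
split=> [w x y|s u v t e|a u s e|s u a v t e|s u a e|a e].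
- by case: w => [|u [|v w]] /=; rewrite ?addr0 // linearD act_additive.
- case: s => [|x [|y s]] /=; last by rewrite addr0.
    by case: t => [|y t]; rewrite ?addr0 ?actD.
  by rewrite addr0.
- by case: s => [|v s] /=; rewrite ?scaler0 // actM actS.
- by case: s => [|x [|y s]].
- case: s => [|x [|y s]] //=.
  by rewrite actM actS linearZ.
- by rewrite /= scaler0.
Qed.

Lemma strict_degw : degw 1 strict.
Proof.
move=> [|u [|v w]] n k hk; try exact: hom0.
exact/act_deg/hom_eps.
Qed.

(** On one letter the action commutes with the differential; on two letters the equation
    is the associativity of the action; longer words give zero term by term. *)
Lemma strict_mc w k : dK (strict w k) + strict w (dK k) + conv strict strict w k
  + geps (Delta strict w k) = 0.
Proof.
have s0 v : strict v 0 = 0.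
  by case: v => [|x [|y v]] //=; rewrite linear0 (addmap0 (act_additive x)).
case: w => [|u [|v [|y w]]].
- by rewrite conv_nil /= !linear0 !addr0.
- rewrite conv_cons conv_nil /= !linear0 addr0 (addmap0 (act_additive u)) !addr0.
  rewrite dK_act -(act_additive u) (_ : dK (geps k) = - geps (dK k)) ?addNr ?(addmap0 (act_additive u)) //.
  by rewrite (deg_eps _ (linear_additive dK) dK_deg).
- rewrite !conv_cons conv_nil /= !linear0 !addr0 !add0r linearN /= !act_eps.
  by rewrite actM epsK addrN.
have c0 : conv strict strict [:: u, v, y & w] k = 0.
  rewrite conv_big big1 // => j _; have [->|hj] := eqVneq j 1%N.
    by rewrite (@strict_size (drop _ _)) // s0.
  have [h|h] := ltnP j (size [:: u, v, y & w]).
    by rewrite (@strict_size (take _ _)) // size_takel // ltnW.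
  by rewrite drop_oversize // s0.
have d0 : Delta strict [:: u, v, y & w] k = 0.
  rewrite delta_big big_nat big1 // => l hl.
  by rewrite strict_size ?sgnz0r // size_contract.
by rewrite c0 d0 !strict_size // !linear0 !addr0.
Qed.

Section Perturbation.
Variables (E F : cochain A) (eta : multimap D E E).
Hypothesis heta : MC eta.
Local Notation TE := (gtot E).
Local Notation TF := (gtot F).
Local Notation V := (gprod TE K).
Variables (a0 : {linear TE -> TF}) (b0 : {linear TF -> TE}).
Variables (dV h : {linear V -> V}) (p : {linear V -> TF}) (i : {linear TF -> V}).
Hypothesis dVE : forall x, dV x = (tdiff E x.1, dK x.2).
Hypotheses (h_deg : deg (-1) h) (p_deg : deg 0 p) (i_deg : deg 0 i).
Hypothesis p_diff : forall x, p (dV x) = tdiff F (p x).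
Hypothesis i_diff : forall f, i (tdiff F f) = dV (i f).
Hypothesis pi_id : forall f, p (i f) = f.
Hypothesis h_homotopy : forall x, x - i (p x) = dV (h x) + h (dV x).
Hypothesis ph : forall x, p (h x) = 0.
Hypothesis hi : forall f, h (i f) = 0.
Hypothesis p_a0 : forall e, p (e, 0) = a0 e.
Hypothesis i_b0 : forall f, (i f).1 = b0 f.

Local Notation etaE := (hat (V := TE) (W := TE) eta).

Let etaE_lin : lin_words (etaE : seq L -> TE -> TE).
Proof. by apply: hat_lin_words; have [] := (in_QP _ _).1 (MC_Q1 heta). Qed.

Let etaE_degw : degw 1 (etaE : seq L -> TE -> TE).
Proof. by apply: hat_degw; have [] := (in_QP _ _).1 (MC_Q1 heta). Qed.

Let etaE_mc w (e : TE) : tdiff E (etaE w e) + etaE w (tdiff E e)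
  + conv etaE etaE w e + geps (Delta etaE w e : TE) = 0.
Proof.
have := congr1 (sgnz ('C(size w, 2))%:Z) (MC_eq heta w (twist (size w) (e : TE))).
rewrite sgnz0r sgnzD -[X in X + _]/(hat (V := TE) (W := TE) (dQ 1 eta) w e).
rewrite -[X in _ + X]/(hat (V := TE) (W := TE) (Qmul 1 eta eta) w e).
have q1 := MC_Q1 heta.
rewrite (hat_dQ _ _ q1) (hat_Qmul _ _ q1); last by have [] := (in_QP _ _).1 q1 => _ [].
by rewrite [sgnz 1 _]/= opprK addrAC.
Qed.

(** The perturbation of [E + K]; the given one on [E], the strict action on [K]. *)
Definition etaV (w : seq L) (x : V) : V := (etaE w x.1, strict w x.2).

Let etaV_degw : degw 1 etaV.
Proof.
move=> w n x /gprod_homE [h1 h2]; apply/gprod_homE; split; first exact: etaE_degw.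
exact: strict_degw.
Qed.

Let etaV_lin : lin_words etaV.
Proof.
exact: (lin_words_pair etaE_lin strict_lin_words).
Qed.

Let etaV_additive w : additive_map (etaV w). Proof. by case: etaV_lin. Qed.

Let etaV_nil x : etaV [::] x = 0.
Proof.
apply: injective_projections => //=; rewrite /hat /=.
by have := MC_P heta [::] x.1; rewrite /restrTA /= => ->.
Qed.

Let etaV_scalars (s : seq A) x : etaV [seq a%:L | a <- s] x =
  if s is [:: a] then a *: geps x else 0.
Proof.
have hs : etaE [seq a%:L | a <- s] x.1 = if s is [:: a] then a *: geps x.1 else 0.
  have := MC_P heta s (twist (size s) x.1).
  rewrite /hat size_map /restrTA => ->.
  by case: s => [|a [|b s]]; rewrite ?sgnz0r.
apply: injective_projections; rewrite /= ?hs; first by case: s {hs} => [|a [|b s]].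
by case: s {hs} => [|a [|b s]] //=; rewrite actS.
Qed.

Let etaV_mc w x : dV (etaV w x) + etaV w (dV x) + conv etaV etaV w x
  + geps (Delta etaV w x) = 0.
Proof.
have fstD : additive_map (fst : V -> TE) by [].
have sndD : additive_map (snd : V -> K) by [].
apply: injective_projections; rewrite !dVE /=.
  rewrite -(conv_compl _ _ _ _ fstD) -(delta_compl _ _ _ _ fstD).
  rewrite delta_compr conv_big -(conv_big etaE etaE).
  exact: etaE_mc.
rewrite -(conv_compl _ _ _ _ sndD) -(delta_compl _ _ _ _ sndD).
rewrite delta_compr conv_big -(conv_big strict strict).
exact: strict_mc.
Qed.

Let epsD : additive_map (geps : V -> V) := linear_additive geps.
Let epsVK := @epsK A V.
Local Notation S := (ser L V).
Local Notation parV := (par (@Lmul C A cA D) epsD).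
Local Notation tauV := (tau epsD : S -> S).
Let cd : S := cst L (linear_additive dV).
Let ch : S := cst L (linear_additive h).
Let ce : S := mkser etaV_additive.
Let cip : S := cst L (linear_additive (i \o p : {linear V -> V})).

Let ring_mc : cd * ce + ce * cd + ce * ce + parV ce = 0.
Proof.
by apply: serP => w x; rewrite !serD cstMl cstMr serM; apply: etaV_mc.
Qed.

Let tau_ce : tauV ce = - ce.
Proof.
apply: serP => w x; rewrite serN !sfunE (deg_eps _ (etaV_additive w) (etaV_degw w)).
rewrite linear_sgn /= -!sgnzDn -[X in sgnz _ X]/(geps (geps (etaV w x))) epsVK.
by rewrite addrCA subrr addr0.
Qed.

Let tau_ch : tauV ch = - ch.
Proof.
apply: tau_cst => x; rewrite (deg_eps _ (linear_additive h) h_deg).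
by rewrite linear_sgn /= -[X in sgnz _ X]/(geps (geps (h x))) epsVK.
Qed.

Let cipE : 1 - cd * ch - ch * cd = cip.
Proof.
apply: serP => w x; rewrite !serD !serN !cstMl ser1 !sfunE.
case: w => [|u w]; last by rewrite !linear0 !addr0.
by rewrite -addrA -opprD -h_homotopy subKr.
Qed.

Let ch_lin : lin_words (sfun ch). Proof. exact: lin_words_cst. Qed.
Let ch_degw : degw (V := V) (W := V) (-1) (sfun ch).
Proof. exact: degw_cst. Qed.

Let good (f : S) := lin_words (sfun f) /\ degw (V := V) (W := V) 0 (sfun f).

Let inverse (N : S) : good N -> (forall x, sfun N [::] x = 0) ->
  exists Y : S, [/\ (1 + N) * Y = 1, Y * (1 + N) = 1 & good Y].
Proof.
move=> [lN dN] N0; have [Y [Y1 Y2 hY]] := series_inverse N0.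
have g1 : good 1.
  have -> : good 1 = good (cst L (linear_additive (idfun : {linear V -> V}))).
    by congr good; apply: serP => w x; rewrite ser1 sfunE.
  split; first exact: lin_words_cst.
  by apply: degw_cst => n x hx; rewrite add0r.
have gN f : good f -> good (1 - N * f).
  move=> [lf df]; split.
    exact: (lin_words_sub g1.1 (lin_words_conv lN lf)).
  exact: (degw_sub g1.2 (degw_conv dN df)).
exists Y; split=> //; split.
  by apply: lin_words_local => n; have [f [lf _] e] := hY good g1 gN n; exists (sfun f).
by apply: degw_local => n; have [f [_ df] e] := hY good g1 gN n; exists (sfun f).
Qed.

Let comp_conv (M N' : lmodType A) (q : {linear V -> M}) (r : N' -> V) (f g : S) w x :
  conv (fun w v => q (sfun f w (i v))) (fun w y => p (sfun g w (r y))) w x =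
  q (sfun (f * cip * g) w (r x)).
Proof.
rewrite serM !conv_big linear_sum; apply: eq_bigr => j _.
by rewrite cstMr.
Qed.

Let p_eps x : p (geps x) = geps (p x).
Proof. exact: (deg_eps _ (linear_additive p) p_deg). Qed.

Let i_eps f : i (geps f) = geps (i f).
Proof. exact: (deg_eps _ (linear_additive i) i_deg). Qed.

(** On words of scalars the perturbation is, up to sign, multiplication on one letter and
    zero otherwise; hence the side conditions [h i = 0] and [p h = 0] kill all the
    higher terms of the transferred structure there. *)
Let h_etaV_scalars s f : h (etaV [seq a%:L | a <- s] (i f)) = 0.
Proof.
rewrite etaV_scalars; case: s => [|a [|b s]]; rewrite ?linear0 //.
by rewrite linearZ /= -i_eps hi scaler0.
Qed.

Let p_etaV_scalars s x : p (etaV [seq a%:L | a <- s] (h x)) = 0.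
Proof.
rewrite etaV_scalars; case: s => [|a [|b s]]; rewrite ?linear0 //.
by rewrite linearZ /= p_eps ph linear0 scaler0.
Qed.

Let killed_right (f : S) s x : sfun (f * (ch * ce)) [seq a%:L | a <- s] (i x) = 0.
Proof.
rewrite serM conv_big big1 // => j _.
by rewrite cstMl -map_drop [h _]h_etaV_scalars (addmap0 (sfun_additive f _)).
Qed.

Let killed_left (f : S) s x : p (sfun (ce * (ch * f)) [seq a%:L | a <- s] x) = 0.
Proof.
rewrite serM conv_big linear_sum big1 // => j _.
by rewrite cstMl -map_take [p _]p_etaV_scalars.
Qed.

(** The perturbation lemma.  With [Y] and [Z] the inverses of [1 + eta h] and
    [1 + h eta], the transferred element is [p Y eta i], the map from [E] to [F] is
    [p Y] restricted to [E], and the map from [F] to [E] is the component of [Z i]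
    in [E].  One construction serves both directions. *)
Lemma transfer : exists (phi : multimap D F F) (a : multimap D E F) (b : multimap D F E),
  [/\ MC phi,
      [/\ in_Q 0 a, P_is_P0 a a0 & forall u e, dMC eta phi 0 a u e = 0] &
      [/\ in_Q 0 b, P_is_P0 b b0 & forall u e, dMC phi eta 0 b u e = 0]].
Proof.
have gN : good (ce * ch).
  by split; [apply: (lin_words_conv etaV_lin ch_lin)|apply: (degw_conv etaV_degw ch_degw)].
have gN' : good (ch * ce).
  by split; [apply: (lin_words_conv ch_lin etaV_lin)|apply: (degw_conv ch_degw etaV_degw)].
have [|Y [Yr Yl gY]] := inverse gN.
  by move=> x; rewrite cstMr; apply: etaV_nil.
have [|Z [Zr Zl gZ]] := inverse gN'.
  by move=> x; rewrite cstMl [sfun ce _ _]etaV_nil linear0.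
pose X := Y * ce.
have XE : X = ce * Z by apply: inverse_swap Yl Zr.
have pD := parD (@Lmul C A cA D) epsD; have pM := parM (@Lmul C A cA D) epsD epsVK.
have pch : parV ch = 0 by apply: par_cst.
have t1 : tauV 1 = 1 by apply: tau1.
have mcX := transferred_mc pD pM pch tau_ch tau_ce ring_mc Yl Yr Zr erefl.
have mcY := transferred_left pD pM pch tau_ch tau_ce t1 ring_mc Yl Yr erefl.
have mcZ := transferred_right pD pM pch tau_ch tau_ce t1 ring_mc Yl Yr Zr erefl.
rewrite cipE -/X in mcX mcY mcZ.
have [lX dX] : lin_words (sfun X) /\ degw (V := V) (W := V) 1 (sfun X).
  by split; [apply: (lin_words_conv gY.1 etaV_lin)|apply: (degw_conv gY.2 etaV_degw)].
have [j jE] : exists j : {linear TE -> V}, forall e, j e = (e, 0).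
  by apply: linear_exists => c x y; rewrite pair_linearl.
have [q qE] : exists q : {linear V -> TE}, forall x, q x = x.1.
  by apply: linear_exists => c x y.
have j_deg : deg 0 j.
  by move=> n e he; rewrite jE; apply/gprod_homE; split; [rewrite add0r|apply: hom0].
have q_deg : deg 0 q.
  by move=> n x /gprod_homE [hx _]; rewrite qE add0r.
have q_eps x : q (geps x) = geps (q x) by rewrite !qE.
pose phiH (w : seq L) (f : TF) : TF := p (sfun X w (i f)).
pose aH (w : seq L) (e : TE) : TF := p (sfun Y w (j e)).
pose bH (w : seq L) (f : TF) : TE := q (sfun Z w (i f)).
have phi_lin : lin_words phiH by apply: lin_words_post; apply: lin_words_pre.
have a_lin : lin_words aH by apply: lin_words_post; apply: lin_words_pre; case: gY.
have b_lin : lin_words bH by apply: lin_words_post; apply: lin_words_pre; case: gZ.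
have phi_degw : degw 1 phiH by apply: (degw_post p_deg); apply: (degw_pre i_deg).
have a_degw : degw 0 aH.
  by apply: (degw_post p_deg); apply: (degw_pre j_deg); case: gY.
have b_degw : degw 0 bH.
  by apply: (degw_post q_deg); apply: (degw_pre i_deg); case: gZ.
pose phi : multimap D F F := hat phiH; pose a : multimap D E F := hat aH.
pose b : multimap D F E := hat bH.
have phiQ : in_Q 1 phi.
  apply/in_QP; split; first exact: hat_degw.
  exact: (hat_lin_words (V := TF) (W := TF)).
have aQ : in_Q 0 a.
  apply/in_QP; split; first exact: hat_degw.
  exact: (hat_lin_words (V := TE) (W := TF)).
have bQ : in_Q 0 b.
  apply/in_QP; split; first exact: hat_degw.
  exact: (hat_lin_words (V := TF) (W := TE)).
have phiK : hat (V := TF) (W := TF) phi = phiH by apply/funext => w; apply/funext => e; apply: hatK.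
have aK : hat (V := TE) (W := TF) a = aH by apply/funext => w; apply/funext => e; apply: hatK.
have bK : hat (V := TF) (W := TE) b = bH by apply/funext => w; apply/funext => e; apply: hatK.
have etaQ := MC_Q1 heta.
have phiA w : additive_map (phi w) by have [_ []] := (in_QP _ _).1 phiQ.
have aA w : additive_map (a w) by have [_ []] := (in_QP _ _).1 aQ.
have bA w : additive_map (b w) by have [_ []] := (in_QP _ _).1 bQ.
have etaA w : additive_map (eta w) by have [_ []] := (in_QP _ _).1 etaQ.
have phi_mc w (f : TF) : tdiff F (phiH w f) + phiH w (tdiff F f) + conv phiH phiH w f
    + geps (Delta phiH w f : TF) = 0.
  have := congr1 (fun s : S => p (sfun s w (i f))) mcX.
  rewrite !serD cstMl cstMr ser0 !linearD linear0 /= p_diff -i_diff -comp_conv sfunE p_eps.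
  by rewrite -(delta_compl _ _ _ _ (linear_additive p)) -delta_compr.
have a_closed w (e : TE) : tdiff F (aH w e) - aH w (tdiff E e) + geps (Delta aH w e : TF)
    + conv phiH aH w e - conv aH etaE w e = 0.
  have := congr1 (fun s : S => p (sfun s w (j e))) mcY.
  rewrite !serD !serN cstMl cstMr ser0 !linearD !linearN linear0 /= p_diff.
  have -> : dV (j e) = j (tdiff E e) by rewrite dVE !jE linear0.
  rewrite -comp_conv sfunE p_eps.
  rewrite -(delta_compl _ _ _ _ (linear_additive p)) -(delta_compr _ j).
  have -> : p (sfun X w (j e)) = conv aH etaE w e.
    rewrite serM !conv_big linear_sum; apply: eq_bigr => k _.
    have s0 v : strict v 0 = 0 by exact: (addmap0 (lw_addE strict_lin_words v)).
    by rewrite /aH !jE -[sfun ce _ _]/(etaE _ e, strict _ 0) s0.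
  move=> <-.
  by rewrite [LHS](ACl (1*4*2*5*3)) /=.
have b_closed w (f : TF) : tdiff E (bH w f) - bH w (tdiff F f) + geps (Delta bH w f : TE)
    + conv etaE bH w f - conv bH phiH w f = 0.
  have := congr1 (fun s : S => q (sfun s w (i f))) mcZ.
  rewrite !serD !serN cstMl cstMr ser0 !linearD !linearN linear0 /= -i_diff.
  rewrite -comp_conv sfunE q_eps.
  rewrite -(delta_compl _ _ _ _ (linear_additive q)) -(delta_compr _ i).
  have -> : q (dV (sfun Z w (i f))) = tdiff E (q (sfun Z w (i f))) by rewrite !qE dVE.
  have -> : q (sfun X w (i f)) = conv etaE bH w f.
    rewrite XE serM !conv_big linear_sum; apply: eq_bigr => k _.
    by rewrite qE /bH qE.
  move=> <-.
  by rewrite [LHS](ACl (1*4*2*5*3)) /=.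
(* These recursions isolate the terms that the side conditions kill on scalars. *)
have X_rec : X = ce - X * (ch * ce).
  by rewrite -[ce in ce - _]mul1r -Yl mulrDr mulr1 mulrDl /X !mulrA addrK.
have Y_rec : Y = 1 - ce * (ch * Y) by rewrite -Yr mulrDl mul1r !mulrA addrK.
have Z_rec : Z = 1 - Z * (ch * ce) by rewrite -Zl mulrDr mulr1 addrK.
exists phi, a, b; split.
- split=> // [s f|w f].
    rewrite /restrTA -[phi _ _]/(sgnz _ (p (sfun X _ (i _)))).
    rewrite X_rec serD serN killed_right subr0 [sfun ce _ _]etaV_scalars size_map.
    case: s => [|c [|c' s]]; rewrite ?linear0 ?sgnz0r //.
    by rewrite linearZ /= p_eps pi_id epsK.
  apply: (hat_eq0 (V := TF) (W := TF) (q := fun w f => dQ 1 phi w f + Qmul 1 phi phi w f)).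
  move=> {}w {}f.
  rewrite hatD (hat_dQ _ _ phiQ) (hat_Qmul _ _ phiQ phiA) phiK.
  by rewrite [sgnz 1 _]/= opprK addrAC phi_mc.
- split=> // [s e|w e].
    rewrite /restrTA -[a _ _]/(sgnz _ (p (sfun Y _ (j _)))).
    rewrite Y_rec serD serN linearB /= killed_left subr0 ser1 size_map.
    by case: s => [|c s] /=; rewrite ?linear0 ?sgnz0r // jE p_a0.
  apply: (hat_eq0 (V := TE) (W := TF) (q := dMC eta phi 0 a)) => {}w {}e.
  rewrite hatD hatN hatD (hat_dQ _ _ aQ) (hat_Qmul _ _ aQ phiA) (hat_Qmul _ _ etaQ aA).
  by rewrite phiK aK a_closed.
split=> // [s f|w f].
  rewrite /restrTA -[b _ _]/(sgnz _ (q (sfun Z _ (i _)))).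
  rewrite Z_rec serD serN killed_right subr0 ser1 size_map.
  by case: s => [|c s] /=; rewrite ?linear0 ?sgnz0r // qE i_b0.
apply: (hat_eq0 (V := TF) (W := TE) (q := dMC phi eta 0 b)) => {}w {}f.
rewrite hatD hatN hatD (hat_dQ _ _ bQ) (hat_Qmul _ _ bQ etaA) (hat_Qmul _ _ phiQ bA).
by rewrite phiK bK b_closed.
Qed.

End Perturbation.
End StrictAction.
End Transfer.

(** * Free modules with their action of L, and the theorem *)

Section GradedFree.
Variables (A : comPzRingType) (B : choiceType) (degB : B -> int).
Local Notation P := (Free A B).

Fact mask_finite n (x : P) : finite_support (fun b => if degB b == n then coef x b else 0).
Proof.
by have [s hs] := coef_finite x; exists s => b /hs ->; rewrite if_same.
Qed.
Fact mask_linear n : linear (fun x : P => mkFree (mask_finite n x)).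
Proof.
move=> a x y; apply: coefP => b; rewrite coefD coefZ /coef /=.
by case: eqP; rewrite ?mulr0 ?addr0.
Qed.
Fact sign_finite (x : P) : finite_support (fun b => sgnz (degB b) (coef x b)).
Proof. by have [s hs] := coef_finite x; exists s => b /hs ->; rewrite sgnz0r. Qed.
Fact sign_linear : linear (fun x : P => mkFree (sign_finite x)).
Proof.
move=> a x y; apply: coefP => b; rewrite coefD coefZ /coef /= /sgnz.
by case: odd => //; rewrite opprD mulrN.
Qed.

Lemma coef_mask n x b : coef (linmap (mask_linear n) x) b = if degB b == n then coef x b else 0.
Proof. by []. Qed.
Lemma coef_sign x b : coef (linmap sign_linear x) b = sgnz (degB b) (coef x b).
Proof. by []. Qed.
Lemma coef_sgn n (x : P) b : coef (sgnz n x) b = sgnz n (coef x b).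
Proof. by rewrite /sgnz; case: odd. Qed.

Fact mask_mask m n x : linmap (mask_linear m) (linmap (mask_linear n) x) =
  if m == n then linmap (mask_linear n) x else 0.
Proof.
apply: coefP => b; rewrite !coef_mask.
have [->|h] := eqVneq m n; first by rewrite coef_mask; case: eqP.
by have [->|//] := eqVneq (degB b) m; rewrite (negbTE h).
Qed.
Fact mask_sep x : (forall n, linmap (mask_linear n) x = 0) -> x = 0.
Proof.
move=> h; apply: coefP => b.
by have := congr1 (fun y => coef y b) (h (degB b)); rewrite coef_mask eqxx.
Qed.
Fact mask_fin x :
  exists N : nat, forall n : int, (N < `|n|)%N -> linmap (mask_linear n) x = 0.
Proof.
exists (\max_(b <- supp x) `|degB b|%N) => n hn; apply: coefP => b; rewrite coef_mask.
have [e|//] := eqVneq (degB b) n; apply: suppP.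
apply/negP => hb; move: hn; rewrite ltnNge -e => /negP; apply.
by rewrite (big_rem b) //= leq_maxl.
Qed.
Fact mask_sign n x : linmap (mask_linear n) (linmap sign_linear x) =
  sgnz n (linmap (mask_linear n) x).
Proof.
apply: coefP => b; rewrite coef_mask coef_sign coef_sgn coef_mask.
by have [->|_] := eqVneq; rewrite ?sgnz0r.
Qed.
Definition gFree : gmod A := Gmod mask_mask mask_sep mask_fin mask_sign.

Lemma gFree_hom n (x : gFree) : hom n x <-> forall b, degB b != n -> coef x b = 0.
Proof.
split=> [h b hb|h]; first by rewrite -h coef_mask (negbTE hb).
by apply: coefP => b; rewrite coef_mask; case: eqVneq => // /h ->.
Qed.

Lemma fev_deg (W : gmod A) (v : B -> W) : (forall b, hom (degB b) (v b)) ->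
  deg (V := gFree) 0 (fev v).
Proof.
move=> hv n x /gFree_hom hx; rewrite add0r; apply: hom_sum => b.
have [<-|h] := eqVneq (degB b) n; last by rewrite hx // scale0r; apply: hom0.
by rewrite /hom linearZ /= hv.
Qed.

End GradedFree.

Section FreeAction.
Variables (C A : comPzRingType) (cA : {rmorphism C -> A}) (D : formal_category cA).
Local Notation L := (Lambda D).
Local Notation "u ** v" := (Lmul u v) (at level 40, left associativity).
Local Notation "a %:L" := (Lscal D a) (at level 2, format "a %:L").

(** The action of [L] on functions: [u] acts on [a] as [u] evaluated at the image of [a]
    under the right structure; for the de Rham groupoid this is a differential
    operator applied to a function. *)
Definition Lact (u : L) (a : A) : A := Lfun u (fr D a).

Lemma Lact_additive u : additive_map (Lact u).
Proof. by move=> a b; rewrite /Lact rmorphD; have [h _ _] := LordP u; apply: h. Qed.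

Lemma LactD u v a : Lact (u + v) a = Lact u a + Lact v a. Proof. by []. Qed.

(** The comultiplication sends [r a] to [1 (x) r a]. *)
Lemma LactM u v a : Lact (u ** v) a = Lact u (Lact v a).
Proof.
rewrite /Lact -[Lfun (u ** v) _]/(Lmul_fun u v (fr D a)) /Lmul_fun.
rewrite (comp_eqK (LordP u) (LordP v) (leqnn _) (fc_mr D _ a)).
by rewrite (one_tens_pure _ _ (LordP v)) mul1r.
Qed.

Lemma LactS a b : Lact a%:L b = a * b.
Proof. by rewrite /Lact -[Lfun _ _]/(feps D (fr D b) * a) (fc_epsr D) mulrC. Qed.

Lemma Lact0 u : Lact u 0 = 0. Proof. exact: addmap0 (Lact_additive u). Qed.

Variables (B : choiceType) (degB : B -> int).
Local Notation P := (gFree A degB).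

Fact act_finite u (x : P) : finite_support (fun b => Lact u (coef x b)).
Proof. by have [s hs] := coef_finite x; exists s => b /hs ->; rewrite Lact0. Qed.
Definition free_act u (x : P) : P := mkFree (act_finite u x).

Lemma coef_act u (x : P) b : coef (free_act u x) b = Lact u (coef x b). Proof. by []. Qed.

Lemma free_act_additive u : additive_map (free_act u).
Proof. by move=> x y; apply: coefP => b; rewrite coefD !coef_act -Lact_additive. Qed.
Lemma free_actD u v x : free_act (u + v) x = free_act u x + free_act v x.
Proof. by apply: coefP => b; rewrite coefD !coef_act LactD. Qed.
Lemma free_actM u v x : free_act (u ** v) x = free_act u (free_act v x).
Proof. by apply: coefP => b; rewrite !coef_act LactM. Qed.
Lemma free_actS a x : free_act a%:L x = a *: x.
Proof. by apply: coefP => b; rewrite coef_act coefZ LactS. Qed.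
Lemma free_act_deg u : deg 0 (free_act u).
Proof.
move=> n x /gFree_hom hx; apply/gFree_hom => b; rewrite add0r => /hx h.
by rewrite coef_act h Lact0.
Qed.

End FreeAction.

Section Main.
Variables (C A : comPzRingType) (cA : {rmorphism C -> A}) (D : formal_category cA).
Local Notation L := (Lambda D).

(** The homogeneous part of degree zero of a section is again a section. *)
Lemma graded_section (F : cochain A) (P : gmod A) (q : {linear P -> gtot F}) :
  deg 0 q -> gbounded (gtot F) -> projective (tot F) -> (forall f, exists x, q x = f) ->
  exists s : {linear gtot F -> P}, deg 0 s /\ forall f, q (s f) = f.
Proof.
move=> dq [N hN] pF hq.
have [|s0 hs0] := pF _ _ q (idfun : {linear gtot F -> gtot F}); first by move=> f; apply: hq.
have [s sE] : exists s : {linear gtot F -> P}, forall f,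
    s f = \sum_(n <- ints N) gpr n (s0 (gpr n f)).
  apply: linear_exists => a x y; rewrite scaler_sumr -big_split.
  by apply: eq_bigr => n _; rewrite !linearP.
exists s; split=> [m f hf|f]; rewrite sE.
  apply: hom_sum => n; have [->|h] := eqVneq n m; first by rewrite add0r; apply: gpr_hom.
  by rewrite (gpr_other hf h) !linear0; apply: hom0.
rewrite linear_sum [RHS](@gdecomp_bound _ _ f N) => [|n hn].
  apply: eq_bigr => n _.
  have := deg_pr n (s0 (gpr n f)) (linear_additive q) dq; rewrite add0r => <-.
  by rewrite hs0 gprE eqxx.
by apply: (hN n) => //; apply: gpr_hom.
Qed.

(** The contractible complex [K] is the cone of the identity of the free module [P] on
    the homogeneous elements of [F].  It carries a strict action of [L], since [P] does,
    and it maps onto [F] with a graded section because [F] is projective. *)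
Lemma transfer_exists (E F : cochain A) (eta : multimap D E E) (heta : MC eta)
    (a0 : {linear gtot E -> gtot F}) (b0 : {linear gtot F -> gtot E})
    (hE : {linear gtot E -> gtot E}) (hF : {linear gtot F -> gtot F}) :
  bounded F -> projective (tot F) ->
  deg 0 a0 -> deg 0 b0 -> deg (-1) hE -> deg (-1) hF ->
  (forall e, a0 (tdiff E e) = tdiff F (a0 e)) ->
  (forall f, b0 (tdiff F f) = tdiff E (b0 f)) ->
  (forall e, e - b0 (a0 e) = tdiff E (hE e) + hE (tdiff E e)) ->
  (forall f, f - a0 (b0 f) = tdiff F (hF f) + hF (tdiff F f)) ->
  exists (phi : multimap D F F) (a : multimap D E F) (b : multimap D F E),
  [/\ MC phi,
      [/\ in_Q 0 a, P_is_P0 a a0 & forall u e, dMC eta phi 0 a u e = 0] &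
      [/\ in_Q 0 b, P_is_P0 b b0 & forall u e, dMC phi eta 0 b u e = 0]].
Proof.
move=> bF pF a0_deg b0_deg hE_deg hF_deg a0_diff b0_diff hE_htpy hF_htpy.
pose B : choiceType := {n : int & F n}.
pose P := gFree A (fun b : B => tag b).
pose v (b : B) : gtot F := tinj (tagged b).
pose q : {linear P -> gtot F} := fev v.
have dq : deg 0 q by apply: fev_deg => b; apply: tinj_hom.
have q_surj f : exists x, q x = f.
  have [N e] := gdecomp f.
  exists (\sum_(n <- ints N) unit_vector A (Tagged (fun n => F n) (component (f : tot F) n))).
  rewrite linear_sum [RHS]e; apply: eq_bigr => n _.
  by rewrite -tinj_component; apply: fev_unit.
have [s [ds qs]] := graded_section dq (gtot_bounded bF) pF q_surj.
(* [rho] is forced on the second summand, the boundary of the first being there. *)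
pose K := gprod P (gshift (-1) P).
have [dK dKE] : exists dK : {linear K -> K}, forall k, dK k = (0, k.1).
  by apply: linear_exists => c x y; rewrite -pair_linearr.
have [cK cKE] : exists cK : {linear K -> K}, forall k, cK k = (k.2, 0).
  by apply: linear_exists => c x y; rewrite -pair_linearl.
have [rho rhoE] : exists rho : {linear K -> gtot F}, forall k, rho k = q k.1 + tdiff F (q k.2).
  by apply: linear_exists => c x y; rewrite !linearP scalerDr addrACA.
have [sigma sigmaE] : exists sigma : {linear gtot F -> K}, forall f, sigma f = (s f, 0).
  by apply: linear_exists => c x y; rewrite -pair_linearl linearP.
have dK_deg : deg 1 dK.
  move=> n k /gprod_homE [h1 _]; rewrite dKE; apply/gprod_homE; split; first exact: hom0.
  by apply/gshift_homE; rewrite addrAC addrN add0r.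
have cK_deg : deg (-1) cK.
  move=> n k /gprod_homE [_ /gshift_homE h2]; rewrite cKE addrC.
  by apply/gprod_homE; split=> //; apply: hom0.
have rho_deg : deg 0 rho.
  move=> n k /gprod_homE [h1 /gshift_homE h2]; rewrite rhoE; apply: homD; first exact: dq.
  by have := @tdiff_deg _ F _ _ (dq _ _ h2); rewrite !add0r addrC subrK.
have sigma_deg : deg 0 sigma.
  by move=> n f hf; rewrite sigmaE; apply/gprod_homE; split; [apply: ds|apply: hom0].
have dKK k : dK (dK k) = 0 by rewrite !dKE.
have cKdK k : dK (cK k) + cK (dK k) = k.
  by rewrite !dKE !cKE /=; apply: injective_projections; rewrite /= ?add0r ?addr0.
have rho_diff k : rho (dK k) = tdiff F (rho k).
  by rewrite !rhoE dKE /= linear0 add0r linearD /= tdiffK addr0.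
have rho_sigma f : rho (sigma f) = f.
  by rewrite rhoE sigmaE /= !linear0 addr0 qs.
have [dV [h [p [i [dVE [_ h_deg p_deg i_deg] [p_diff i_diff]
  [pi_id h_htpy ph hi] [p_a0 i_b0]]]]]] := deformation_retraction dK_deg cK_deg dKK cKdK
  rho_deg sigma_deg rho_diff rho_sigma a0_deg b0_deg hE_deg hF_deg a0_diff b0_diff
  hE_htpy hF_htpy.
pose act (u : L) (k : K) : K := (free_act u k.1, free_act u k.2).
apply: (transfer (act := act) _ _ _ _ _ dK_deg _ heta dVE h_deg p_deg i_deg p_diff
  i_diff pi_id h_htpy ph hi p_a0 i_b0).
- by move=> u x y; congr pair; apply: free_act_additive.
- by move=> u w k; congr pair; apply: free_actD.
- by move=> u w k; congr pair; apply: free_actM.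
- by move=> a k; congr pair; apply: free_actS.
- move=> u n k /gprod_homE [h1 /gshift_homE h2]; apply/gprod_homE; split.
    exact: free_act_deg.
  by apply/gshift_homE; rewrite -addrA; apply: free_act_deg.
- move=> u k; rewrite !dKE; congr pair.
  by rewrite (addmap0 (free_act_additive (degB := fun b : B => tag b) u)).
Qed.

End Main.

Theorem lemma4p5 (R : realType) (A : comPzRingType) (cA : {rmorphism R[i] -> A})
    (hA : finitely_generated cA)
    (D : formal_category cA) (hD : smooth_type D)
    (E F : cochain A)
    (hEb : bounded E) (hEf : forall n, locally_free (E n))
    (hFb : bounded F) (hFf : forall n, locally_free (F n))
    (eta : multimap D E E) (heta : MC eta) :
  (forall a0 : chain_map E F, quasi_isomorphism a0 ->
     exists (phi : multimap D F F) (a : multimap D E F),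
       [/\ MC phi, in_Q 0 a, P_is_P0 a (tot_map a0) &
           forall u e, dMC eta phi 0 a u e = 0]) /\
  (forall b0 : chain_map F E, quasi_isomorphism b0 ->
     exists (phi : multimap D F F) (b : multimap D F E),
       [/\ MC phi, in_Q 0 b, P_is_P0 b (tot_map b0) &
           forall u e, dMC phi eta 0 b u e = 0]).
Proof.
have torsion g : bounded_torsion g (A^o : lmodType A).
  by apply: acc_bounded_torsion; apply: finitely_generated_acc hA.
have projE n : projective (E n) by apply: locally_free_projective.
have projF n : projective (F n) by apply: locally_free_projective.
have projTF : projective (tot F) by apply: tot_projective.
split=> [a0 qa0|b0 qb0].
  have [b0 [hE [hF [db0 dhE dhF b0_diff [hE_htpy hF_htpy]]]]] :=
    homotopy_inverse hEb hFb projE projF qa0.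
  have [phi [a [b [? [? ? ?] _]]]] := transfer_exists heta hFb projTF (tmap_deg a0) db0
    dhE dhF (tmap_diff a0) b0_diff hE_htpy hF_htpy.
  by exists phi, a.
have [a0 [hF [hE [da0 dhF dhE a0_diff [hF_htpy hE_htpy]]]]] :=
  homotopy_inverse hFb hEb projF projE qb0.
have [phi [a [b [? _ [? ? ?]]]]] := transfer_exists heta hFb projTF da0 (tmap_deg b0)
  dhE dhF a0_diff (tmap_diff b0) hE_htpy hF_htpy.
by exists phi, b.
Qed.
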